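(* Let $\tilde v_0\in\mathcal{P}_+$, let $\tilde v$ be the solution of the nonlinear heat equation $$\partial_t\tilde v=\partial_{xx}^2\tilde v-V\tilde v+\Big(\int_0^1V(\xi)\tilde v(t,\xi)d\xi\Big)\tilde v,\qquad \partial_x\tilde v(t,0)=\partial_x\tilde v(t,1)=0,\qquad \tilde v(0,\cdot)=\tilde v_0,$$ on its maximal time span $[0,T_*(\tilde v_0)[$, and put $\tilde g(t)=\int_0^1\tilde v(t,\xi)d\xi$, $\tilde g_0=\tilde g(0)$. Then: (i) $\tilde v(t,\cdot)\in\mathcal{P}_+$ for all $t\in[0,T_*(\tilde v_0)[$. (ii) For all $t\in[0,T_*(\tilde v_0)[$: if $\tilde g_0>1$ then $\tilde g(t)>1$; if $\tilde g_0=1$ then $\tilde g(t)=1$; if $\tilde g_0<1$ then $\tilde g_0e^{-t\sup V}\le\tilde g(t)<1$. In particular $\mathcal{P}_1$ is invariant. (iii) If $\tilde g_0\le1$ then $T_*(\tilde v_0)=\infty$ and $\|\tilde v(t,\cdot)\|_{L^2}\le e^{t\sup V}\|\tilde v_0\|_{L^2}$ for all $t\ge0$. (iv) If $\tilde g_0>1$ then $T_*(\tilde v_0)<\infty$: the solution blows up in finite time, and $\tilde v(t,x)$ blows up at all spatial locations $x\in[0,1]$ at the same time, which is the blow-up time of $\tilde g$.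
   Context: $V:[0,1]\to\mathbb{R}$ is a fixed smooth, strictly positive function. $\mathcal{P}_+$ is the set of strictly positive functions on $[0,1]$ which are square integrable together with their first weak derivative (i.e. belong to $H^1$, hence are continuous). $\mathcal{P}_1$ is the set of $v\in\mathcal{P}_+$ with $\int_0^1v(s)ds=1$. Solutions are the local-in-time $L^2([0,1])$-valued solutions (in the Duhamel sense), and $[0,T_*(\tilde v_0)[$ is the maximal interval of existence in $L^2([0,1])$. *)

(* Defs.v *)
From HB Require Import structures.
From mathcomp Require Import all_boot all_order all_algebra.
From mathcomp Require Import all_classical all_reals all_analysis.

Set Implicit Arguments.
Unset Strict Implicit.
Unset Printing Implicit Defensive.
Import Order.TTheory GRing.Theory Num.Theory.
Import numFieldNormedType.Exports.

Local Open Scope classical_set_scope.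
Local Open Scope ring_scope.

(* A function on [0, 1] is encoded by a function R -> R whose values outside  *)
(* [0, 1] are irrelevant, and an element of L^2([0, 1]) by any representative *)
(* of its class.                                                              *)

Section Defs.
Context {R : realType}.
Implicit Types (f g u w V phi : R -> R) (v h : R -> R -> R).

Local Notation mu := (@lebesgue_measure R).
Local Notation I := (`[0, 1]%classic : set R).

Definition smooth f : Prop := forall (n : nat) (x : R), derivable (f^`(n))%classic x 1.

Definition smooth_on01 f : Prop :=
  exists F : R -> R, smooth F /\ {in I, f =1 F}.

Definition L2 f : Prop := (f \_ I) \in Lfun mu 2%:E.

Definition L2norm f : \bar R := 'N[mu]_(2%:E)[EFin \o (f \_ I)]%E.

Definition dotL2 f g : R := \int[mu]_(x in I) (f x * g x).

Definition mass f : R := \int[mu]_(x in I) f x.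

Definition ae_eq01 f g : Prop := f = g %[ae mu in I].

Definition test_function phi : Prop :=
  smooth phi /\ closure [set x | phi x != 0] `<=` `]0, 1[.

Definition weak_derivative f g : Prop :=
  forall phi, test_function phi -> dotL2 f (phi^`())%classic = - dotL2 g phi.

Definition Pplus f : Prop :=
  [/\ forall x, x \in I -> 0 < f x,
      {within I, continuous f},
      L2 f &
      exists g, L2 g /\ weak_derivative f g].

Definition Pone f : Prop := Pplus f /\ mass f = 1.

(* Membership in P of the almost everywhere class of f. *)
Definition class_in (P : (R -> R) -> Prop) f : Prop :=
  exists u, P u /\ ae_eq01 u f.

(* The L^2-normalized eigenfunctions of the Neumann Laplacian on [0, 1];      *)
(* eigenfunction n has eigenvalue - (n pi)^2.                                 *)
Definition neumann_basis (n : nat) (x : R) : R :=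
  if n is 0 then 1 else Num.sqrt 2 * cos (n%:R * pi * x).

(* The semigroup exp(t d_xx) with Neumann boundary conditions. For 0 < t and  *)
(* f in L^2 the spectral series converges uniformly; it need not converge     *)
(* pointwise for t = 0, where the semigroup is the identity.                  *)
Definition neumann_heat (t : R) f : R -> R :=
  if 0 < t then
    fun x => limn (series (fun n : nat =>
      expR (- ((n%:R * pi) ^+ 2 * t)) * dotL2 f (neumann_basis n)
        * neumann_basis n x))
  else f.

Definition reaction V f (x : R) : R := - (V x * f x) + dotL2 V f * f x.

(* w is the L^2-valued integral of h over [a, b]: h is scalarly integrable    *)
(* and w represents the functional phi |-> \int_a^b <h s, phi> ds. For a norm *)
(* continuous h this is the Bochner (and Riemann) integral of h.              *)
Definition is_L2_integral h (a b : R) w : Prop :=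
  L2 w /\ forall phi, L2 phi ->
    mu.-integrable `[a, b] (fun s => (dotL2 (h s) phi)%:E) /\
    dotL2 w phi = \int[mu]_(s in `[a, b]) dotL2 (h s) phi.

Definition timespan (T : \bar R) : set R := [set t | 0 <= t /\ (t%:E < T)%E].

(* v is in C([0, T[, L^2) and                                                 *)
(*   v(t) = e^{t d_xx} v0 + \int_0^t e^{(t-s) d_xx} (reaction V (v s)) ds.    *)
Definition mild_solution V (v0 : R -> R) (T : \bar R) v : Prop :=
  [/\ forall t, timespan T t -> L2 (v t),
      forall s, timespan T s ->
        L2norm (v t \- v s) @[t --> within (timespan T) (nbhs s)] --> 0%E,
      ae_eq01 (v 0) v0 &
      forall t, timespan T t ->
        is_L2_integral (fun s => neumann_heat (t - s) (reaction V (v s))) 0 t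
                       (v t \- neumann_heat t v0)].

(* Right end of the maximal interval of existence. The set below contains 0,  *)
(* so that this is always nonnegative.                                        *)
Definition Tmax V (v0 : R -> R) : \bar R :=
  ereal_sup [set T | exists v, mild_solution V v0 T v].

(* u consists of the continuous representatives of the classes v t. *)
Definition continuous_version (T : \bar R) v (u : R -> R -> R) : Prop :=
  forall t, timespan T t ->
    {within I, continuous (u t)} /\ ae_eq01 (u t) (v t).

End Defs.

(* Main.v *)
(* The nonlinearity only multiplies the solution by a function of time. Let
   K = sup V and let z solve the linear equation z' = z_xx + (K - V) z with
   z(0) = v0. As K - V >= 0, Picard iteration and the positivity of the Neumann
   heat semigroup S give S(t) v0 <= z(t) <= e^(K t) S(t) v0. The damped mass
   m(t) = e^(-K t) \int z(t) satisfies m' = - e^(-K t) <V, z>, so that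
   v(t) = e^(-K t) z(t) / (1 - g0 + m(t)), with g0 = \int v0, solves the
   nonlinear equation and has mass m(t) / (1 - g0 + m(t)). Since inf V > 0, m
   decreases strictly from g0 to 0: the denominator stays positive if g0 <= 1
   and vanishes at exactly one time if g0 > 1. A Gronwall argument in L^2 shows
   that every mild solution coincides with this one and that none outlives it.
   Everywhere blow-up follows from z >= S(t) v0 >= min v0 > 0. Membership in
   H^1 at t > 0 follows from the summability of n |z_n(t)|, with z_n(t) the
   cosine coefficients. *)

Require Import Defs.
From HB Require Import structures.
From mathcomp Require Import all_boot all_order all_algebra.
From mathcomp Require Import all_classical all_reals all_analysis.
From mathcomp Require Import measurable_realfun.
From mathcomp Require Import ring lra.

Set Implicit Arguments.
Unset Strict Implicit.
Unset Printing Implicit Defensive.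
Import Order.TTheory GRing.Theory Num.Theory.
Import numFieldNormedType.Exports.

Local Open Scope classical_set_scope.
Local Open Scope ring_scope.


(** [neumann_heat] is given only as a cosine series, so its order structure has to be extracted from
    the multipliers. Positivity comes from Poisson kernels and random walks; it yields strong
    continuity by Korovkin's argument on 1, cos(pi x), cos(2 pi x); strong continuity makes cosine
    coefficients separate continuous functions ([coef_inj]). From there on, identities between
    curves are checked coefficient by coefficient, as scalar linear equations. The quotient solves
    the nonlinear equation because w = e^(-K t) z satisfies w' = w_xx - V w, with mass m such that
    m' = - <V, w>. With q = 1 - g0 + m, dividing w by q adds the term - q' / q times w / q, and - q'
    / q = <V, w / q> is the nonlocal factor. The delicate point is H^1 at t > 0. Bounded source
    coefficients only give n |z_n| = O(1 / n), which just misses summability. *)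

Section L2_facts.
Context {R : realType}.
Implicit Types (f g u w : R -> R).

Local Notation mu := (@lebesgue_measure R).
Local Notation I := (`[0, 1]%classic : set R).

Lemma I01E (x : R) : I x <-> 0 <= x <= 1.
Proof. by rewrite /= in_itv. Qed.

Lemma integrable01_cont f : {within I, continuous f} ->
  mu.-integrable I (EFin \o f).
Proof.
by move=> cf; apply: continuous_compact_integrable => //; exact: segment_compact.
Qed.

Lemma lebesgue01 : mu I = 1%E.
Proof. by rewrite lebesgue_measure_itv/= lte_fin ltr01 oppr0 adde0. Qed.

Lemma Rintegral_cst01 (c : R) : \int[mu]_(x in I) c = c.
Proof.
rewrite Rintegral_cst; last exact: measurable_itv.
by have /= -> := lebesgue01; rewrite mulr1.
Qed.

Lemma within_bounded (a b : R) f : {within `[a, b], continuous f} ->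
  exists M, 0 <= M /\ forall x, a <= x <= b -> `|f x| <= M.
Proof.
move=> cf.
have := continuous_compact cf (@segment_compact R a b).
move=> /compact_bounded[M [_ mrt]].
exists `|M + 1|; split => // x xab.
have MM : M < `|M + 1| by rewrite (lt_le_trans _ (ler_norm _))// ltrDl.
by apply: (mrt _ MM); exists x => //=; rewrite in_itv.
Qed.

Lemma L2_restrict f : L2 f <->
  measurable_fun I f /\ mu.-integrable I (EFin \o (fun x => f x ^+ 2)).
Proof.
rewrite /L2; split.
  move=> lf; split.
    move: (lf); rewrite inE => /andP[+ _]; rewrite inE/= => mf.
    by apply/(measurable_restrictT f); first exact: measurable_itv.
  have := Lfun2_integrable_sqr lf => h.
  apply/integrable_mkcond; first exact: measurable_itv.
  apply: eq_integrable h => //= x _; rewrite /patch/=.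
  by case: ifPn => // _; rewrite expr0n.
move=> [mf if2]; rewrite inE; apply/andP; split.
  rewrite inE/=; apply/(measurable_restrictT f) => //; exact: measurable_itv.
rewrite inE/= /finite_norm unlock poweR_lty//.
have /integrableP[_] : mu.-integrable setT ((EFin \o (fun x => f x ^+ 2)) \_ I).
  by apply/(integrable_mkcond _ _).1 => //; exact: measurable_itv.
apply: le_lt_trans; rewrite le_eqVlt; apply/orP; left; apply/eqP.
apply: eq_integral => x _ /=; rewrite /patch; case: ifPn => _ /=.
  by rewrite powR_mulrn ?normr_ge0// normrX.
by rewrite normr0 powR0// pnatr_eq0.
Qed.

Lemma L2_cont f : {within I, continuous f} -> L2 f.
Proof.
move=> cf; apply/L2_restrict; split.
  by apply: subspace_continuous_measurable_fun => //; exact: measurable_itv.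
apply: integrable01_cont => x.
by apply: continuousM; exact: cf.
Qed.

Lemma L2_measurable f : L2 f -> measurable_fun I f.
Proof. by case/L2_restrict. Qed.

Lemma L2_mul f g : L2 f -> L2 g -> mu.-integrable I (EFin \o (f \* g)).
Proof.
move=> lf lg; have /Lfun1_integrable := Lfun2_mul_Lfun1 lf lg.
move=> h; apply/integrable_mkcond; first exact: measurable_itv.
apply: eq_integrable h => //= x _; rewrite /patch/=.
by case: ifPn => // _; rewrite mul0r.
Qed.

Lemma L2_ext f g : {in I, f =1 g} -> L2 f -> L2 g.
Proof.
move=> fg; rewrite /L2; suff -> : f \_ I = g \_ I by [].
by apply/funext => x; rewrite /patch; case: ifPn => // /fg.
Qed.

Lemma L2D f g : L2 f -> L2 g -> L2 (f \+ g).
Proof.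
move=> lf lg; rewrite /L2; suff -> : (f \+ g) \_ I = f \_ I + g \_ I.
  by apply: (Lfun_addr_closed _ _).2 => //; rewrite lee1n.
by apply/funext => x; rewrite /patch/= fctE; case: ifPn => // _; rewrite addr0.
Qed.

Lemma L2Z (c : R) f : L2 f -> L2 (fun x => c * f x).
Proof.
move=> lf; rewrite /L2; suff -> : (fun x => c * f x) \_ I = c \o* (f \_ I).
  by apply: Lfun_scale => //; rewrite ler1n.
by apply/funext => x; rewrite /patch/=; case: ifPn => _; rewrite ?mul0r// mulrC.
Qed.

Lemma L2N f : L2 f -> L2 (\- f).
Proof.
by move=> /(L2Z (-1)); apply: L2_ext => x _ /=; rewrite mulN1r.
Qed.

Lemma L2B f g : L2 f -> L2 g -> L2 (f \- g).
Proof. by move=> lf /L2N lg; apply: L2_ext (L2D lf lg). Qed.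

Lemma L2M_bounded f g (M : R) : measurable_fun I f ->
  (forall x, I x -> `|f x| <= M) -> L2 g -> L2 (f \* g).
Proof.
move=> mf fM /L2_restrict[mg ig]; apply/L2_restrict; split.
  exact: measurable_funM.
have iM : mu.-integrable I (fun x => (M ^+ 2)%:E * (EFin \o (fun x => g x ^+ 2)%R) x)%E.
  by apply: integrableZl => //; exact: measurable_itv.
apply: le_integrable iM => //.
- by apply/measurable_EFinP; apply: measurable_funX; exact: measurable_funM.
- move=> x Ix /=; rewrite lee_fin exprMn normrM [leRHS]normrM.
  rewrite ler_wpM2r// !normrX ler_pXn2r ?nnegrE//.
  by rewrite (le_trans (fM _ Ix))// ler_norm.
Qed.

Lemma L2_cst (c : R) : L2 (fun=> c).
Proof. by apply: L2_cont => x; exact: cst_continuous. Qed.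

Lemma L2_integrable f : L2 f -> mu.-integrable I (EFin \o f).
Proof.
move=> lf; have := L2_mul lf (L2_cst 1).
by apply: eq_integrable => //= x _; rewrite mulr1.
Qed.

Lemma L2_sum (J : Type) (r : seq J) (F : J -> R -> R) :
  (forall j, L2 (F j)) -> L2 (fun x => \sum_(j <- r) F j x).
Proof.
move=> lF; elim: r => [|j r IH].
  by apply: L2_ext (L2_cst 0) => x _; rewrite big_nil.
by apply: L2_ext (L2D (lF j) IH) => x _; rewrite big_cons.
Qed.

Lemma dotC f g : dotL2 f g = dotL2 g f.
Proof. by apply: eq_Rintegral => x _; rewrite mulrC. Qed.

Lemma eq_dot f f' g g' : {in I, f =1 f'} -> {in I, g =1 g'} ->
  dotL2 f g = dotL2 f' g'.
Proof. by move=> ff' gg'; apply: eq_Rintegral => x xI; rewrite ff'// gg'. Qed.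

Lemma dotDl f g w : L2 f -> L2 g -> L2 w ->
  dotL2 (f \+ g) w = dotL2 f w + dotL2 g w.
Proof.
move=> lf lg lw; rewrite /dotL2 -RintegralD//; [|exact: L2_mul..].
by apply: eq_Rintegral => x _ /=; rewrite mulrDl.
Qed.

Lemma dotZl (c : R) f w : L2 f -> L2 w ->
  dotL2 (fun x => c * f x) w = c * dotL2 f w.
Proof.
move=> lf lw; rewrite /dotL2 -RintegralZl//; last exact: L2_mul.
by apply: eq_Rintegral => x _ /=; rewrite mulrA.
Qed.

Lemma dotNl f w : L2 f -> L2 w -> dotL2 (\- f) w = - dotL2 f w.
Proof.
move=> lf lw; rewrite -[RHS]mulN1r -dotZl//.
by apply: eq_dot => // x _ /=; rewrite mulN1r.
Qed.

Lemma dotBl f g w : L2 f -> L2 g -> L2 w ->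
  dotL2 (f \- g) w = dotL2 f w - dotL2 g w.
Proof. by move=> lf lg lw; rewrite -dotNl// -dotDl//; exact: L2N. Qed.

Lemma dotDr f g w : L2 f -> L2 g -> L2 w ->
  dotL2 w (f \+ g) = dotL2 w f + dotL2 w g.
Proof. by move=> *; rewrite dotC dotDl// !(dotC w). Qed.

Lemma dotBr f g w : L2 f -> L2 g -> L2 w ->
  dotL2 w (f \- g) = dotL2 w f - dotL2 w g.
Proof. by move=> *; rewrite dotC dotBl// !(dotC w). Qed.

Lemma dotZr (c : R) f w : L2 f -> L2 w ->
  dotL2 w (fun x => c * f x) = c * dotL2 w f.
Proof. by move=> *; rewrite dotC dotZl// dotC. Qed.

Lemma dot_suml (J : Type) (r : seq J) (F : J -> R -> R) w :
  (forall j, L2 (F j)) -> L2 w ->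
  dotL2 (fun x => \sum_(j <- r) F j x) w = \sum_(j <- r) dotL2 (F j) w.
Proof.
move=> lF lw; elim: r => [|j r IH].
  rewrite big_nil (_ : dotL2 _ w = dotL2 (fun x => 0 * 1) w).
    by rewrite dotZl// ?mul0r//; exact: L2_cst.
  by apply: eq_dot => // x _; rewrite big_nil mul0r.
rewrite big_cons -IH -dotDl//; last exact: L2_sum.
by apply: eq_dot => // x _; rewrite big_cons.
Qed.

Lemma dot_ge0 f : 0 <= dotL2 f f.
Proof. by apply: Rintegral_ge0 => x _; rewrite -expr2 sqr_ge0. Qed.

(** Expanding the square of a f - s g for s = 1 and s = -1. Being linear in the squared norms, this
    form can be summed over coefficients, and its weight can be tuned in the Gronwall step. *)
Lemma dot_young (a : R) f g : 0 < a -> L2 f -> L2 g ->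
  `|dotL2 f g| <= (a * dotL2 f f + a^-1 * dotL2 g g) / 2.
Proof.
move=> a0 lf lg.
have key : forall s : R, s ^+ 2 = 1 ->
    s * dotL2 f g <= (a * dotL2 f f + a^-1 * dotL2 g g) / 2.
  move=> s s1.
  have : 0 <= dotL2 ((fun x => a * f x) \- (fun x => s * g x))
                    ((fun x => a * f x) \- (fun x => s * g x)) by exact: dot_ge0.
  have la := L2Z a lf; have ls := L2Z s lg.
  rewrite dotBl ?dotBr//; [|exact: L2B..].
  rewrite !dotZl// !dotZr// (dotC g f).
  set p := dotL2 f f; set q := dotL2 f g; set r := dotL2 g g.
  move=> h; rewrite ler_pdivlMr//.
  have -> : a * p + a^-1 * r = a^-1 * (a * (a * p) + s * (s * r)).
    rewrite mulrDr mulKf ?gt_eqF//; congr (_ + _ * _).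
    by rewrite mulrA -expr2 s1 mul1r.
  by rewrite -(ler_pM2l a0) mulVKf ?gt_eqF//; nra.
rewrite ler_norml lerNl -mulN1r key ?sqrrN ?expr1n//=.
by have := key 1; rewrite expr1n mul1r; exact.
Qed.

Lemma dot_ae f f' g : L2 f -> L2 f' -> L2 g -> ae_eq01 f f' ->
  dotL2 f g = dotL2 f' g.
Proof.
move=> lf lf' lg ff'; rewrite /dotL2 /Rintegral; congr fine.
apply: ae_eq_integral => //.
- exact: (measurable_int mu (L2_mul lf lg)).
- exact: (measurable_int mu (L2_mul lf' lg)).
- apply: filterS ff'; first exact: (ae_filter_ringOfSetsType mu).
  by move=> x h /h ->.
Qed.

Lemma dot0_ae f : L2 f -> dotL2 f f = 0 -> ae_eq01 f (fun=> 0).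
Proof.
move=> lf f0.
have m2 : measurable_fun I (EFin \o (f \* f)%R).
  exact: (measurable_int mu (L2_mul lf lf)).
have : (\int[mu]_(x in I) `|(EFin \o (f \* f)%R) x| = 0)%E.
  rewrite (_ : \int[mu]_(x in I) _ = \int[mu]_(x in I) (f x * f x)%:E)%E.
    transitivity (dotL2 f f)%:E; last by rewrite f0.
    by rewrite /dotL2 /Rintegral fineK//; exact: (integrable_fin_num _ (L2_mul lf lf)).
  by apply: eq_integral => x _ /=; rewrite -expr2 ger0_norm// sqr_ge0.
move/ae_eq_integral_abs; move=> /(_ (measurable_itv _) m2).
move=> H; apply: filterS H => x h /h /= [] /eqP; rewrite mulf_eq0 orbb => /eqP //.
Qed.

Lemma L2norm_dot f : L2 f -> (L2norm f `^ 2 = (dotL2 f f)%:E)%E.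
Proof.
move=> lf; rewrite /L2norm poweR_Lnorm// /dotL2 /Rintegral fineK.
  rewrite [RHS]integral_mkcond; apply: eq_integral => x _ /=.
  rewrite /patch; case: ifPn => _ /=; last by rewrite normr0 powR0// pnatr_eq0.
  by rewrite powR_mulrn ?normr_ge0// -normrX expr2 ger0_norm// -expr2 sqr_ge0.
exact: (integrable_fin_num _ (L2_mul lf lf)).
Qed.

Lemma L2norm_sqrt f : L2 f -> (L2norm f = (Num.sqrt (dotL2 f f))%:E)%E.
Proof.
move=> lf; have := L2norm_dot lf.
move/(congr1 (fun y => y `^ 2^-1)%E); rewrite -poweRrM divff// poweRe1.
  by move=> ->; rewrite poweR_EFin powR12_sqrt// dot_ge0.
exact: Lnorm_ge0.
Qed.

End L2_facts.

(** * Absolutely convergent series and Tannery's theorem *)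

Section series_facts.
Context {R : realType}.
Implicit Types (a b M : nat -> R).

Lemma summable_norm a : cvgn (series (fun n => `|a n|)) -> cvgn (series a).
Proof. exact: (@normed_cvg R R^o). Qed.

Lemma summable_le a M : (forall n, `|a n| <= M n) -> cvgn (series M) ->
  cvgn (series (fun n => `|a n|)).
Proof.
move=> aM cM; apply: (series_le_cvg _ _ aM cM) => n //.
by rewrite (le_trans _ (aM n)).
Qed.

Lemma series_tail a M (N : nat) : (forall n, `|a n| <= M n) -> cvgn (series M) ->
  `|limn (series a) - series a N| <= limn (series M) - series M N.
Proof.
move=> aM cM.
have ca : cvgn (series a) by exact/summable_norm/(summable_le aM).
have h1 : (fun n => `|series a n - series a N|) @ \oo -->
    `|limn (series a) - series a N|.
  by apply: cvg_norm; apply: cvgB => //; exact: cvg_cst.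
have h2 : (fun n => series M n - series M N) @ \oo -->
    limn (series M) - series M N.
  by apply: cvgB => //; exact: cvg_cst.
rewrite -(cvg_lim _ h1)// -(cvg_lim _ h2)//; apply: ler_lim.
- by apply/cvg_ex; eexists; exact: h1.
- by apply/cvg_ex; eexists; exact: h2.
near=> n.
have Nn : (N <= n)%N by near: n; exact: nbhs_infty_ge.
rewrite !sub_series_geq// (le_trans (ler_norm_sum _ _ _))// ler_sum// => i _.
Unshelve. all: by end_near. Qed.

Lemma series_tail0 M : cvgn (series M) -> forall e, 0 < e ->
  exists N, `|limn (series M) - series M N| < e.
Proof.
move=> cM e e0; have /cvgrPdist_lt /(_ e e0) [N _ h] := cM.
by exists N; apply: h => /=.
Qed.

Lemma cvgr_le_near (T : Type) (F : set_system T) (FF : ProperFilter F)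
    (f : T -> R) (l M : R) :
  f x @[x --> F] --> l -> (\forall x \near F, f x <= M) -> l <= M.
Proof.
move=> fl fM; rewrite -(cvg_lim _ fl)//; apply: limr_le => //.
by apply/cvg_ex; exists l.
Qed.

Lemma cvgr_ge_near (T : Type) (F : set_system T) (FF : ProperFilter F)
    (f : T -> R) (l M : R) :
  f x @[x --> F] --> l -> (\forall x \near F, M <= f x) -> M <= l.
Proof.
move=> fl fM; rewrite -(cvg_lim _ fl)//; apply: limr_ge => //.
by apply/cvg_ex; exists l.
Qed.

Lemma cvg_series_fin (T : Type) (F : set_system T) (FF : ProperFilter F)
    (u : T -> nat -> R) (l : nat -> R) (N : nat) :
  (forall n, u k n @[k --> F] --> l n) ->
  series (u k) N @[k --> F] --> series l N.
Proof.
move=> ul; elim: N => [|N IH].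
  rewrite /series /=; under eq_fun do rewrite big_geq//.
  by rewrite big_geq//; exact: cvg_cst.
rewrite /series /=; under eq_fun do rewrite big_nat_recr//=.
by rewrite big_nat_recr//=; apply: cvgD => //; exact: IH.
Qed.

(** Dominated convergence for series: a tail of [M] controls both remainders, and the remaining
    finite sum converges termwise. The arbitrary filter lets it serve limits along the integers,
    continuity at a point, and derivatives. *)
Lemma tannery (T : Type) (F : set_system T) (FF : ProperFilter F)
    (u : T -> nat -> R) (l M : nat -> R) :
  cvgn (series M) ->
  (\forall k \near F, forall n, `|u k n| <= M n) ->
  (forall n, u k n @[k --> F] --> l n) ->
  limn (series (u k)) @[k --> F] --> limn (series l).
Proof.
move=> cM uM ul.
have lM n : `|l n| <= M n.
  apply: (cvgr_le_near FF (cvg_norm (ul n))).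
  by apply: filterS uM => k; exact.
apply/cvgrPdist_lt => e e0.
have e3 : 0 < e / 3 by rewrite divr_gt0.
have [N hN] := series_tail0 cM e3.
have /cvgrPdist_lt /(_ _ e3) h := cvg_series_fin FF (N := N) ul.
near=> k.
have -> : limn (series l) - limn (series (u k)) =
  (limn (series l) - series l N) + (series l N - series (u k) N) -
  (limn (series (u k)) - series (u k) N) by ring.
have t1 := series_tail N lM cM.
have t2 : `|limn (series (u k)) - series (u k) N| <= limn (series M) - series M N.
  by apply: series_tail => //; near: k; exact: uM.
have t3 : `|series l N - series (u k) N| < e / 3 by near: k; exact: h.
have t4 := ler_norm (limn (series M) - series M N).
have -> : e = e / 3 + e / 3 + e / 3 by field.
rewrite (le_lt_trans (ler_normB _ _))// ltr_leD//; last first.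
  by rewrite (le_trans t2)// (le_trans t4)// ltW.
rewrite (le_lt_trans (ler_normD _ _))// ler_ltD//.
by rewrite (le_trans t1)// (le_trans t4)// ltW.
Unshelve. all: by end_near. Qed.

Lemma summable_bounded a B : (forall n, 0 <= a n) ->
  (forall N, series a N <= B) -> cvgn (series a).
Proof.
move=> a0 aB; apply: nondecreasing_is_cvgn.
  by apply/nondecreasing_seqP => n; rewrite -subr_ge0 seriesSB.
by exists B => _ [n _ <-].
Qed.

(** Telescoping by 1 / (x + 1)^2 <= 1 / x - 1 / (x + 1), where the gap is 1 / (x (x + 1)^2). *)
Lemma series_inv_sqr_le (N : nat) :
  series (fun n => (n.+1%:R ^+ 2)^-1 : R) N.+1 <= 2 - (N.+1%:R)^-1.
Proof.
elim: N => [|N IH].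
  by rewrite /series/= big_nat1 expr1n invr1; lra.
rewrite /series/= big_nat_recr//=; rewrite /series/= in IH.
rewrite (le_trans (lerD IH (lexx _)))//.
set x : R := N.+1%:R.
have x0 : 0 < x by rewrite ltr0n.
have -> : N.+2%:R = x + 1 :> R by rewrite /x -natr1.
rewrite -subr_ge0.
have -> : 2 - (x + 1)^-1 - (2 - x^-1 + ((x + 1) ^+ 2)^-1) =
   (x * (x + 1) ^+ 2)^-1.
  by field; rewrite !gt_eqF// addr_gt0.
by rewrite invr_ge0 mulr_ge0 ?sqr_ge0 ?ltW.
Qed.

Lemma summable_inv_sqr (c : R) : 0 <= c -> 
  cvgn (series (fun n => c / n.+1%:R ^+ 2)).
Proof.
move=> c0; have h : cvgn (series (fun n => (n.+1%:R ^+ 2)^-1 : R)); last first.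
  rewrite (_ : series _ = fun N => c * series (fun n => (n.+1%:R ^+ 2)^-1) N).
    by apply: is_cvgM => //; exact: is_cvg_cst.
  by apply/funext => N; rewrite /series/= big_distrr.
apply: (@summable_bounded _ 2) => [n|[|N]].
- by rewrite invr_ge0 sqr_ge0.
- by rewrite /series/= big_geq.
- by rewrite (le_trans (series_inv_sqr_le _))// gerBl.
Qed.

Lemma summable_geo (c r : R) : 0 <= r < 1 -> cvgn (series (fun n => c * r ^+ n)).
Proof.
move=> /andP[r0 r1]; apply: (@is_cvg_geometric_series _ c r).
by rewrite ger0_norm.
Qed.

End series_facts.

(** * The fundamental theorem of calculus and elementary derivatives *)

Section ftc.
Context {R : realType}.
Implicit Types (f g F G : R -> R).
Local Notation mu := (@lebesgue_measure R).

Lemma derive_oo_LR F f (a b : R) : (forall x : R, is_derive x (1 : R) F (f x)) ->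
  derivable_oo_LRcontinuous F a b.
Proof.
move=> dF.
have cF : continuous F.
  by move=> x; apply/differentiable_continuous/derivable1_diffP; case: (dF x).
split; first by move=> x _; case: (dF x).
- by apply: cvg_at_right_filter; exact: cF.
- by apply: cvg_at_left_filter; exact: cF.
Qed.

Lemma FTC2_global F f (a b : R) : a <= b ->
  (forall x : R, is_derive x (1 : R) F (f x)) -> continuous f ->
  \int[mu]_(x in `[a, b]) f x = F b - F a.
Proof.
rewrite le_eqVlt => /predU1P[<- _ _|ab dF cf].
  by rewrite set_itv1 Rintegral_set1 subrr.
rewrite /Rintegral (continuous_FTC2 (F := F) ab)//.
- exact: continuous_subspaceT.
- exact: derive_oo_LR dF.
- by move=> x _; rewrite derive1E; case: (dF x).
Qed.

Lemma is_derive_scale (c x : R) : is_derive x (1 : R) (fun x => c * x) c.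
Proof.
have -> : (fun x => c * x) = c \*: (@id R) by [].
by apply: is_derive_eq; rewrite /GRing.scale/= mulr1.
Qed.

Lemma is_derive_sin_scale (c x : R) :
  is_derive x (1 : R) (fun x => sin (c * x)) (c * cos (c * x)).
Proof.
have h := is_derive_scale c x.
have -> : (fun x => sin (c * x)) = sin \o (fun x => c * x) by [].
by apply: is_derive_eq; rewrite mulrC.
Qed.

Lemma is_derive_cos_scale (c x : R) :
  is_derive x (1 : R) (fun x => cos (c * x)) (- (c * sin (c * x))).
Proof.
have h := is_derive_scale c x.
have -> : (fun x => cos (c * x)) = cos \o (fun x => c * x) by [].
by apply: is_derive_eq; rewrite mulNr mulrC.
Qed.

Lemma is_derive_expR_scale (c x : R) :
  is_derive x (1 : R) (fun x => expR (c * x)) (c * expR (c * x)).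
Proof.
have h := is_derive_scale c x.
have -> : (fun x => expR (c * x)) = expR \o (fun x => c * x) by [].
by apply: is_derive_eq; rewrite mulrC.
Qed.

End ftc.

(** * The cosine basis and Bessel's inequality *)

Section basis.
Context {R : realType}.
Implicit Types (f g u w : R -> R).

Local Notation mu := (@lebesgue_measure R).
Local Notation I := (`[0, 1]%classic : set R).
Local Notation e_ := (@neumann_basis R).

Definition eigen (n : nat) : R := (n%:R * pi) ^+ 2.

Lemma eigen_ge0 n : 0 <= eigen n.
Proof. exact: sqr_ge0. Qed.

Lemma basis0 x : e_ 0 x = 1. Proof. by []. Qed.

Lemma basisS n x : e_ n.+1 x = Num.sqrt 2 * cos (n.+1%:R * pi * x).
Proof. by []. Qed.

Definition basis_scale (n : nat) : R := if n is 0%N then 1 else Num.sqrt 2.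

Lemma basisE n x : e_ n x = basis_scale n * cos (n%:R * pi * x).
Proof. by case: n => //=; rewrite !mul0r cos0 mulr1. Qed.

Lemma sqrt2_le2 : Num.sqrt 2 <= 2 :> R.
Proof.
by rewrite -[leRHS]ger0_norm// -sqrtr_sqr ler_sqrt// expr2; lra.
Qed.

Lemma basis_scale_ge0 n : 0 <= basis_scale n. Proof. by case: n => /=. Qed.

Lemma basis_scale_le2 n : basis_scale n <= 2.
Proof. by case: n => /=; [rewrite ler1n|move=> _; exact: sqrt2_le2]. Qed.

Lemma basis_le2 n x : `|e_ n x| <= 2.
Proof.
rewrite basisE normrM (ger0_norm (basis_scale_ge0 n)) -[leRHS]mulr1.
by apply: ler_pM => //; [exact: basis_scale_ge0|exact: basis_scale_le2|exact: cos_max].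
Qed.

Lemma basis_continuous n : continuous (e_ n).
Proof.
move=> x; rewrite (_ : e_ n = fun x => basis_scale n * cos (n%:R * pi * x)); last first.
  by apply/funext => y; rewrite basisE.
apply: cvgM; first exact: cvg_cst.
apply: (@continuous_comp _ _ _ (fun x => n%:R * pi * x) cos).
  by apply: cvgM; [exact: cvg_cst|exact: cvg_id].
exact: continuous_cos.
Qed.

Lemma L2_basis n : L2 (e_ n).
Proof. by apply/L2_cont/continuous_subspaceT; exact: basis_continuous. Qed.

Lemma sin_natpi n : sin (n%:R * pi) = 0 :> R.
Proof.
elim: n => [|n IH]; first by rewrite mul0r sin0.
by rewrite -natr1 mulrDl mul1r sinDpi IH oppr0.
Qed.

Lemma integral_cos k : (0 < k)%N ->
  \int[mu]_(x in I) cos (k%:R * pi * x) = 0.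
Proof.
move=> k0.
have a0 : k%:R * pi != 0 :> R by rewrite mulf_neq0 ?pnatr_eq0 -?lt0n// gt_eqF// pi_gt0.
have dF (x : R) : is_derive x (1 : R)
    (fun x => (k%:R * pi)^-1 * sin (k%:R * pi * x)) (cos (k%:R * pi * x)).
  have h := is_derive_sin_scale (k%:R * pi) x.
  have -> : (fun x => (k%:R * pi)^-1 * sin (k%:R * pi * x)) =
    (k%:R * pi)^-1 \*: (fun x => sin (k%:R * pi * x)) by [].
  by apply: is_derive_eq; rewrite /GRing.scale/= mulKf.
rewrite (FTC2_global ler01 dF).
  by rewrite mulr0 mulr1 sin0 sin_natpi !mulr0 subr0.
move=> x; apply: (@continuous_comp _ _ _ (fun x => k%:R * pi * x) cos).
  by apply: cvgM; [exact: cvg_cst|exact: cvg_id].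
exact: continuous_cos.
Qed.

Lemma cosM_sum (a b : R) : cos a * cos b = (cos (a + b) + cos (a - b)) / 2.
Proof. by rewrite cosD cosB; field. Qed.

Lemma integral_coscos (m n : nat) : (m < n)%N ->
  \int[mu]_(x in I) (cos (m%:R * pi * x) * cos (n%:R * pi * x)) = 0.
Proof.
move=> mn.
have ic (k : nat) : mu.-integrable I (EFin \o (fun x => cos (k%:R * pi * x))).
  apply/integrable01_cont/continuous_subspaceT => x.
  apply: (@continuous_comp _ _ _ (fun x => k%:R * pi * x) cos).
    by apply: cvgM; [exact: cvg_cst|exact: cvg_id].
  exact: continuous_cos.
under eq_Rintegral => x _.
  rewrite mulrC cosM_sum -!mulrDl -!mulrBl -natrD -natrB ?(ltnW mn)// -[_ / 2]/(_ * _).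
  over.
rewrite RintegralZr//; last first.
  have -> : EFin \o (fun x => cos ((n + m)%:R * pi * x) + cos ((n - m)%:R * pi * x))
    = ((EFin \o (fun x => cos ((n + m)%:R * pi * x))) \+
      (EFin \o (fun x => cos ((n - m)%:R * pi * x))))%E by [].
  exact: integrableD.
rewrite RintegralD// !integral_cos ?addr0 ?mul0r// ?subn_gt0//.
by rewrite addn_gt0 (leq_ltn_trans _ mn).
Qed.

Lemma integral_cos2 (n : nat) : (0 < n)%N ->
  \int[mu]_(x in I) (cos (n%:R * pi * x) * cos (n%:R * pi * x)) = 2^-1.
Proof.
move=> n0.
have ic (k : nat) : mu.-integrable I (EFin \o (fun x => cos (k%:R * pi * x))).
  apply/integrable01_cont/continuous_subspaceT => x.
  apply: (@continuous_comp _ _ _ (fun x => k%:R * pi * x) cos).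
    by apply: cvgM; [exact: cvg_cst|exact: cvg_id].
  exact: continuous_cos.
have i1 : mu.-integrable I (EFin \o (fun=> 1 : R)).
  by apply/integrable01_cont/continuous_subspaceT => x; exact: cvg_cst.
under eq_Rintegral => x _.
  rewrite cosM_sum subrr cos0 -!mulrDl -natrD -[_ / 2]/(_ * _).
  over.
rewrite RintegralZr//; last first.
  have -> : EFin \o (fun x => cos ((n + n)%:R * pi * x) + 1)
    = ((EFin \o (fun x => cos ((n + n)%:R * pi * x))) \+
      (EFin \o (fun=> 1%R : R)))%E by [].
  exact: integrableD.
rewrite RintegralD// integral_cos ?addn_gt0 ?n0// add0r Rintegral_cst01.
by rewrite mul1r.
Qed.

Lemma dot_basis (m n : nat) : dotL2 (e_ m) (e_ n) = (m == n)%:R.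
Proof.
have E (k l : nat) : dotL2 (e_ k) (e_ l) =
    basis_scale k * basis_scale l * \int[mu]_(x in I) (cos (k%:R * pi * x) * cos (l%:R * pi * x)).
  rewrite /dotL2 -RintegralZl//.
    by apply: eq_Rintegral => x _; rewrite !basisE; ring.
  apply/integrable01_cont/continuous_subspaceT => x.
  by apply: continuousM; apply: (@continuous_comp _ _ _ (fun x => _ * pi * x) cos);
    try exact: continuous_cos; apply: cvgM; [exact: cvg_cst|exact: cvg_id
      |exact: cvg_cst|exact: cvg_id].
have [->|mn] := eqVneq m n.
  case: n => [|n].
    rewrite /dotL2 /=; under eq_Rintegral do rewrite mul1r.
    exact: Rintegral_cst01.
  rewrite E integral_cos2// /basis_scale -expr2 sqr_sqrtr//.
  by rewrite mulfV// pnatr_eq0.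
wlog lmn : m n mn / (m < n)%N => [H|].
  move: (mn); rewrite neq_ltn => /orP[h|h]; first exact: H.
  by rewrite dotC H// eq_sym.
by rewrite E integral_coscos// mulr0.
Qed.

Definition coef f (n : nat) : R := dotL2 f (e_ n).

Lemma coef_basis m n : coef (e_ m) n = (m == n)%:R.
Proof. exact: dot_basis. Qed.

Lemma fcoefD f g n : L2 f -> L2 g -> coef (f \+ g) n = coef f n + coef g n.
Proof. by move=> lf lg; rewrite /coef dotDl//; exact: L2_basis. Qed.

Lemma fcoefB f g n : L2 f -> L2 g -> coef (f \- g) n = coef f n - coef g n.
Proof. by move=> lf lg; rewrite /coef dotBl//; exact: L2_basis. Qed.

Lemma fcoefZ c f n : L2 f -> coef (fun x => c * f x) n = c * coef f n.
Proof. by move=> lf; rewrite /coef dotZl//; exact: L2_basis. Qed.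

Lemma eq_coef f g n : {in I, f =1 g} -> coef f n = coef g n.
Proof. by move=> fg; exact: eq_dot. Qed.

(** Nonnegativity of |f - p|^2 for the partial cosine sum p: both <f, p> and <p, p> equal the
    partial sum of squares. *)
Lemma bessel f (N : nat) : L2 f -> series (fun n => coef f n ^+ 2) N <= dotL2 f f.
Proof.
move=> lf.
pose p x := \sum_(0 <= k < N) (coef f k * e_ k x).
have lp : L2 p by apply: L2_sum => k; apply/L2Z/L2_basis.
have fp : dotL2 f p = series (fun n => coef f n ^+ 2) N.
  rewrite dotC dot_suml//; last by move=> k; apply/L2Z/L2_basis.
  apply: eq_bigr => k _; rewrite dotZl ?expr2//; last exact: L2_basis.
  by rewrite dotC.
have pp : dotL2 p p = series (fun n => coef f n ^+ 2) N.
  rewrite {1}/p dot_suml//; last by move=> k; apply/L2Z/L2_basis.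
  apply: eq_big_nat => k kN; rewrite dotZl//; last exact: L2_basis.
  rewrite expr2; congr (_ * _); rewrite dotC dot_suml//; last 2 first.
  - by move=> j; apply/L2Z/L2_basis.
  - exact: L2_basis.
  rewrite (eq_bigr (fun j => coef f j * (j == k)%:R)); last first.
    by move=> j _; rewrite dotZl ?dot_basis//; exact: L2_basis.
  rewrite (bigD1_seq k)//= ?mem_index_iota// ?iota_uniq//.
  rewrite eqxx mulr1 big1 ?addr0// => j /negPf; rewrite eq_sym => jk.
  by rewrite jk mulr0.
have := dot_ge0 (f \- p).
rewrite dotBl ?dotBr//; last exact: L2B.
by rewrite (dotC p f) fp pp; lra.
Qed.

Lemma coef_bounded f : L2 f -> exists B, 0 <= B /\ forall n, `|coef f n| <= B.
Proof.
move=> lf; exists ((dotL2 f f + 1) / 2); split.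
  by rewrite divr_ge0// addr_ge0// dot_ge0.
move=> n; have := dot_young ltr01 lf (L2_basis n).
by rewrite dot_basis eqxx invr1 !mul1r.
Qed.

End basis.

(** * Cosine series *)

Section cosine_series.
Context {R : realType}.
Implicit Types (f g u w : R -> R) (a b M : nat -> R).

Local Notation mu := (@lebesgue_measure R).
Local Notation I := (`[0, 1]%classic : set R).
Local Notation e_ := (@neumann_basis R).

Definition abs_summable a := cvgn (series (fun n => `|a n|)).

Definition cosser a (x : R) : R := limn (series (fun n => a n * e_ n x)).

Lemma le_summable a M : (forall n, `|a n| <= M n) -> cvgn (series M) -> abs_summable a.
Proof. exact: summable_le. Qed.

Lemma summable2 a : abs_summable a -> cvgn (series (fun n => `|a n| * 2)).
Proof.
move=> sa; rewrite (_ : series _ = fun N => series (fun n => `|a n|) N * 2).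
  by apply: is_cvgM => //; exact: is_cvg_cst.
by apply/funext => N; rewrite /series/= big_distrl.
Qed.

Lemma cosser_term (c : R) n x : `|c * e_ n x| <= `|c| * 2.
Proof. by rewrite normrM ler_wpM2l// basis_le2. Qed.

Lemma cosser_cvg a x : abs_summable a ->
  series (fun n => a n * e_ n x) @ \oo --> cosser a x.
Proof.
move=> sa; apply: summable_norm; apply: summable_le (summable2 sa) => n.
exact: cosser_term.
Qed.

Lemma cosser_tail a x (N : nat) : abs_summable a ->
  `|cosser a x - series (fun n => a n * e_ n x) N| <=
  limn (series (fun n => `|a n| * 2)) - series (fun n => `|a n| * 2) N.
Proof.
move=> sa; apply: series_tail (summable2 sa) => n; exact: cosser_term.
Qed.

Lemma cosser_continuous a : abs_summable a -> continuous (cosser a).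
Proof.
move=> sa x; apply: (@tannery R R (nbhs x) _ _ _ (fun n => `|a n| * 2)).
- exact: summable2.
- by apply: nearW => y n; exact: cosser_term.
- by move=> n; apply: cvgM; [exact: cvg_cst|exact: basis_continuous].
Qed.

Lemma L2_cosser a : abs_summable a -> L2 (cosser a).
Proof. by move=> sa; apply/L2_cont/continuous_subspaceT/cosser_continuous. Qed.

Lemma eq_cosser a b : a =1 b -> cosser a = cosser b.
Proof. by move=> /funext ->. Qed.

Lemma cosserD a b x : abs_summable a -> abs_summable b ->
  cosser (fun n => a n + b n) x = cosser a x + cosser b x.
Proof.
move=> sa sb; apply: (@cvg_lim) => //.
rewrite (_ : series _ = fun N => series (fun n => a n * e_ n x) N
   + series (fun n => b n * e_ n x) N).
  by apply: cvgD; exact: cosser_cvg.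
apply/funext => N; rewrite /series/= -big_split.
by apply: eq_bigr => i _; rewrite mulrDl.
Qed.

Lemma cosserZ (c : R) a x : abs_summable a ->
  cosser (fun n => c * a n) x = c * cosser a x.
Proof.
move=> sa; apply: (@cvg_lim) => //.
rewrite (_ : series _ = fun N => c * series (fun n => a n * e_ n x) N).
  by apply: cvgM; [exact: cvg_cst|exact: cosser_cvg].
by apply/funext => N; rewrite /series/= big_distrr; apply: eq_bigr => i _ /=; rewrite mulrA.
Qed.

Lemma dot_sup f g (M : R) : L2 f -> L2 g -> (forall x, I x -> `|f x| <= M) ->
  `|dotL2 f g| <= M * \int[mu]_(x in I) `|g x|.
Proof.
move=> lf lg fM; have ig := L2_integrable lg.
have ing : mu.-integrable I (EFin \o (fun x => `|g x|)).
  by have := integrable_norm ig.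
rewrite (le_trans (le_normr_Rintegral _ (L2_mul lf lg)))//.
rewrite -RintegralZl//; apply: le_Rintegral => //.
- by have := integrable_norm (L2_mul lf lg).
- have : mu.-integrable I (fun x => M%:E * (EFin \o (fun x => `|g x|)%R) x)%E.
    by apply: integrableZl.
  by [].
- by move=> x Ix /=; rewrite normrM ler_wpM2r// fM.
Qed.

(** The partial sums converge uniformly, which passes to the pairing through the L^1 norm G of g. *)
Lemma dot_cosser a g : abs_summable a -> L2 g ->
  series (fun n => a n * coef g n) @ \oo --> dotL2 (cosser a) g.
Proof.
move=> sa lg; set G := \int[mu]_(x in I) `|g x|.
have G0 : 0 <= G by apply: Rintegral_ge0.
have E N : series (fun n => a n * coef g n) N =
    dotL2 (fun x => series (fun n => a n * e_ n x) N) g.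
  rewrite /series/= dot_suml//; last by move=> n; apply/L2Z/L2_basis.
  by apply: eq_bigr => n _; rewrite dotZl//; [rewrite dotC|exact: L2_basis].
apply/cvgrPdist_le => e e0.
have G1 : 0 < G + 1 by rewrite ltr_wpDl.
have eG : 0 < e / (G + 1) by rewrite divr_gt0.
have /cvgrPdist_lt /(_ _ eG) := summable2 sa.
apply: filterS => N /= hN; rewrite E.
have lS : L2 (fun x => series (fun n => a n * e_ n x) N).
  by apply: L2_sum => n; apply/L2Z/L2_basis.
rewrite -dotBl//; last exact: L2_cosser.
rewrite (le_trans (dot_sup (M := e / (G + 1)) _ lg _))//.
- exact: L2B (L2_cosser sa) lS.
- move=> x _ /=; rewrite (le_trans (cosser_tail x N sa))//.
  by rewrite (le_trans (ler_norm _))// ltW.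
- rewrite -/G -mulrA mulrC -ler_pdivlMr// divff ?gt_eqF//.
  by rewrite mulrC ler_pdivrMr// mul1r lerDl.
Qed.

(** Paired with e_n, the partial sums are constant as soon as they contain the index n. *)
Lemma coef_cosser a n : abs_summable a -> coef (cosser a) n = a n.
Proof.
move=> sa; have := dot_cosser sa (L2_basis n).
move/cvg_lim; rewrite -/(coef _ _) => <-//; apply/cvg_lim => //.
apply: cvg_near_cst; exists n.+1 => //= N nN.
rewrite /series/= (bigD1_seq n)//= ?mem_index_iota ?iota_uniq//.
rewrite coef_basis eqxx mulr1 big1 ?addr0// => i /negPf.
by rewrite coef_basis eq_sym => ->; rewrite mulr0.
Qed.

Definition damp (t : R) a (n : nat) : R := expR (- (eigen n * t)) * a n.

Lemma damp_le (t : R) a n : 0 <= t -> `|damp t a n| <= `|a n|.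
Proof.
move=> t0; rewrite normrM ger0_norm ?expR_ge0// ler_piMl//.
by rewrite expR_le1 oppr_le0 mulr_ge0// eigen_ge0.
Qed.

Lemma pi_sqr_ge1 : 1 <= pi ^+ 2 :> R.
Proof. by have := @pi_ge2 R; nra. Qed.

(** From (n pi)^2 >= n. This turns damped series at positive times into geometric ones. *)
Lemma expR_eigen_le (t : R) n : 0 <= t -> expR (- (eigen n * t)) <= expR (- t) ^+ n.
Proof.
move=> t0; rewrite -expRM_natl ler_expR mulrN lerN2 ler_wpM2r//.
rewrite /eigen exprMn -[leLHS]mulr1 ler_pM ?pi_sqr_ge1//.
by rewrite expr2 -natrM ler_nat; case: n => // n; rewrite leq_pmulr.
Qed.

Lemma damp_summable (t : R) a B : 0 < t -> (forall n, `|a n| <= B) ->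
  abs_summable (damp t a).
Proof.
move=> t0 aB; apply: (@le_summable _ (fun n => B * expR (- t) ^+ n)).
  move=> n; rewrite normrM mulrC ler_pM//.
  by rewrite ger0_norm ?expR_ge0// expR_eigen_le// ltW.
by apply: summable_geo; rewrite expR_ge0 expR_lt1 oppr_lt0.
Qed.

(** The exponential is split into two equal factors: one absorbs n, by n e^(- n t / 2) <= 2 / t, and
    the other leaves a geometric series. *)
Lemma damp_n_summable (t : R) a B : 0 < t -> (forall n, `|a n| <= B) ->
  abs_summable (fun n => n%:R * damp t a n).
Proof.
move=> t0 aB; have t2 : 0 < t / 2 by rewrite divr_gt0.
apply: (@le_summable _ (fun n => (2 / t * B) * expR (- (t / 2)) ^+ n)).
  move=> n; rewrite normrM /damp normrM.
  have -> : expR (- (eigen n * t)) =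
      expR (- (eigen n * (t / 2))) * expR (- (eigen n * (t / 2))).
    by rewrite -expRD; congr expR; field.
  set E := expR (- (eigen n * (t / 2))).
  have E0 : 0 <= E by exact: expR_ge0.
  have h1 : E <= expR (- (t / 2)) ^+ n by apply: expR_eigen_le; rewrite ltW.
  have h2 : n%:R * E <= 2 / t.
    have h : expR (- (t / 2)) ^+ n = (expR (n%:R * (t / 2)))^-1.
      by rewrite -expRM_natl mulrN expRN.
    have h3 := expR_ge1Dx (n%:R * (t / 2)).
    have h4 : 0 <= n%:R * (t / 2) by rewrite mulr_ge0// ltW.
    rewrite (le_trans (ler_wpM2l _ h1))// h ler_pdivrMr ?expR_gt0//.
    rewrite -ler_pdivrMl ?divr_gt0// invf_div mulrC (le_trans _ h3)//.
    by rewrite lerDr.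
  rewrite ger0_norm// ger0_norm ?mulr_ge0//.
  have -> : n%:R * (E * E * `|a n|) = (n%:R * E * `|a n|) * E by ring.
  by rewrite ler_pM ?mulr_ge0// ler_pM ?mulr_ge0.
by apply: summable_geo; rewrite expR_ge0 expR_lt1 oppr_lt0.
Qed.

End cosine_series.

(** * Taylor bounds and Gaussian limits of powers of cosines *)

Section gaussian_limit.
Context {R : realType}.
Implicit Types F f : R -> R.

(** Drives the chain of Taylor bounds below: the derivative of each remainder of sine or cosine is
    the previous remainder. *)
Lemma ge0_of_derive F f : (forall x : R, is_derive x (1 : R) F (f x)) ->
  (forall x, 0 <= x -> 0 <= f x) -> 0 <= F 0 -> forall x, 0 <= x -> 0 <= F x.
Proof.
move=> dF f0 F0 x x0.
have cF : {within `[0, x], continuous F}.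
  apply: continuous_subspaceT => y.
  by apply/differentiable_continuous/derivable1_diffP; case: (dF y).
have [c + E] := MVT_segment x0 (fun y _ => dF y) cF.
rewrite in_itv/= => /andP[c0 _].
by rewrite -(subrK (F 0) (F x)) E addr_ge0// mulr_ge0 ?f0// subr0.
Qed.

Lemma sin_le_id (x : R) : 0 <= x -> sin x <= x.
Proof.
move=> x0; rewrite -subr_ge0.
apply: (@ge0_of_derive (id - sin) (fun x => 1 - cos x) _ _ _ x x0).
- by move=> y _; rewrite subr_ge0 cos_le1.
- by rewrite !fctE/= sin0 subr0.
Qed.

Lemma cos_ge_quadratic (x : R) : 0 <= x -> 1 - x ^+ 2 / 2 <= cos x.
Proof.
move=> x0; rewrite -subr_ge0.
have -> : cos x - (1 - x ^+ 2 / 2) = (cos + (2^-1 \*: (id ^+ 2)) - cst 1) x.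
  by rewrite !fctE/= /GRing.scale/=; ring.
apply: (@ge0_of_derive _ (fun x => - sin x + x) _ _ _ _ x0).
- move=> y; apply: is_derive_eq; rewrite /GRing.scale/= subr0; congr (_ + _).
  by rewrite expr1 mulr1 -mulr_natl mulrA mulVf ?mul1r.
- by move=> y y0; rewrite addrC subr_ge0 sin_le_id.
- by rewrite !fctE/= /GRing.scale/= cos0 expr0n mulr0 addr0 subrr.
Qed.

Lemma sin_ge_cubic (x : R) : 0 <= x -> x - x ^+ 3 / 6 <= sin x.
Proof.
move=> x0; rewrite -subr_ge0.
have -> : sin x - (x - x ^+ 3 / 6) = (sin - id + (6^-1 \*: (id ^+ 3))) x.
  by rewrite !fctE/= /GRing.scale/=; ring.
apply: (@ge0_of_derive _ (fun x => cos x - 1 + x ^+ 2 / 2) _ _ _ _ x0).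
- move=> y; apply: is_derive_eq; rewrite /GRing.scale/=; congr (_ + _).
  by rewrite mulr1 -mulr_natl; field.
- by move=> y y0; have := cos_ge_quadratic y0; lra.
- by rewrite !fctE/= /GRing.scale/= sin0 expr0n mulr0 addr0 subrr.
Qed.

Lemma cos_le_quartic (x : R) : 0 <= x -> cos x <= 1 - x ^+ 2 / 2 + x ^+ 4 / 24.
Proof.
move=> x0; rewrite -subr_ge0.
have -> : 1 - x ^+ 2 / 2 + x ^+ 4 / 24 - cos x =
    (cst 1 - (2^-1 \*: (id ^+ 2)) + (24^-1 \*: (id ^+ 4)) - cos) x.
  by rewrite !fctE/= /GRing.scale/=; ring.
apply: (@ge0_of_derive _ (fun x => - x + x ^+ 3 / 6 + sin x) _ _ _ _ x0).
- move=> y; apply: is_derive_eq; rewrite /GRing.scale/= sub0r opprK; congr (- _ + _ + _).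
    by rewrite expr1 mulr1 -mulr_natl mulrA mulVf ?mul1r.
  by rewrite mulr1 -mulr_natl; field.
- by move=> y y0; have := sin_ge_cubic y0; lra.
- by rewrite !fctE/= /GRing.scale/= cos0 !expr0n !mulr0 addr0 subr0 subrr.
Qed.

Lemma expRN_le_quadratic (y : R) : 0 <= y -> expR (- y) <= 1 - y + y ^+ 2 / 2.
Proof.
move=> y0; rewrite -subr_ge0.
have -> : 1 - y + y ^+ 2 / 2 - expR (- y) =
    (cst 1 - id + (2^-1 \*: (id ^+ 2)) - (fun x => expR (-1 * x))) y.
  by rewrite !fctE/= /GRing.scale/= mulN1r; ring.
apply: (@ge0_of_derive _ (fun x => - 1 + x + expR (-1 * x)) _ _ _ _ y0).
- move=> z; have h := is_derive_expR_scale (-1) z.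
  apply: is_derive_eq; rewrite /GRing.scale/= sub0r mulN1r mulNr mul1r opprK; congr (_ + _ + _).
  by rewrite expr1 mulr1 -mulr_natl mulrA mulVf ?mul1r.
- by move=> z z0; have := expR_ge1Dx (- z); rewrite mulN1r; lra.
- by rewrite !fctE/= /GRing.scale/= mulr0 expR0 expr0n mulr0 addr0 subr0 subrr.
Qed.

(** Both functions equal 1 - y to first order: by the Taylor bounds they lie between 1 - y and 1 - y
    + y^2 / 2, where the quartic term for the cosine is (2 y)^2 / 24 = y^2 / 6. *)
Lemma cos_sub_expR (y : R) : 0 <= y ->
  `|cos (Num.sqrt (2 * y)) - expR (- y)| <= y ^+ 2.
Proof.
move=> y0; have z0 := sqrtr_ge0 (2 * y).
have h1 := cos_ge_quadratic z0; have h2 := cos_le_quartic z0.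
have h3 := expRN_le_quadratic y0; have h4 := expR_ge1Dx (- y).
have h : Num.sqrt (2 * y) ^+ 2 = 2 * y by rewrite sqr_sqrtr// mulr_ge0.
have h' : Num.sqrt (2 * y) ^+ 4 = (2 * y) ^+ 2 by rewrite -[in RHS]h -exprM.
rewrite h in h1; rewrite h h' in h2.
have y2 := sqr_ge0 y.
by rewrite ler_norml; apply/andP; split; nra.
Qed.

Lemma expr_sub_le (a b : R) (k : nat) : `|a| <= 1 -> `|b| <= 1 ->
  `|a ^+ k - b ^+ k| <= k%:R * `|a - b|.
Proof.
move=> a1 b1; elim: k => [|k IH]; first by rewrite !expr0 subrr normr0 mul0r.
rewrite !exprS.
have -> : a * a ^+ k - b * b ^+ k = a * (a ^+ k - b ^+ k) + (a - b) * b ^+ k by ring.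
rewrite (le_trans (ler_normD _ _))// -natr1 (mulrDl _ 1) mul1r lerD//.
  by rewrite normrM (le_trans _ IH)// ler_piMl.
by rewrite normrM ler_piMr// normrX exprn_ile1.
Qed.

(** The central limit theorem for a symmetric random walk of k steps of size sqrt (2 b / k), read on
    characteristic functions: each factor is within (b / k)^2 of e^(- b / k), so the k-th powers
    differ by at most b^2 / k. *)
Lemma cos_power_cvg (b : R) : 0 <= b ->
  (fun k => cos (Num.sqrt (2 * (b / k.+1%:R))) ^+ k.+1) @ \oo --> expR (- b).
Proof.
move=> b0; apply/cvgrPdist_le => e e0.
have /cvgrPdist_lt /(_ e e0) : (fun k : nat => b ^+ 2 * harmonic k) @ \oo --> (0 : R).
  by rewrite -(mulr0 (b ^+ 2)); apply: cvgM; [exact: cvg_cst|exact: cvg_harmonic].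
apply: filterS => k; rewrite sub0r normrN /harmonic => h.
have k0 : (0 : R) < k.+1%:R by rewrite ltr0n.
have -> : expR (- b) = expR (- (b / k.+1%:R)) ^+ k.+1.
  by rewrite -expRM_natl; congr expR; rewrite mulrN mulrC divfK// gt_eqF.
have y0 : 0 <= b / k.+1%:R by rewrite divr_ge0// ltW.
rewrite distrC (le_trans (expr_sub_le _ _ _))//; first exact: cos_max.
  by rewrite ger0_norm ?expR_ge0// expR_le1 oppr_le0.
rewrite (le_trans _ (ltW h))// (le_trans (ler_wpM2l _ (cos_sub_expR y0)))//.
rewrite (le_trans _ (ler_norm _))// le_eqVlt; apply/orP; left; apply/eqP.
by move: (lt0r_neq0 k0); rewrite /=; move: (k.+1%:R : R) => q q0; field.
Qed.

End gaussian_limit.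

(** * The Neumann heat semigroup *)

Section heat_semigroup.
Context {R : realType}.
Implicit Types (f g u w : R -> R) (a b M : nat -> R).

Local Notation mu := (@lebesgue_measure R).
Local Notation I := (`[0, 1]%classic : set R).
Local Notation e_ := (@neumann_basis R).
Local Notation heat := (@neumann_heat R).

Lemma heat_le0 (t : R) f : t <= 0 -> heat t f = f.
Proof. by rewrite /neumann_heat leNgt => /negPf ->. Qed.

Lemma heat_gt0 (t : R) f : 0 < t -> heat t f = cosser (damp t (coef f)).
Proof. by rewrite /neumann_heat => ->. Qed.

Lemma summable_heat (t : R) f : 0 < t -> L2 f -> abs_summable (damp t (coef f)).
Proof.
by move=> t0 /coef_bounded[B [_ hB]]; apply: damp_summable t0 hB.
Qed.

Lemma heat_continuous (t : R) f : {within I, continuous f} ->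
  {within I, continuous (heat t f)}.
Proof.
move=> cf; have [t0|t0] := leP t 0; first by rewrite heat_le0.
rewrite heat_gt0//; apply/continuous_subspaceT/cosser_continuous.
exact: summable_heat (L2_cont cf).
Qed.

Lemma L2_heat (t : R) f : L2 f -> L2 (heat t f).
Proof.
move=> lf; have [t0|t0] := leP t 0; first by rewrite heat_le0.
by rewrite heat_gt0//; apply/L2_cosser/summable_heat.
Qed.

Lemma coef_heat (t : R) f n : 0 <= t -> L2 f ->
  coef (heat t f) n = expR (- (eigen n * t)) * coef f n.
Proof.
rewrite le_eqVlt => /predU1P[<-|t0] lf.
  by rewrite heat_le0// mulr0 oppr0 expR0 mul1r.
by rewrite heat_gt0// coef_cosser//; exact: summable_heat.
Qed.

Lemma heatD (t : R) f g x : L2 f -> L2 g ->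
  heat t (f \+ g) x = heat t f x + heat t g x.
Proof.
move=> lf lg; have [t0|t0] := leP t 0; first by rewrite !heat_le0.
rewrite !heat_gt0// -cosserD; [|exact: summable_heat..].
by congr (cosser _ x); apply/funext => n; rewrite /damp fcoefD// mulrDr.
Qed.

Lemma heatZ (t c : R) f x : L2 f ->
  heat t (fun x => c * f x) x = c * heat t f x.
Proof.
move=> lf; have [t0|t0] := leP t 0; first by rewrite !heat_le0.
rewrite !heat_gt0// -cosserZ; last exact: summable_heat.
by congr (cosser _ x); apply/funext => n; rewrite /damp fcoefZ// mulrCA.
Qed.

Lemma heatB (t : R) f g x : L2 f -> L2 g ->
  heat t (f \- g) x = heat t f x - heat t g x.
Proof.
move=> lf lg; rewrite (_ : f \- g = f \+ (fun x => -1 * g x)).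
  by rewrite heatD ?heatZ ?mulN1r//; exact: L2Z.
by apply/funext => y /=; rewrite mulN1r.
Qed.

Lemma damp_basis (t : R) n : damp t (coef (e_ n)) =1
  fun k => if k == n then expR (- (eigen n * t)) else 0.
Proof.
move=> k; rewrite /damp coef_basis eq_sym; case: eqP => [->|_].
  by rewrite mulr1.
by rewrite mulr0.
Qed.

Lemma cosser_single (c : R) n x :
  cosser (fun k => if k == n then c else 0) x = c * e_ n x.
Proof.
apply/cvg_lim => //; apply: cvg_near_cst; exists n.+1 => //= N nN.
rewrite /series/= (bigD1_seq n)//= ?mem_index_iota ?iota_uniq//.
by rewrite eqxx big1 ?addr0// => i /negPf ->; rewrite mul0r.
Qed.

Lemma heat_basis (t : R) n x : 0 <= t ->
  heat t (e_ n) x = expR (- (eigen n * t)) * e_ n x.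
Proof.
rewrite le_eqVlt => /predU1P[<-|t0].
  by rewrite heat_le0// mulr0 oppr0 expR0 mul1r.
by rewrite heat_gt0// (eq_cosser (damp_basis t n)) cosser_single.
Qed.

Lemma heat_cst (t c x : R) : heat t (fun=> c) x = c.
Proof.
have [t0|t0] := leP t 0; first by rewrite heat_le0.
have -> : (fun=> c) = (fun x => c * e_ 0%N x) :> (R -> R).
  by apply/funext => y; rewrite /= mulr1.
rewrite heatZ; last exact: L2_basis.
by rewrite heat_basis ?ltW// /eigen mul0r expr0n mul0r oppr0 expR0 !mulr1.
Qed.

Lemma heat_semigroup (s t : R) f x : 0 <= s -> 0 <= t -> L2 f ->
  heat s (heat t f) x = heat (s + t) f x.
Proof.
rewrite le_eqVlt => /predU1P[<- _ _|s0 t0 lf].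
  by rewrite add0r (@heat_le0 0).
have st : 0 < s + t by rewrite ltr_wpDr.
rewrite (heat_gt0 _ s0) (heat_gt0 _ st).
congr (cosser _ x); apply/funext => n; rewrite /damp coef_heat// mulrA -expRD.
by congr (expR _ * _); ring.
Qed.

(* The Abel means of a cosine series are its averages against the positive
   Poisson kernel, here truncated; this makes the heat semigroup positive. *)
Lemma poisson_identity (r th : R) (N : nat) :
  (1 - 2 * r * cos th + r ^+ 2) *
    (1 + 2 * \sum_(1 <= n < N.+1) (r ^+ n * cos (n%:R * th))) =
  1 - r ^+ 2 - 2 * r ^+ N.+1 * cos (N.+1%:R * th)
    + 2 * r ^+ N.+2 * cos (N%:R * th).
Proof.
elim: N => [|N IH].
  by rewrite big_geq// mul0r cos0 mul1r mulr0 addr0 !mulr1 expr1; ring.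
rewrite big_nat_recr//=; move: IH; set S := \sum_(_ <= _ < _) _; set D := 1 - _ + _.
move=> IH; rewrite (_ : D * _ = D * (1 + 2 * S) + D * (2 * (r ^+ N.+1 * cos (N.+1%:R * th)))).
  2: by ring.
rewrite IH /D.
have h : cos (N.+2%:R * th) = 2 * (cos th * cos (N.+1%:R * th)) - cos (N%:R * th).
  have -> : N.+2%:R * th = N.+1%:R * th + th by rewrite -(natr1 N.+1); ring.
  have -> : N%:R * th = N.+1%:R * th - th by rewrite -(natr1 N); ring.
  by rewrite cosD cosB; ring.
rewrite h [r ^+ N.+3]exprSr [r ^+ N.+2]exprSr; ring.
Qed.

(** Up to truncation terms of total size at most 4 r^(N + 1), the kernel times D is 1 - r^2 >= 0;
    dividing by D costs at most (1 - r)^2, since D >= (1 - r)^2. *)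
Lemma poisson_lower (r th : R) (N : nat) : 0 <= r < 1 ->
  - (4 * r ^+ N.+1 / (1 - r) ^+ 2) <=
  1 + 2 * \sum_(1 <= n < N.+1) (r ^+ n * cos (n%:R * th)).
Proof.
move=> /andP[r0 r1]; have := poisson_identity r th N.
set p := 1 + 2 * _; set D := 1 - 2 * r * cos th + r ^+ 2.
have D1 : (1 - r) ^+ 2 <= D by have := cos_le1 th; rewrite /D; nra.
have r10 : 0 < (1 - r) ^+ 2 by rewrite exprn_gt0// subr_gt0.
have D0 : 0 < D := lt_le_trans r10 D1.
have rN : 0 <= r ^+ N.+1 by rewrite exprn_ge0.
move=> E.
have h1 : - (4 * r ^+ N.+1) <= D * p.
  rewrite E [r ^+ N.+2]exprSr.
  have := cos_le1 (N.+1%:R * th); have := cos_geN1 (N%:R * th).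
  set c1 := cos _; set c2 := cos _; move=> c1N c21.
  have r2 : 0 <= 1 - r ^+ 2 by nra.
  have k1 : r ^+ N.+1 * c2 <= r ^+ N.+1 by rewrite ler_piMr.
  have k2 : - (r ^+ N.+1) <= r ^+ N.+1 * (r * c1).
    have : - 1 <= r * c1 by nra.
    by move=> h; rewrite -mulrN1 ler_wpM2l.
  by rewrite -[2 * (_ * r) * c1]mulrA -[_ * r * c1]mulrA -mulrA; lra.
have h2 : - (4 * r ^+ N.+1) / D <= p.
  by rewrite ler_pdivrMr// [p * D]mulrC.
rewrite (le_trans _ h2)// mulNr lerN2 ler_wpM2l ?mulr_ge0// lef_pV2//.
Qed.

Lemma basisM (n : nat) (x y : R) : (0 < n)%N ->
  e_ n x * e_ n y = cos (n%:R * (pi * (x + y))) + cos (n%:R * (pi * (x - y))).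
Proof.
case: n => // n _; rewrite !basisS.
have -> : Num.sqrt 2 * cos (n.+1%:R * pi * x) * (Num.sqrt 2 * cos (n.+1%:R * pi * y))
   = (Num.sqrt 2 ^+ 2) * (cos (n.+1%:R * pi * x) * cos (n.+1%:R * pi * y)) :> R.
  by rewrite expr2; ring.
rewrite sqr_sqrtr// cosM_sum mulrC divfK ?pnatr_eq0//.
by congr (cos _ + cos _); ring.
Qed.

Lemma summable_abel f (r : R) : 0 <= r < 1 -> L2 f ->
  abs_summable (fun n => r ^+ n * coef f n).
Proof.
move=> r01 /coef_bounded[B [B0 hB]].
apply: (@le_summable _ _ (fun n => B * r ^+ n)); last exact: summable_geo.
case/andP: r01 => r0 _ n; rewrite normrM (ger0_norm (exprn_ge0 _ r0)) mulrC.
by rewrite ler_wpM2r// exprn_ge0.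
Qed.

(** Partial sums are pairings of f with a truncated kernel [k]. By the product formula [k] is the
    mean of two truncated Poisson kernels, at x + y and x - y (the method of images), hence at least
    - C r^(N + 1), which vanishes in the limit. The conclusion covers every real x, because
    averaging over translates leaves [0, 1]. *)
Lemma abel_ge0 f (r x : R) : 0 <= r < 1 -> L2 f -> (forall y, I y -> 0 <= f y) ->
  0 <= cosser (fun n => r ^+ n * coef f n) x.
Proof.
move=> r01 lf f0; have sa := summable_abel r01 lf.
pose C := 4 / (1 - r) ^+ 2.
have key N : - (C * dotL2 f (fun=> 1) * r ^+ N.+1) <=
    series (fun n => r ^+ n * coef f n * e_ n x) N.+1.
  pose k y := 1 + \sum_(1 <= n < N.+1) r ^+ n * (e_ n x * e_ n y).
  have lk : L2 k.
    apply: L2D; first exact: L2_cst.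
    apply: L2_sum => n; apply: L2_ext (L2Z (r ^+ n * e_ n x) (L2_basis n)).
    by move=> y _ /=; rewrite mulrA.
  have kE : dotL2 f k = series (fun n => r ^+ n * coef f n * e_ n x) N.+1.
    have -> : k = fun y => \sum_(0 <= n < N.+1) (r ^+ n * e_ n x) * e_ n y.
      apply/funext => y; rewrite big_ltn// expr0 !basis0 !mulr1; congr (_ + _).
      by apply: eq_bigr => n _; rewrite mulrA.
    rewrite dotC dot_suml//; last by move=> n; apply/L2Z/L2_basis.
    apply: eq_bigr => n _; rewrite dotZl//; last exact: L2_basis.
    by rewrite dotC mulrAC.
  rewrite -kE.
  have -> : - (C * dotL2 f (fun=> 1) * r ^+ N.+1) =
      dotL2 f (fun y => - (C * r ^+ N.+1) * 1).
    by rewrite dotZr//; [ring|exact: L2_cst].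
  apply: le_Rintegral => //.
  - by apply: (L2_mul lf); apply/L2Z/L2_cst.
  - exact: (L2_mul lf lk).
  - move=> y Iy; rewrite ler_wpM2l ?f0// mulr1 /k.
    have -> : 1 + \sum_(1 <= n < N.+1) r ^+ n * (e_ n x * e_ n y) =
       ((1 + 2 * \sum_(1 <= n < N.+1) (r ^+ n * cos (n%:R * (pi * (x + y))))) +
        (1 + 2 * \sum_(1 <= n < N.+1) (r ^+ n * cos (n%:R * (pi * (x - y)))))) / 2.
      rewrite addrACA -mulrDr -big_split/= mulrDl mulrAC divff ?pnatr_eq0// mul1r.
      congr (_ + _).
      by apply: eq_big_nat => n /andP[n1 _]; rewrite basisM// mulrDr.
    have h1 := poisson_lower (pi * (x + y)) N r01.
    have h2 := poisson_lower (pi * (x - y)) N r01.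
    have -> : C * r ^+ N.+1 = 4 * r ^+ N.+1 / (1 - r) ^+ 2 by rewrite /C mulrAC.
    lra.
have c1 : series (fun n => r ^+ n * coef f n * e_ n x) N.+1
     + C * dotL2 f (fun=> 1) * r ^+ N.+1 @[N --> \oo] -->
     cosser (fun n => r ^+ n * coef f n) x + C * dotL2 f (fun=> 1) * 0.
  apply: cvgD; first by rewrite (cvg_shiftS (series _)); exact: cosser_cvg.
  apply: cvgM; first exact: cvg_cst.
  rewrite (cvg_shiftS (fun n => r ^+ n)).
  by case/andP: r01 => r0 r1; apply: cvg_expr; rewrite ger0_norm.
rewrite -[cosser _ x]addr0 -(mulr0 (C * dotL2 f (fun=> 1))).
apply: (cvgr_ge_near _ c1); apply: nearW => N.
by rewrite mulr0 -lerBlDr sub0r key.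
Qed.

Lemma basis_avg (n : nat) (h x : R) :
  cos (n%:R * pi * h) * e_ n x = (e_ n (x + h) + e_ n (x - h)) / 2.
Proof.
by rewrite !basisE !(mulrDr (n%:R * pi)) mulrN cosD cosB; field.
Qed.

(* Averaging over two translates multiplies the n-th cosine coefficient by
   cos (n pi h); its powers approximate the Gaussian multipliers. *)
Lemma cosser_avg a (h : R) : abs_summable a -> (forall x, 0 <= cosser a x) ->
  forall x, 0 <= cosser (fun n => cos (n%:R * pi * h) * a n) x.
Proof.
move=> sa a0 x; suff -> : cosser (fun n => cos (n%:R * pi * h) * a n) x =
    (cosser a (x + h) + cosser a (x - h)) / 2.
  by rewrite divr_ge0// addr_ge0.
apply/cvg_lim => //.
rewrite (_ : series _ = fun N => (series (fun n => a n * e_ n (x + h)) N +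
    series (fun n => a n * e_ n (x - h)) N) / 2).
  by apply: cvgM; [apply: cvgD; exact: cosser_cvg|exact: cvg_cst].
apply/funext => N; rewrite /series/= -big_split big_distrl/=.
by apply: eq_bigr => n _; rewrite mulrAC basis_avg; ring.
Qed.

Lemma cosser_avg_iter a (h : R) (k : nat) : abs_summable a ->
  (forall x, 0 <= cosser a x) ->
  forall x, 0 <= cosser (fun n => cos (n%:R * pi * h) ^+ k * a n) x.
Proof.
move=> sa a0; elim: k => [|k IH] x.
  by rewrite (@eq_cosser _ _ a)// => n; rewrite expr0 mul1r.
rewrite (@eq_cosser _ _ (fun n => cos (n%:R * pi * h) *
    (cos (n%:R * pi * h) ^+ k * a n))); last by move=> n; rewrite exprS mulrA.
apply: cosser_avg => //; apply: (@le_summable _ _ _ _ sa) => n.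
by rewrite normrM ler_piMl// normrX exprn_ile1// cos_max.
Qed.

(** Averaging k times at distance sqrt (2 t / k) multiplies the n-th coefficient by a power of a
    cosine that tends to the heat multiplier; Tannery's theorem carries positivity to the limit. *)
Lemma cosser_damp_ge0 a (t : R) : 0 <= t -> abs_summable a ->
  (forall x, 0 <= cosser a x) -> forall x, 0 <= cosser (damp t a) x.
Proof.
move=> t0 sa a0 x.
pose h (k : nat) : R := Num.sqrt (2 * (t / k.+1%:R)).
have h2 n k : n%:R * pi * h k = Num.sqrt (2 * (eigen n * t / k.+1%:R)).
  rewrite /h /eigen.
  have -> : 2 * ((n%:R * pi) ^+ 2 * t / k.+1%:R) =
    (n%:R * pi) ^+ 2 * (2 * (t / k.+1%:R)) :> R by ring.
  by rewrite [RHS]sqrtrM ?sqr_ge0// sqrtr_sqr ger0_norm// mulr_ge0// pi_ge0.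
have : limn (series (fun n => cos (n%:R * pi * h k) ^+ k.+1 * a n * e_ n x))
    @[k --> \oo] --> cosser (damp t a) x.
  apply: (@tannery R nat \oo _ _ _ (fun n => `|a n| * 2)).
  - exact: summable2.
  - apply: nearW => k n; rewrite (le_trans (cosser_term _ _ _))// ler_wpM2r//.
    by rewrite normrM ler_piMl// normrX exprn_ile1// cos_max.
  - move=> n; apply: cvgM; last exact: cvg_cst.
    apply: cvgM; last exact: cvg_cst.
    under eq_fun do rewrite h2.
    by apply: cos_power_cvg; rewrite mulr_ge0// eigen_ge0.
move=> /cvgr_ge_near; apply; apply: nearW => k.
exact: cosser_avg_iter.
Qed.

(** The coefficients of an L^2 function may fail to be summable, so the heat multiplier is first
    applied to the Abel means of f, which are nonnegative with summable coefficients. Then r tends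
    to 1, with the damped coefficients of f as majorant. *)
Lemma heat_ge0 (t : R) f x : L2 f -> (forall y, I y -> 0 <= f y) -> I x ->
  0 <= heat t f x.
Proof.
move=> lf f0 Ix; have [t0|t0] := leP t 0; first by rewrite heat_le0//; exact: f0.
rewrite heat_gt0//.
pose r (k : nat) : R := 1 - harmonic k.
have r01 k : 0 <= r k < 1.
  rewrite /r /harmonic/= subr_ge0 invf_le1 ?ltr0n// ler1n/=.
  by rewrite gtrBl invr_gt0 ltr0n.
have r1 n : r k ^+ n @[k --> \oo] --> (1 : R).
  elim: n => [|n IH]; first by under eq_fun do rewrite expr0; exact: cvg_cst.
  have rr : r k @[k --> \oo] --> (1 - 0 : R).
    by apply: cvgB; [exact: cvg_cst|exact: cvg_harmonic].
  have h : r k * r k ^+ n @[k --> \oo] --> (1 - 0) * (1 : R) by apply: cvgM.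
  by under eq_fun do rewrite exprS; rewrite subr0 mulr1 in h.
have := summable_heat t0 lf; set D := damp t _ => sD.
have : limn (series (fun n => damp t (fun n => r k ^+ n * coef f n) n * e_ n x))
    @[k --> \oo] --> cosser D x.
  apply: (@tannery R nat \oo _ _ _ (fun n => `|D n| * 2)).
  - exact: summable2.
  - apply: nearW => k n; rewrite (le_trans (cosser_term _ _ _))// ler_wpM2r//.
    rewrite /D /damp !normrM ler_wpM2l// ler_piMl//.
    by case/andP: (r01 k) => ? ?; rewrite normrX exprn_ile1// ger0_norm// ltW.
  - move=> n; apply: cvgM; last exact: cvg_cst.
    rewrite /D /damp; apply: cvgM; first exact: cvg_cst.
    rewrite -[X in _ --> X]mul1r; apply: cvgM; [exact: r1|exact: cvg_cst].
move=> /cvgr_ge_near; apply; apply: nearW => k.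
apply: cosser_damp_ge0; [exact: ltW|exact: summable_abel|].
by move=> y; exact: abel_ge0.
Qed.

Lemma heat_le (t : R) f g x : L2 f -> L2 g -> (forall y, I y -> f y <= g y) ->
  I x -> heat t f x <= heat t g x.
Proof.
move=> lf lg fg Ix; rewrite -subr_ge0 -heatB//.
apply: heat_ge0 => //; first exact: L2B.
by move=> y Iy /=; rewrite subr_ge0 fg.
Qed.

(** Constants are fixed by the semigroup, so preserving order entails contracting the sup norm. *)
Lemma heat_bound (t : R) f (M : R) x : L2 f ->
  (forall y, I y -> `|f y| <= M) -> I x -> `|heat t f x| <= M.
Proof.
move=> lf fM Ix; rewrite ler_norml -{1}(heat_cst t (- M) x) -{2}(heat_cst t M x).
by rewrite !heat_le//; try exact: L2_cst; move=> y /fM; rewrite ler_norml => /andP[].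
Qed.

Lemma heat_dist (t : R) f g (M : R) x : L2 f -> L2 g ->
  (forall y, I y -> `|f y - g y| <= M) -> I x -> `|heat t f x - heat t g x| <= M.
Proof.
by move=> lf lg fgM Ix; rewrite -heatB//; apply: heat_bound => //; exact: L2B.
Qed.

Lemma unif_cont01 f : {within I, continuous f} -> forall e, 0 < e ->
  exists2 d, 0 < d & forall x y, I x -> I y -> `|x - y| < d -> `|f x - f y| < e.
Proof.
move=> cf e e0.
have := (@compact_near_coveringP R I).1 (@segment_compact R 0 1).
move=> /(_ R (0^'+) (fun d x => I x -> forall y, I y -> `|x - y| < d -> `|f x - f y| < e)).
case.
  move=> x Ix.
  have /cvgrPdist_lt /(_ (e / 2)) := (subspace_continuousP _ _).1 cf x Ix.
  rewrite divr_gt0// => /(_ isT).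
  rewrite near_withinE => /nbhs_ballP[d /= d0 hd].
  exists (ball x (d / 2), [set z | z < d / 2]) => /=.
    split; first by apply: nbhsx_ballx; rewrite divr_gt0.
    by apply: nbhs_right_lt; rewrite divr_gt0.
  move=> [z w] /= [xz wd] Iz y Iy zy.
  have h1 : `|f x - f z| < e / 2.
    by apply: hd => //; rewrite /ball/= in xz *; rewrite (lt_trans xz)// gtr_pMr// invf_lt1// ltr1n.
  have h2 : `|f x - f y| < e / 2.
    apply: hd => //; rewrite /ball/= in xz *.
    rewrite -(subrKA z) (le_lt_trans (ler_normD _ _))//.
    by rewrite [ltRHS]splitr ltrD// (lt_trans zy).
  rewrite -(subrKA (f x)) (le_lt_trans (ler_normD _ _))//.
  by rewrite [ltRHS]splitr ltrD// distrC.
move=> d /= d0 hd.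
exists (d / 2); first by rewrite divr_gt0.
move=> x y Ix Iy xy; apply: (hd (d / 2)) => //=.
- by rewrite sub0r normrN ger0_norm ?divr_ge0 ?ltW// gtr_pMr// invf_lt1// ltr1n.
- by rewrite divr_gt0.
Qed.

Lemma sin_ge_concave (d x : R) : 0 <= d <= 1 -> d <= x <= 1 ->
  0 <= sin (pi / 2 * d) <= sin (pi / 2 * x).
Proof.
move=> /andP[d0 d1] /andP[dx x1].
have p0 : 0 < pi / 2 :> R by rewrite divr_gt0// pi_gt0.
have inJ (y : R) : 0 <= y <= 1 -> pi / 2 * y \in `[(- (pi / 2)), (pi / 2)].
  move=> /andP[y0 y1]; rewrite in_itv/=; apply/andP; split.
    by have := mulr_ge0 (ltW p0) y0; lra.
  by rewrite ler_piMr// ltW.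
apply/andP; split.
  have h : pi / 2 * d <= pi / 2 by rewrite ler_piMr// ltW.
  by apply: sin_ge0_pi; rewrite mulr_ge0 ?(ltW p0)//=; lra.
rewrite leNgt ltr_sin ?inJ ?d0 ?d1//; last by rewrite (le_trans d0).
by rewrite ltr_pM2l// -leNgt.
Qed.

Lemma cosB_prod (u v : R) : cos u - cos v =
  - (2 * (sin ((u + v) / 2) * sin ((u - v) / 2))).
Proof.
have {1}-> : u = (u + v) / 2 + (u - v) / 2 by field.
have {3}-> : v = (u + v) / 2 - (u - v) / 2 by field.
rewrite cosD cosB; ring.
Qed.

(** The difference factors into sines at pi (x + y) / 2 and pi (x - y) / 2, each at least s = sin
    (pi d / 2) once y <= x; if x + y > 1 the first argument is reflected about pi / 2. *)
Lemma cos_separation (d : R) : 0 < d -> d <= 1 -> exists2 c, 0 < c &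
  forall x y, I x -> I y -> d <= `|x - y| -> c <= (cos (pi * x) - cos (pi * y)) ^+ 2.
Proof.
move=> d0 d1; set s := sin (pi / 2 * d).
have p0 : 0 < pi :> R := pi_gt0 R.
have s0 : 0 < s.
  apply: sin_gt0_pi; rewrite mulr_gt0 ?divr_gt0//=.
  rewrite (@le_lt_trans _ _ (pi / 2))//; first by rewrite ler_piMr// divr_ge0// ltW.
  by rewrite ltr_pdivrMr// ltr_pMr// ltr1n.
exists ((2 * (s * s)) ^+ 2); first by rewrite exprn_gt0// mulr_gt0// mulr_gt0.
move=> x y Ix Iy; wlog xy : x y Ix Iy / y <= x => [H|].
  have [yx|/ltW xy] := leP y x; first exact: H.
  by rewrite distrC -[X in _ -> _ <= X]sqrrN opprB; exact: H.
rewrite ger0_norm ?subr_ge0// => dxy.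
move: Ix Iy => /I01E/andP[x0 x1] /I01E/andP[y0 y1].
have d01 : 0 <= d <= 1 by rewrite ltW.
have h1 : s <= sin ((pi * x - pi * y) / 2).
  have -> : (pi * x - pi * y) / 2 = pi / 2 * (x - y) by field.
  suff /andP[] : 0 <= sin (pi / 2 * d) <= sin (pi / 2 * (x - y)) by [].
  by apply: sin_ge_concave => //; rewrite dxy/=; lra.
have h2 : s <= sin ((pi * x + pi * y) / 2).
  have -> : (pi * x + pi * y) / 2 = pi / 2 * (x + y) by field.
  have [xy1|xy1] := leP (x + y) 1.
    suff /andP[] : 0 <= sin (pi / 2 * d) <= sin (pi / 2 * (x + y)) by [].
    by apply: sin_ge_concave => //; rewrite xy1 andbT; lra.
  have -> : sin (pi / 2 * (x + y)) = sin (pi / 2 * (2 - (x + y))).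
    have -> : pi / 2 * (2 - (x + y)) = - (pi / 2 * (x + y)) + pi by field.
    by rewrite sinDpi sinN opprK.
  suff /andP[] : 0 <= sin (pi / 2 * d) <= sin (pi / 2 * (2 - (x + y))) by [].
  by apply: sin_ge_concave => //; apply/andP; split; lra.
have h3 : s * s <= sin ((pi * x + pi * y) / 2) * sin ((pi * x - pi * y) / 2).
  by apply: ler_pM => //; exact: ltW.
have ss : 0 <= s * s by rewrite mulr_ge0// ltW.
by rewrite cosB_prod sqrrN ler_pXn2r ?nnegrE ?mulr_ge0//; lra.
Qed.

(* The inequality behind Korovkin's theorem for the test function cos (pi x),
   which is injective on [0, 1] *)
Lemma korovkin_modulus f (e : R) : {within I, continuous f} -> 0 < e ->
  exists2 C, 0 <= C & forall x y, I x -> I y ->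
    `|f y - f x| <= e + C * (cos (pi * y) - cos (pi * x)) ^+ 2.
Proof.
move=> cf e0; have [d0 d00 hd0] := unif_cont01 cf e0.
have [M [M0 hM]] := within_bounded cf.
set d := Num.min d0 1.
have d_gt0 : 0 < d by rewrite lt_min d00 ltr01.
have d1 : d <= 1 by rewrite ge_min lexx orbT.
have [c c0 hc] := cos_separation d_gt0 d1.
(* For points at distance at least d the oscillation is at most 2 M while the square is at least c;
   for closer points the term e suffices. *)
exists (2 * M / c); first by rewrite divr_ge0 ?mulr_ge0// ltW.
move=> x y Ix Iy; have [dxy|xyd] := leP d `|y - x|.
  have h := hc _ _ Iy Ix dxy.
  have h1 : `|f y - f x| <= 2 * M.
    rewrite (le_trans (ler_normB _ _))// mulr_natl mulr2n.
    by rewrite lerD// hM.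
  rewrite (le_trans h1)// -[leLHS]add0r lerD//; first exact: ltW.
  rewrite -[leLHS]mulr1 -[2 * M / c * _]mulrA ler_wpM2l ?mulr_ge0//.
  by rewrite mulrC ler_pdivlMr// mul1r.
have h : `|f y - f x| < e.
  by apply: hd0 => //; rewrite (lt_le_trans xyd)// ge_min lexx.
rewrite (le_trans (ltW h))// lerDl mulr_ge0 ?sqr_ge0// divr_ge0 ?mulr_ge0//.
exact: ltW.
Qed.

Lemma basis1 x : e_ 1 x = Num.sqrt 2 * cos (pi * x).
Proof. by rewrite basisS mul1r. Qed.

(** The square is a combination of the eigenfunctions 1, e_1 and e_2, on which the semigroup is
    explicit; it vanishes at y = x, so its evolution at x is of order t. *)
Lemma heat_korovkin_quadratic (t x : R) : 0 <= t ->
  heat t (fun y => (cos (pi * y) - cos (pi * x)) ^+ 2) x <= 4 * pi ^+ 2 * t.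
Proof.
move=> t0; set c := cos (pi * x).
have s2 : Num.sqrt 2 != 0 :> R by rewrite sqrtr_eq0 -ltNge.
have E : (fun y => (cos (pi * y) - c) ^+ 2) =
  (fun y => 2^-1 / Num.sqrt 2 * e_ 2 y) \+
  ((fun y => (- 2 * c) / Num.sqrt 2 * e_ 1 y) \+ (fun=> 2^-1 + c ^+ 2)).
  apply/funext => y /=.
  rewrite -/(e_ 2 y) -/(e_ 1 y) basis1 basisS.
  have -> : 2 * pi * y = (pi * y) *+ 2 by rewrite [RHS]mulr2n; ring.
  rewrite cos_mulr2n -[_ *+ 2]mulr_natl; move: (cos (pi * y)) => k.
  by move: (Num.sqrt 2) s2 => q q0; field.
have l1 : L2 (fun y => (- 2 * c) / Num.sqrt 2 * e_ 1 y) by exact/L2Z/L2_basis.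
have l2 : L2 (fun=> 2^-1 + c ^+ 2 : R) by exact: L2_cst.
rewrite E (heatD _ _ (L2Z _ (L2_basis 2)) (L2D l1 l2)) (heatD _ _ l1 l2) heat_cst.
rewrite (heatZ t _ x (L2_basis 1)) (heatZ t _ x (L2_basis 2)).
rewrite !heat_basis// basis1 basisS -/c.
have -> : 2 * pi * x = (pi * x) *+ 2 by rewrite [RHS]mulr2n; ring.
rewrite cos_mulr2n -/c [c ^+ 2 *+ 2]mulr2n.
(* With a = e^(- pi^2 t) the value becomes (1 - a^4) / 2 + c^2 (a^4 - 2 a + 1). Each summand is at
   most 2 (1 - a), and 1 - a <= pi^2 t. *)
have h2 : expR (- (eigen 2 * t)) = expR (- (pi ^+ 2 * t)) ^+ 4.
  by rewrite -expRM_natl /eigen; congr expR; ring.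
rewrite h2 /eigen mul1r.
have a0 := expR_ge0 (- (pi ^+ 2 * t)).
have a1 : expR (- (pi ^+ 2 * t)) <= 1.
  by rewrite expR_le1 oppr_le0 mulr_ge0// sqr_ge0.
have a2 := expR_ge1Dx (- (pi ^+ 2 * t)).
have c1 : c ^+ 2 <= 1 by have := cos_le1 (pi * x); have := cos_geN1 (pi * x); rewrite -/c; nra.
have c0 := sqr_ge0 c.
move: (expR _) a0 a1 a2 => a a0 a1 a2.
have -> : 2^-1 / Num.sqrt 2 * (a ^+ 4 * (Num.sqrt 2 * (c ^+ 2 + c ^+ 2 - 1))) +
   (- 2 * c / Num.sqrt 2 * (a * (Num.sqrt 2 * c)) + (2^-1 + c ^+ 2)) =
   (1 - a ^+ 4) / 2 + c ^+ 2 * (a ^+ 4 - 2 * a + 1).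
  by move: (Num.sqrt 2) s2 => q q0; field.
have a4 : 1 - 4 * (1 - a) <= a ^+ 4.
  rewrite -subr_ge0 (_ : _ - _ = (1 - a) ^+ 2 * ((a + 1) ^+ 2 + 2)); last by ring.
  by rewrite mulr_ge0 ?sqr_ge0// addr_ge0// sqr_ge0.
have a41 : a ^+ 4 <= 1 by rewrite exprn_ile1.
have h : c ^+ 2 * (a ^+ 4 - 2 * a + 1) <= 2 * (1 - a).
  have : a ^+ 4 - 2 * a + 1 <= 2 * (1 - a) by lra.
  have : 0 <= 2 * (1 - a) by lra.
  by nra.
have -> : 4 * pi ^+ 2 * t = 4 * (pi ^+ 2 * t) by ring.
by lra.
Qed.

(** By positivity the bound of |f - f x| by e / 2 + C q survives the semigroup, and at the point x
    the evolution of q is at most 4 pi^2 t. The radius d makes C times this at most e / 2. No lower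
    bound on t is imposed because the semigroup is the identity for t <= 0. *)
Lemma heat_strong_continuity f (e : R) : {within I, continuous f} -> 0 < e ->
  exists2 d, 0 < d & forall t x, t < d -> I x -> `|heat t f x - f x| <= e.
Proof.
move=> cf e0; have e2 : 0 < e / 2 by rewrite divr_gt0.
have [C C0 hC] := korovkin_modulus cf e2.
have lf := L2_cont cf.
have D0 : 0 < 8 * (C + 1) * pi ^+ 2.
  by rewrite mulr_gt0 ?exprn_gt0 ?pi_gt0// mulr_gt0// ltr_wpDl.
exists (e / (8 * (C + 1) * pi ^+ 2)); first by rewrite divr_gt0.
move=> t x td Ix; have [t0|t0] := leP t 0.
  by rewrite heat_le0// subrr normr0 ltW.
pose q y := (cos (pi * y) - cos (pi * x)) ^+ 2.
have lq : L2 q.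
  apply/L2_cont/continuous_subspaceT => y.
  have h : {for y, continuous (fun y => cos (pi * y) - cos (pi * x))}.
    apply: cvgB; last exact: cvg_cst.
    apply: (@continuous_comp _ _ _ (fun x => pi * x) cos).
      by apply: cvgM; [exact: cvg_cst|exact: cvg_id].
    exact: continuous_cos.
  by rewrite /q; under eq_fun do rewrite expr2; apply: cvgM.
have -> : heat t f x - f x = heat t (f \- (fun=> f x)) x.
  by rewrite heatB ?heat_cst//; exact: L2_cst.
have ub : heat t (fun y => e / 2 + C * q y) x <= e.
  have -> : (fun y => e / 2 + C * q y) = (fun=> e / 2) \+ (fun y => C * q y) by [].
  rewrite heatD ?heat_cst ?heatZ//; [|exact: L2_cst|exact: L2Z].
  have := heat_korovkin_quadratic x (ltW t0); rewrite -/q => h.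
  rewrite [leRHS]splitr lerD2l (le_trans (ler_wpM2l C0 h))//.
  move: td; rewrite ltr_pdivlMr// => td.
  have p2 := sqr_ge0 (pi : R).
  have : 0 <= pi ^+ 2 * t by rewrite mulr_ge0// ltW.
  by nra.
have l1 : L2 (f \- (fun=> f x)) by apply: L2B => //; exact: L2_cst.
have l2 : L2 (fun y => e / 2 + C * q y).
  by apply: (L2D (L2_cst _)); exact: L2Z.
have b1 := heat_le t l1 l2 _ Ix.
have b2 := heat_le t (L2N l2) l1 _ Ix.
have hN : heat t (\- (fun y => e / 2 + C * q y)) x =
    - heat t (fun y => e / 2 + C * q y) x.
  rewrite -mulN1r -heatZ//; congr (heat t _ x); apply/funext => y /=.
  by rewrite mulN1r.
rewrite ler_norml; apply/andP; split.
  rewrite (le_trans _ (b2 _))//; first by rewrite hN lerN2.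
  by move=> y Iy /=; have := hC x y Ix Iy; rewrite ler_norml => /andP[].
rewrite (le_trans (b1 _))//.
by move=> y Iy /=; have := hC x y Ix Iy; rewrite ler_norml => /andP[].
Qed.

End heat_semigroup.

(** * Completeness of the cosines among continuous functions *)

Section heat_completeness.
Context {R : realType}.
Implicit Types (f g u w : R -> R) (a b M : nat -> R).

Local Notation mu := (@lebesgue_measure R).
Local Notation I := (`[0, 1]%classic : set R).
Local Notation e_ := (@neumann_basis R).
Local Notation heat := (@neumann_heat R).

(** Young's inequality coefficient by coefficient, with multipliers at most 1, followed by Bessel's
    inequality for f and for g: the L^2 contraction in bilinear form, with a free weight. *)
Lemma heat_dot_young (t al : R) f g : 0 < al -> L2 f -> L2 g ->
  `|dotL2 (heat t f) g| <= (al * dotL2 f f + al^-1 * dotL2 g g) / 2.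
Proof.
move=> al0 lf lg; have [t0|t0] := leP t 0; first by rewrite heat_le0//; exact: dot_young.
rewrite heat_gt0//; set B := _ / 2.
have key N : `|series (fun n => damp t (coef f) n * coef g n) N| <= B.
  have -> : B = al / 2 * dotL2 f f + al^-1 / 2 * dotL2 g g by rewrite /B; ring.
  rewrite (@le_trans _ _ (series (fun n => al / 2 * coef f n ^+ 2 + al^-1 / 2 * coef g n ^+ 2) N))//.
    rewrite /series/= (le_trans (ler_norm_sum _ _ _))// ler_sum// => n _.
    rewrite normrM (@le_trans _ _ (`|coef f n| * `|coef g n|))//.
      by rewrite ler_wpM2r// damp_le// ltW.
    rewrite -(real_normK (num_real (coef f n))) -(real_normK (num_real (coef g n))).
    set p := `|coef f n|; set q := `|coef g n|.
    have E : al / 2 * p ^+ 2 + al^-1 / 2 * q ^+ 2 - p * q = (al * p - q) ^+ 2 / (2 * al).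
      by field; rewrite gt_eqF.
    by rewrite -subr_ge0 E divr_ge0 ?sqr_ge0// mulr_ge0// ltW.
  rewrite /series/= big_split/= -!big_distrr/= lerD// ler_wpM2l ?divr_ge0 ?invr_ge0 ?(ltW al0)//.
    exact: bessel.
  exact: bessel.
have h := dot_cosser (summable_heat t0 lf) lg.
by apply: (cvgr_le_near _ (cvg_norm h)); apply: nearW.
Qed.

Lemma heat_dot_le (t : R) f : L2 f -> dotL2 (heat t f) (heat t f) <= dotL2 f f.
Proof.
move=> lf; have ls := L2_heat t lf.
have := heat_dot_young t ltr01 lf ls; rewrite invr1 !mul1r.
by move=> /(le_trans (ler_norm _)); lra.
Qed.

(** Equal coefficients give equal heat evolutions at every t > 0, and strong continuity lets t tend
    to 0. *)
Lemma coef_inj f g x : {within I, continuous f} -> {within I, continuous g} ->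
  coef f =1 coef g -> I x -> f x = g x.
Proof.
move=> cf cg fg Ix.
have lf := L2_cont cf; have lg := L2_cont cg.
apply/eqP; rewrite -subr_eq0 -normr_le0; apply/ler_addgt0Pl => e e0; rewrite addr0.
have e2 : 0 < e / 2 by rewrite divr_gt0.
have [d1 d10 h1] := heat_strong_continuity cf e2.
have [d2 d20 h2] := heat_strong_continuity cg e2.
set t := Num.min d1 d2 / 2.
have m0 : 0 < Num.min d1 d2 by rewrite lt_min d10 d20.
have t0 : 0 < t by rewrite divr_gt0.
have tm : t < Num.min d1 d2 by rewrite ltr_pdivrMr// ltr_pMr// ltr1n.
have {}h1 := h1 t x (lt_le_trans tm _) Ix; have {}h2 := h2 t x (lt_le_trans tm _) Ix.
have E : heat t f x = heat t g x.
  by rewrite !heat_gt0//; congr (cosser _ x); apply/funext => n; rewrite /damp fg.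
have -> : f x - g x = (heat t g x - g x) - (heat t f x - f x) by rewrite E; ring.
rewrite (le_trans (ler_normB _ _))// [leRHS]splitr lerD//.
  by apply: h2; rewrite ge_min lexx orbT.
by apply: h1; rewrite ge_min lexx.
Qed.

Lemma cosine_inversion f x : {within I, continuous f} -> abs_summable (coef f) ->
  I x -> f x = cosser (coef f) x.
Proof.
move=> cf sf Ix; apply: coef_inj => //.
  by apply/continuous_subspaceT/cosser_continuous.
by move=> n; rewrite coef_cosser.
Qed.

End heat_completeness.

(** * Integrals over time intervals *)

Section calculus.
Context {R : realType}.
Implicit Types (f g F G : R -> R).
Local Notation mu := (@lebesgue_measure R).

Lemma integrable_itv f (a b : R) : continuous f ->
  mu.-integrable `[a, b] (EFin \o f).
Proof.
move=> cf; apply: continuous_compact_integrable; first exact: segment_compact.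
exact: continuous_subspaceT.
Qed.

Lemma Rintegral_itv_cst (a b c : R) : a <= b -> \int[mu]_(x in `[a, b]) c = c * (b - a).
Proof.
move=> ab; rewrite Rintegral_cst//=.
rewrite lebesgue_measure_itv/= lte_fin; case: ltP => [_|ba] //=.
have -> : a = b by apply/eqP; rewrite eq_le ab ba.
by rewrite subrr.
Qed.

Lemma Rintegral_itv_empty f (a b : R) : b < a -> \int[mu]_(x in `[a, b]) f x = 0.
Proof. by move=> ba; rewrite set_itv_ge ?bnd_simp -?ltNge// Rintegral_set0. Qed.

Lemma Rintegral_itv_cat f (a b c : R) : continuous f -> a <= b -> b <= c ->
  \int[mu]_(x in `[a, c]) f x =
  \int[mu]_(x in `[a, b]) f x + \int[mu]_(x in `[b, c]) f x.
Proof.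
move=> cf ab bc; have := @Rintegral_itvB R f (BLeft a) (BRight c) b.
rewrite !bnd_simp => /(_ (integrable_itv a c cf) ab bc) h.
have iS : mu.-integrable `]b, c] (EFin \o f).
  apply: integrableS (integrable_itv b c cf) => //.
  by apply: subset_itvr; rewrite bnd_simp.
by have <- := Rintegral_itv_obnd_cbnd iS; rewrite -h addrC subrK.
Qed.

Lemma Rintegral_itv_norm_le f (a b M : R) : continuous f -> a <= b ->
  (forall x, a <= x <= b -> `|f x| <= M) ->
  `|\int[mu]_(x in `[a, b]) f x| <= M * (b - a).
Proof.
move=> cf ab fM; rewrite (le_trans (le_normr_Rintegral _ (integrable_itv a b cf)))//.
rewrite -Rintegral_itv_cst//; apply: le_Rintegral => //.
- by apply: (integrable_itv (f := fun x => `|f x|)) => x; apply: cvg_norm; exact: cf.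
- by apply: (integrable_itv (f := fun=> M)) => x; exact: cvg_cst.
Qed.

Lemma le_Rintegral_itv f g (a b : R) : continuous f -> continuous g ->
  (forall x, a <= x <= b -> f x <= g x) ->
  \int[mu]_(x in `[a, b]) f x <= \int[mu]_(x in `[a, b]) g x.
Proof.
move=> cf cg fg; by apply: le_Rintegral => //; exact: integrable_itv.
Qed.

Lemma FTC2_itv F f (a b : R) : a <= b ->
  (forall x : R, a <= x <= b -> is_derive x (1 : R) F (f x)) -> continuous f ->
  \int[mu]_(x in `[a, b]) f x = F b - F a.
Proof.
rewrite le_eqVlt => /predU1P[<- _ _|ab dF cf].
  by rewrite set_itv1 Rintegral_set1 subrr.
have cF x : a <= x <= b -> {for x, continuous F}.
  by move=> xab; apply/differentiable_continuous/derivable1_diffP; case: (dF x xab).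
rewrite /Rintegral (continuous_FTC2 (F := F) ab)//.
- exact: continuous_subspaceT.
- split.
  + by move=> x; rewrite in_itv/= => /andP[ax xb]; case: (dF x) => //; rewrite !ltW.
  + by apply: cvg_at_right_filter; apply: cF; rewrite lexx ltW.
  + by apply: cvg_at_left_filter; apply: cF; rewrite lexx ltW.
- move=> x; rewrite in_itv/= => /andP[ax xb]; rewrite derive1E.
  by case: (dF x) => //; rewrite !ltW.
Qed.

Lemma is_derive_primitive f (a x : R) : continuous f -> a < x ->
  is_derive x (1 : R) (fun y => \int[mu]_(s in `[a, y]) f s) (f x).
Proof.
move=> cf ax; have xx : x < x + 1 by rewrite ltrDl.
have [h1 h2] := continuous_FTC1_closed xx (integrable_itv a (x + 1) cf) ax (cf x).
by apply: (DeriveDef h1); rewrite -derive1E; exact: h2.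
Qed.

Lemma is_derive_estimate F (x l : R) :
  (forall e, 0 < e -> exists2 d, 0 < d &
    forall h, `|h| < d -> `|F (x + h) - F x - h * l| <= e * `|h|) ->
  is_derive x (1 : R) F l.
Proof.
move=> H.
have : h^-1 *: (F (h + x) - F x) @[h --> 0^'] --> l.
  apply/cvgrPdist_le => e e0; have [d d0 hd] := H e e0.
  near=> h.
  have h0 : h != 0 by near: h; exact: nbhs_dnbhs_neq.
  have hdd : `|h| < d by near: h; apply: dnbhs0_lt.
  have := hd h hdd; rewrite [h + x]addrC => hh.
  have -> : l - h^-1 *: (F (x + h) - F x) = - (h^-1 * (F (x + h) - F x - h * l)).
    by rewrite /GRing.scale/=; field.
  rewrite normrN normrM normfV ler_pdivrMl ?normr_gt0//.
  by rewrite [`|h| * e]mulrC.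
move=> H1; apply: DeriveDef.
  rewrite /derivable; apply/cvg_ex; exists l.
  by under eq_fun do rewrite [_ *: 1]mulr1; exact: H1.
rewrite /derive; apply/cvg_lim => //.
by under eq_fun do rewrite [_ *: 1]mulr1; exact: H1.
Unshelve. all: by end_near. Qed.

Lemma Rintegral_itv_reflect f (t : R) : continuous f ->
  \int[mu]_(s in `[0, t]) f (t - s) = \int[mu]_(s in `[0, t]) f s.
Proof.
move=> cf; have [t0|t0] := ltP t 0; first by rewrite !Rintegral_itv_empty.
(* Starting the primitive at -1 makes it differentiable at 0 as well, from both sides. *)
pose P y := \int[mu]_(s in `[-1, y]) f s.
have dP (x : R) : 0 <= x -> is_derive x (1 : R) P (f x).
  by move=> x0; apply: is_derive_primitive => //; rewrite (lt_le_trans _ x0)// ltrN10.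
have dQ (x : R) : 0 <= x <= t -> is_derive x (1 : R) (fun s => - P (t - s)) (f (t - x)).
  move=> /andP[x0 xt].
  have h1 : is_derive (t - x) (1 : R) P (f (t - x)) by apply: dP; rewrite subr_ge0.
  have h2 : is_derive x (1 : R) (fun s => t - s) (-1).
    have -> : (fun s => t - s) = cst t - id by [].
    by apply: is_derive_eq; rewrite sub0r.
  have -> : (fun s => - P (t - s)) = - (P \o (fun s => t - s)) by [].
  by apply: is_derive_eq; rewrite mulrN1 opprK.
have cr : continuous (fun s => f (t - s)).
  move=> x; apply: (@continuous_comp _ _ _ (fun s => t - s) f); last exact: cf.
  by apply: cvgB; [exact: cvg_cst|exact: cvg_id].
have dP' (x : R) : 0 <= x <= t -> is_derive x (1 : R) P (f x).
  by move=> /andP[x0 _]; exact: dP.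
have -> := FTC2_itv t0 dQ cr; have -> := FTC2_itv t0 dP' cf.
by rewrite subrr subr0; ring.
Qed.

End calculus.

(** * Duhamel integrals *)

Section curves.
Context {R : realType}.
Implicit Types (f g u w phi : R -> R) (h k : R -> R -> R).

Local Notation mu := (@lebesgue_measure R).
Local Notation I := (`[0, 1]%classic : set R).
Local Notation e_ := (@neumann_basis R).
Local Notation heat := (@neumann_heat R).

(* Continuous curves in C([0, 1]). They are parametrized by all of R, since
   the semigroup and the Duhamel integral extend constantly to t < 0: this
   avoids one-sided limits at t = 0. *)
Definition ccurve h : Prop :=
  (forall t, {within I, continuous (h t)}) /\
  forall (t0 e : R), 0 < e -> exists2 d, 0 < d &
    forall t, `|t - t0| < d -> forall x, I x -> `|h t x - h t0 x| <= e.

Lemma ccurve_L2 h t : ccurve h -> L2 (h t).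
Proof. by move=> ch; apply: L2_cont; exact: (ch.1 t). Qed.

Lemma ccurve_continuous h x : ccurve h -> I x -> continuous (h^~ x).
Proof.
move=> [_ ch] Ix t0; apply/cvgrPdist_le => e e0.
have [d d0 hd] := ch t0 e e0.
apply/nbhs_ballP; exists d => //= t.
by rewrite /ball/= => td; rewrite distrC; apply: hd => //; rewrite distrC.
Qed.

(** Compactness of [a, b]: thresholds valid near each point yield a common one. Since the common
    parameter is small, upper bounds are passed through it as inverses. *)
Lemma itv_near_covering (a b : R) (P : R -> R -> Prop) :
  (forall s0, a <= s0 <= b -> exists2 d, 0 < d &
     forall s r, `|s - s0| < d -> 0 < r < d -> P r s) ->
  exists2 d, 0 < d & forall s, a <= s <= b -> P d s.
Proof.
move=> H.
have := (@compact_near_coveringP R `[a, b]%classic).1 (@segment_compact R a b).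
move=> /(_ R (0^'+) P); case.
  move=> s; rewrite /= in_itv/= => /H[d d0 hd].
  exists (ball s d, [set z | 0 < z < d]) => /=.
    split; first exact: nbhsx_ballx.
    near=> r => /=; apply/andP; split; near: r; [exact: nbhs_right_gt|exact: nbhs_right_lt].
  move=> [z r] /= [sz rd]; apply: hd => //.
  by move: sz; rewrite /ball/= distrC.
move=> d /= d0 hd; exists (d / 2); first by rewrite divr_gt0.
move=> s sab; apply: (hd (d / 2)) => //=.
- by rewrite sub0r normrN ger0_norm ?divr_ge0 ?ltW// gtr_pMr// invf_lt1// ltr1n.
- by rewrite divr_gt0.
Unshelve. all: by end_near. Qed.

Lemma ccurve_uniform h (a b e : R) : ccurve h -> 0 < e -> exists2 d, 0 < d &
  forall s, a <= s <= b -> forall t, `|t - s| < d ->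
  forall x, I x -> `|h t x - h s x| <= e.
Proof.
move=> [_ ch] e0; have e2 : 0 < e / 2 by rewrite divr_gt0.
apply: (@itv_near_covering a b (fun d s => forall t, `|t - s| < d ->
  forall x, I x -> `|h t x - h s x| <= e)) => s0 _.
have [d d0 hd] := ch s0 _ e2.
exists (d / 2); first by rewrite divr_gt0.
move=> s r ss0 /andP[r0 rd] t ts x Ix.
have h1 : `|h s x - h s0 x| <= e / 2.
  apply: hd => //; rewrite (lt_le_trans ss0)// ler_piMr ?(ltW d0)//.
  by rewrite invf_le1// ler1n.
have h2 : `|h t x - h s0 x| <= e / 2.
  apply: hd => //; rewrite -(subrKA s) (le_lt_trans (ler_normD _ _))//.
  by rewrite [ltRHS]splitr ltrD// (lt_trans ts).
rewrite -(subrKA (h s0 x)) (le_trans (ler_normD _ _))//.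
by rewrite [leRHS]splitr lerD// distrC.
Qed.

Lemma ccurve_bounded h (a b : R) : ccurve h -> exists M, 0 <= M /\
  forall s, a <= s <= b -> forall x, I x -> `|h s x| <= M.
Proof.
move=> ch.
have [d d0 hd] : exists2 d, 0 < d & forall s, a <= s <= b ->
    forall x, I x -> `|h s x| <= d^-1.
  apply: (@itv_near_covering a b) => s0 _.
  have [d d0 hd] := ch.2 s0 1 ltr01.
  have [M [M0 hM]] := within_bounded (ch.1 s0).
  exists (Num.min d (M + 1)^-1); first by rewrite lt_min d0 invr_gt0 ltr_wpDl.
  move=> s r; rewrite !lt_min => /andP[sd _] /andP[r0 /andP[_ rM]] x Ix.
  rewrite -(subrK (h s0 x) (h s x)) (le_trans (ler_normD _ _))//.
  rewrite (@le_trans _ _ (1 + M))//; first by rewrite lerD ?hd// hM//; apply/I01E.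
  by rewrite addrC -[leLHS]invrK lef_pV2 ?posrE ?invr_gt0 ?ltr_wpDl// ltW.
by exists d^-1; split => //; rewrite invr_ge0 ltW.
Qed.

Lemma ccurveD h k : ccurve h -> ccurve k -> ccurve (fun t x => h t x + k t x).
Proof.
move=> ch ck; split.
  by move=> t x; apply: cvgD; [exact: (ch.1 t)|exact: (ck.1 t)].
move=> t0 e e0; have e2 : 0 < e / 2 by rewrite divr_gt0.
have [d1 d10 h1] := ch.2 t0 _ e2; have [d2 d20 h2] := ck.2 t0 _ e2.
exists (Num.min d1 d2); first by rewrite lt_min d10.
move=> t; rewrite lt_min => /andP[t1 t2] x Ix.
have -> : h t x + k t x - (h t0 x + k t0 x) = (h t x - h t0 x) + (k t x - k t0 x) by ring.
by rewrite (le_trans (ler_normD _ _))// [leRHS]splitr lerD// ?h1// h2.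
Qed.

Lemma ccurveM_within f h : {within I, continuous f} -> ccurve h ->
  ccurve (fun t x => f x * h t x).
Proof.
move=> cf ch; split.
  by move=> t x; apply: cvgM; [exact: cf|exact: (ch.1 t)].
have [M [M0 hM]] := within_bounded cf.
have M1 : 0 < M + 1 by rewrite ltr_wpDl.
move=> t0 e e0; have e2 : 0 < e / (M + 1) by rewrite divr_gt0.
have [d d0 hd] := ch.2 t0 _ e2.
exists d => // t td x Ix.
rewrite -mulrBr normrM (le_trans (ler_pM _ _ (hM x Ix) (hd t td x Ix)))//.
by rewrite mulrCA ler_piMr ?(ltW e0)// ler_pdivrMr// mul1r lerDl.
Qed.

Lemma ccurveM_scalar phi h : continuous phi -> ccurve h ->
  ccurve (fun t x => phi t * h t x).
Proof.
move=> cp ch; split.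
  by move=> t x; apply: cvgM; [exact: cvg_cst|exact: (ch.1 t)].
move=> t0 e e0; have [M [M0 hM]] := within_bounded (ch.1 t0).
have M1 : 0 < M + 1 by rewrite ltr_wpDl.
pose N := `|phi t0| + 1; have N0 : 0 < N by rewrite ltr_wpDl.
have e2 : 0 < e / 2 / N by rewrite !divr_gt0.
have e3 : 0 < e / 2 / (M + 1) by rewrite !divr_gt0.
have [d d0 hd] := ch.2 t0 _ e2.
have /cvgrPdist_lt /(_ _ e3) /nbhs_ballP[d1 /= d10 h1] := cp t0.
have /cvgrPdist_lt /(_ _ ltr01) /nbhs_ballP[d2 /= d20 h2] := cp t0.
exists (Num.min d (Num.min d1 d2)); first by rewrite !lt_min d0 d10 d20.
move=> t; rewrite !lt_min => /and3P[td t1 t2] x Ix.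
have {}h1 : `|phi t - phi t0| <= e / 2 / (M + 1).
  by rewrite distrC ltW// h1// /ball/= distrC.
have {}h2 : `|phi t| <= N.
  rewrite -(subrK (phi t0) (phi t)) (le_trans (ler_normD _ _))// /N addrC lerD2l.
  by rewrite distrC ltW// h2// /ball/= distrC.
have -> : phi t * h t x - phi t0 * h t0 x =
  phi t * (h t x - h t0 x) + (phi t - phi t0) * h t0 x by ring.
rewrite (le_trans (ler_normD _ _))// [leRHS]splitr lerD// normrM.
  rewrite (le_trans (ler_pM _ _ h2 (hd t td x Ix)))//.
  by rewrite mulrC divfK// gt_eqF.
rewrite (le_trans (ler_pM _ _ h1 (hM x Ix)))//.
rewrite (@le_trans _ _ (e / 2 / (M + 1) * (M + 1)))//.
  by rewrite ler_wpM2l ?(ltW e3)// lerDl.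
by rewrite divfK// gt_eqF.
Qed.

Lemma ccurve_dot h phi : ccurve h -> L2 phi -> continuous (fun t => dotL2 (h t) phi).
Proof.
move=> ch lp t0; apply/cvgrPdist_le => e e0.
set P := \int[mu]_(x in I) `|phi x|.
have P0 : 0 <= P by apply: Rintegral_ge0.
have P1 : 0 < P + 1 by rewrite ltr_wpDl.
have e2 : 0 < e / (P + 1) by rewrite divr_gt0.
have [d d0 hd] := ch.2 t0 _ e2.
apply/nbhs_ballP; exists d => //= t; rewrite /ball/= => td.
rewrite distrC -dotBl//; try exact: ccurve_L2.
rewrite (le_trans (dot_sup (M := e / (P + 1)) _ lp _))//.
- by apply: L2B; exact: ccurve_L2.
- by move=> x Ix /=; apply: hd => //; rewrite distrC.
- by rewrite -/P mulrAC ler_pdivrMr// ler_wpM2l ?(ltW e0)// lerDl.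
Qed.

Lemma ccurveB h k : ccurve h -> ccurve k -> ccurve (fun t x => h t x - k t x).
Proof.
move=> ch ck; have c1 : continuous ((fun=> -1) : R -> R) by move=> s; exact: cvg_cst.
have := ccurveD ch (ccurveM_scalar c1 ck).
rewrite (_ : (fun t x => _) = (fun t x => h t x - k t x))//.
by apply/funext => s; apply/funext => y; rewrite mulN1r.
Qed.

Lemma ccurve_lim (hn : nat -> R -> R -> R) h :
  (forall n, ccurve (hn n)) ->
  (forall (T e : R), 0 < e -> exists n, forall t, t <= T -> forall x, I x ->
      `|h t x - hn n t x| <= e) ->
  ccurve h.
Proof.
move=> cn H; split.
  move=> t; apply/subspace_continuousP => x Ix; apply/cvgrPdist_le => e e0.
  have e3 : 0 < e / 3 by rewrite divr_gt0.
  have [n hn3] := H t _ e3.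
  have /subspace_continuousP /(_ x Ix) /cvgrPdist_le /(_ _ e3) := (cn n).1 t.
  rewrite !near_withinE; apply: filterS => y hy Iy.
  have -> : h t x - h t y = (h t x - hn n t x) + (hn n t x - hn n t y) - (h t y - hn n t y) by ring.
  have -> : e = e / 3 + e / 3 + e / 3 by field.
  rewrite (le_trans (ler_normB _ _))// lerD//; last exact: hn3.
  by rewrite (le_trans (ler_normD _ _))// lerD//; [exact: hn3|exact: hy].
move=> t0 e e0; have e3 : 0 < e / 3 by rewrite divr_gt0.
have [n hn3] := H (t0 + 1) _ e3.
have [d d0 hd] := (cn n).2 t0 _ e3.
exists (Num.min d 1); first by rewrite lt_min d0 ltr01.
move=> t; rewrite lt_min => /andP[td t1] x Ix.
have -> : h t x - h t0 x = (h t x - hn n t x) + (hn n t x - hn n t0 x) - (h t0 x - hn n t0 x) by ring.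
have -> : e = e / 3 + e / 3 + e / 3 by field.
have tt : t <= t0 + 1 by move: t1; rewrite ltr_norml => /andP[_]; lra.
rewrite (le_trans (ler_normB _ _))// lerD//; last by apply: hn3 => //; lra.
by rewrite (le_trans (ler_normD _ _))// lerD//; [exact: hn3|exact: hd].
Qed.

Lemma ccurve_int_within h (a b : R) : ccurve h ->
  {within I, continuous (fun x => \int[mu]_(s in `[a, b]) h s x)}.
Proof.
move=> ch; have [ba|ab] := ltP b a.
  have -> : (fun x => \int[mu]_(s in `[a, b]) h s x) = fun=> 0.
    by apply/funext => x; rewrite Rintegral_itv_empty.
  by apply: continuous_subspaceT => x; exact: cvg_cst.
apply/subspace_continuousP => x Ix; apply/cvgrPdist_le => e e0.
have b1 : 0 < b - a + 1 by rewrite ltr_wpDl// subr_ge0.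
have e3 : 0 < e / (b - a + 1) / 3 by rewrite !divr_gt0.
have [d d0 hd] : exists2 d, 0 < d & forall s, a <= s <= b -> forall y, I y ->
    `|x - y| < d -> `|h s x - h s y| <= e / (b - a + 1).
  apply: (@itv_near_covering a b) => s0 _.
  have [d1 d10 h1] := ch.2 s0 _ e3.
  have /subspace_continuousP /(_ x Ix) /cvgrPdist_le /(_ _ e3) := ch.1 s0.
  rewrite near_withinE => /nbhs_ballP[d2 /= d20 h2].
  exists (Num.min d1 d2); first by rewrite lt_min d10.
  move=> s r; rewrite !lt_min => /andP[s1 _] /and3P[r0 _ r2] y Iy xy.
  have -> : h s x - h s y = (h s x - h s0 x) + (h s0 x - h s0 y) - (h s y - h s0 y) by ring.
  have -> : e / (b - a + 1) = e / (b - a + 1) / 3 + e / (b - a + 1) / 3 + e / (b - a + 1) / 3 by field; rewrite gt_eqF.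
  rewrite (le_trans (ler_normB _ _))// lerD//; last exact: h1.
  rewrite (le_trans (ler_normD _ _))// lerD//; first exact: h1.
  by apply: h2 => //; rewrite /ball/= (lt_trans xy).
rewrite near_withinE; apply/nbhs_ballP; exists d => //= y xy Iy.
have cx := ccurve_continuous ch Ix; have cy := ccurve_continuous ch Iy.
rewrite -RintegralB//; try exact: integrable_itv.
rewrite (le_trans (@Rintegral_itv_norm_le _ (fun s => h s x - h s y) a b (e / (b - a + 1)) _ ab _))//.
- by move=> s; apply: cvgB; [exact: cx|exact: cy].
- by move=> s sab; exact: hd.
- by rewrite mulrAC ler_pdivrMr// ler_wpM2l ?(ltW e0)// lerDl.
Qed.

(** Proved by differentiation: the pairing of phi with the integral up to t has derivative <h t,
    phi>, and the fundamental theorem recovers the right-hand side. *)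
Lemma ccurve_fubini h (a b : R) phi : ccurve h -> L2 phi ->
  dotL2 (fun x => \int[mu]_(s in `[a, b]) h s x) phi =
  \int[mu]_(s in `[a, b]) dotL2 (h s) phi.
Proof.
move=> ch lp; have [ba|ab] := ltP b a.
  rewrite Rintegral_itv_empty// -(mul0r (dotL2 (fun=> 1) phi)) -dotZl//.
    by apply: eq_dot => // x _; rewrite Rintegral_itv_empty// mul0r.
  exact: L2_cst.
pose J (c d : R) x := \int[mu]_(s in `[c, d]) h s x.
have lJ c d : L2 (J c d) by apply/L2_cont/ccurve_int_within.
have cI x : I x -> continuous (h^~ x) by exact: ccurve_continuous.
(* The lower limit a - 1 makes a an interior point, where F has a two-sided derivative. *)
pose F t := dotL2 (J (a - 1) t) phi.
pose P := \int[mu]_(x in I) `|phi x|.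
have P0 : 0 <= P by apply: Rintegral_ge0.
have P1 : 0 < P + 1 by rewrite ltr_wpDl.
(* One estimate for increments of both signs: t can be either end of [c, c + r]. *)
have key (c r t e : R) : a - 1 <= c -> 0 <= r -> c <= t <= c + r ->
    (forall s, c <= s <= c + r -> forall x, I x -> `|h s x - h t x| <= e) ->
    `|F (c + r) - F c - r * dotL2 (h t) phi| <= e * r * P.
  move=> ac r0 tcd he; have cd : c <= c + r by rewrite lerDl.
  rewrite /F -dotBl//.
  have lt : L2 (h t) by exact: ccurve_L2.
  rewrite -dotZl// -dotBl//; [|exact: L2B|exact: L2Z].
  apply: dot_sup => //; first by apply: L2B; [exact: L2B|exact: L2Z].
  move=> x Ix /=.
  have -> : J (a - 1) (c + r) x - J (a - 1) c x = \int[mu]_(s in `[c, c + r]) h s x.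
    by rewrite /J (Rintegral_itv_cat (cI x Ix) ac cd); ring.
  have rE : r = c + r - c by rewrite addrAC subrr add0r.
  rewrite mulrC [in h t x * r]rE -Rintegral_itv_cst// -RintegralB//; last 2 first.
  - by apply: integrable_itv; exact: cI.
  - by apply: (@integrable_itv _ (fun=> h t x)) => y; exact: cvg_cst.
  rewrite [in leRHS]rE.
  apply: (@Rintegral_itv_norm_le _ (fun s => h s x - h t x)) => //.
    by move=> s; apply: cvgB; [exact: (cI x Ix)|exact: cvg_cst].
  by move=> s sab; exact: he.
have dF t : a <= t -> is_derive t (1 : R) F (dotL2 (h t) phi).
  move=> at_; apply: is_derive_estimate => e e0.
  have e1 : 0 < e / (P + 1) by rewrite divr_gt0.
  have [d d0 hd] := ch.2 t _ e1.
  have eP : e / (P + 1) * P <= e.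
    by rewrite mulrAC ler_pdivrMr// ler_wpM2l ?(ltW e0)// lerDl.
  exists (Num.min d 1); first by rewrite lt_min d0 ltr01.
  move=> r; rewrite lt_min => /andP[rd r1].
  have [r0|r0] := leP 0 r.
    rewrite (le_trans (@key t r t (e / (P + 1)) _ r0 _ _))//.
    - by rewrite (le_trans _ at_)// gerBl.
    - by rewrite lexx lerDl.
    - move=> s /andP[s1 s2] x Ix; apply: hd => //.
      by rewrite (le_lt_trans _ rd)// !ger0_norm ?subr_ge0// lerBlDl.
    - by rewrite mulrAC ger0_norm// ler_wpM2r.
  have r0' : 0 <= - r by rewrite oppr_ge0 ltW.
  have := @key (t + r) (- r) t (e / (P + 1)) _ r0'; rewrite addrK.
  have flip (x y q : R) : `|x - y - - r * q| = `|y - x - r * q|.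
    by rewrite -normrN; congr (`|_|); ring.
  rewrite flip => H; move: r1; rewrite ltr0_norm// => r1.
  rewrite (le_trans (H _ _ _))//.
  - by lra.
  - by rewrite gerDl (ltW r0) lexx.
  - move=> s /andP[s1 s2] x Ix; apply: hd => //.
    by rewrite (le_lt_trans _ rd)// ler0_norm ?subr_le0// ltr0_norm//; lra.
  - by rewrite mulrAC ler_wpM2r.
have dF' (t : R) : a <= t <= b -> is_derive t (1 : R) F (dotL2 (h t) phi).
  by move=> /andP[at_ _]; exact: dF.
rewrite (FTC2_itv ab dF' (ccurve_dot ch lp)) /F -dotBl//.
apply: eq_dot => // x /set_mem Ix /=; rewrite /J.
have aa : a - 1 <= a by rewrite gerBl.
by rewrite (Rintegral_itv_cat (cI x Ix) aa ab); ring.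
Qed.

End curves.

(** * The semigroup along curves and the Duhamel integral *)

Section duhamel.
Context {R : realType}.
Implicit Types (f g u w phi : R -> R) (h k : R -> R -> R).

Local Notation mu := (@lebesgue_measure R).
Local Notation I := (`[0, 1]%classic : set R).
Local Notation e_ := (@neumann_basis R).
Local Notation heat := (@neumann_heat R).

Lemma heat_max0 (t : R) f : heat (Num.max 0 t) f = heat t f.
Proof. by have [t0|t0] := leP t 0 => //; rewrite !heat_le0. Qed.

Lemma max0_dist (s t : R) : `|Num.max 0 s - Num.max 0 t| <= `|s - t|.
Proof.
have [s0|s0] := leP s 0; have [t0|t0] := leP t 0 => //.
- by rewrite subrr normr0.
- by rewrite sub0r normrN gtr0_norm// ler0_norm; lra.
- by rewrite subr0 gtr0_norm// ger0_norm; lra.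
Qed.

(** For s <= s' the semigroup law writes the difference as the evolution for time s of heat (s' - s)
    f - f, and the semigroup contracts the sup norm. Thus continuity at time 0 is uniform in
    time. *)
Lemma heat_time_dist f (d e s s' x : R) : {within I, continuous f} ->
  (forall t x, t < d -> I x -> `|heat t f x - f x| <= e) ->
  `|s - s'| < d -> I x -> `|heat s f x - heat s' f x| <= e.
Proof.
move=> cf fd ssd Ix; rewrite -(heat_max0 s) -(heat_max0 s').
have {}ssd := le_lt_trans (max0_dist s s') ssd.
have s0 : 0 <= Num.max 0 s by rewrite le_max lexx.
have s'0 : 0 <= Num.max 0 s' by rewrite le_max lexx.
move: (Num.max 0 s) (Num.max 0 s') s0 s'0 ssd => {s}s {s'}s'.
have lf := L2_cont cf.
wlog ss' : s s' / s <= s' => [H|].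
  move=> s0 s'0 ssd; have [?|/ltW ?] := leP s s'; first exact: H.
  by rewrite distrC; apply: H => //; rewrite distrC.
move=> s0 s'0 ssd.
have -> : heat s' f x = heat s (heat (s' - s) f) x.
  by rewrite heat_semigroup ?subr_ge0// addrC subrK.
rewrite distrC.
have ls : L2 (heat (s' - s) f) by exact: L2_heat.
apply: heat_dist => // y Iy; apply: fd => //.
by move: ssd; rewrite distrC ger0_norm// subr_ge0.
Qed.

Lemma ccurve_heat f : {within I, continuous f} -> ccurve (fun t => heat t f).
Proof.
move=> cf; split; first by move=> t; exact: heat_continuous.
move=> t0 e e0; have [d d0 hd] := heat_strong_continuity cf e0.
by exists d => // t td x Ix; apply: heat_time_dist hd _ _.
Qed.

Lemma ccurve_heat_curve k : ccurve k -> ccurve (fun t => heat t (k t)).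
Proof.
move=> ck; split; first by move=> t; apply: heat_continuous; exact: ck.1.
move=> t0 e e0; have e2 : 0 < e / 2 by rewrite divr_gt0.
have [d1 d10 h1] := (ccurve_heat (ck.1 t0)).2 t0 _ e2.
have [d2 d20 h2] := ck.2 t0 _ e2.
exists (Num.min d1 d2); first by rewrite lt_min d10.
move=> t; rewrite lt_min => /andP[t1 t2] x Ix.
rewrite -(subrKA (heat t (k t0) x)) (le_trans (ler_normD _ _))//.
rewrite [leRHS]splitr lerD//; last exact: h1.
by apply: heat_dist => //; [exact: ccurve_L2..|exact: h2].
Qed.

Lemma ccurve_shift h (t : R) : ccurve h -> ccurve (fun s => h (t - s)).
Proof.
move=> ch; split; first by move=> s; exact: ch.1.
move=> t0 e e0; have [d d0 hd] := ch.2 (t - t0) _ e0.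
exists d => // s sd x Ix; apply: hd => //.
have -> : t - s - (t - t0) = t0 - s by ring.
by rewrite distrC.
Qed.

Lemma ccurve_heat_shift h (t : R) : ccurve h -> ccurve (fun r => heat r (h (t - r))).
Proof. by move=> ch; apply/(@ccurve_heat_curve (fun r => h (t - r)))/ccurve_shift. Qed.

Lemma ccurve_heat_shift' h (t : R) : ccurve h -> ccurve (fun s => heat (t - s) (h s)).
Proof.
move=> ch; have := ccurve_shift t (ccurve_heat_shift t ch).
by under [X in ccurve X -> _]eq_fun do rewrite subKr.
Qed.

(* The Duhamel integral \int_0^t S(t - s) h(s) ds, after the substitution
   r = t - s *)
Definition duh h (t x : R) : R := \int[mu]_(r in `[0, t]) heat r (h (t - r)) x.

Lemma duh_le0 h (t x : R) : t <= 0 -> duh h t x = 0.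
Proof.
rewrite le_eqVlt => /predU1P[->|t0].
  by rewrite /duh set_itv1 Rintegral_set1.
by rewrite /duh Rintegral_itv_empty.
Qed.

Lemma duh_max0 h (t x : R) : duh h (Num.max 0 t) x = duh h t x.
Proof. by have [t0|t0] := leP t 0 => //; rewrite !duh_le0. Qed.

(** For s <= s' the integrands on [0, s] differ by at most e / (2 T) by uniform continuity of h, and
    the remaining interval [s, s'] is shorter than e / (2 (M + 1)), with integrand at most M. *)
Lemma ccurve_duh h : ccurve h -> ccurve (duh h).
Proof.
move=> ch; split.
  move=> t; exact: (@ccurve_int_within _ _ 0 t (ccurve_heat_shift t ch)).
move=> t0 e e0.
pose T := `|t0| + 1; have T0 : 0 < T by rewrite ltr_wpDl.
have [M [M0 hM]] := ccurve_bounded 0 T ch.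
have e2 : 0 < e / 2 / T by rewrite !divr_gt0.
have [d d0 hd] := ccurve_uniform 0 T ch e2.
have M1 : 0 < M + 1 by rewrite ltr_wpDl.
pose d' := Num.min (Num.min d 1) (e / 2 / (M + 1)).
have key (s s' x : R) : 0 <= s -> s <= s' -> s' <= T -> s' - s < d' -> I x ->
    `|duh h s' x - duh h s x| <= e.
  move=> s0 ss' s'T; rewrite !lt_min -andbA => /and3P[sd _ sM] Ix.
  have c1 := ccurve_continuous (ccurve_heat_shift s' ch) Ix.
  have c2 := ccurve_continuous (ccurve_heat_shift s ch) Ix.
  rewrite /duh (Rintegral_itv_cat c1 s0 ss') addrAC -RintegralB//; last 2 first.
  - exact: integrable_itv.
  - exact: integrable_itv.
  rewrite (le_trans (ler_normD _ _))// [leRHS]splitr lerD//.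
    rewrite (le_trans (@Rintegral_itv_norm_le _
      (fun r => heat r (h (s' - r)) x - heat r (h (s - r)) x) 0 s (e / 2 / T) _ s0 _))//.
    - by move=> r; apply: cvgB; [exact: c1|exact: c2].
    - move=> r /andP[r0 rs]; apply: heat_dist => //; try exact: ccurve_L2.
      move=> y Iy; apply: hd => //.
        by rewrite subr_ge0 rs/= (le_trans _ s'T)// (le_trans _ ss')// gerBl.
      have -> : s' - r - (s - r) = s' - s by ring.
      by rewrite ger0_norm// subr_ge0.
    - rewrite subr0 mulrAC ler_pdivrMr// ler_wpM2l ?divr_ge0 ?(ltW e0)//.
      exact: le_trans s'T.
  rewrite (le_trans (@Rintegral_itv_norm_le _ _ s s' M c1 ss' _))//.
    move=> r /andP[sr rs']; apply: heat_bound => //; first exact: ccurve_L2.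
    move=> y Iy; apply: hM => //; rewrite subr_ge0 rs'/= (le_trans _ s'T)// gerBl.
    exact: le_trans sr.
  move: sM; rewrite ltr_pdivlMr// => sM; rewrite mulrC (le_trans _ (ltW sM))//.
  by rewrite ler_wpM2l ?subr_ge0// lerDl.
exists d'; first by rewrite !lt_min d0 ltr01 !divr_gt0.
move=> t td x Ix; rewrite -(duh_max0 h t) -(duh_max0 h t0).
have ttd := le_lt_trans (max0_dist t t0) td.
have tT : Num.max 0 t <= T.
  rewrite ge_max (ltW T0)/= /T; move: td; rewrite !lt_min -andbA => /and3P[_ t1 _].
  have := ler_norm t0; move: t1; rewrite ltr_norml => /andP[_]; lra.
have t0T : Num.max 0 t0 <= T.
  by rewrite ge_max (ltW T0)/= /T; have := ler_norm t0; lra.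
have m1 : 0 <= Num.max 0 t by rewrite le_max lexx.
have m2 : 0 <= Num.max 0 t0 by rewrite le_max lexx.
have [tt|/ltW tt] := leP (Num.max 0 t0) (Num.max 0 t).
  by apply: key => //; rewrite -(ger0_norm (_ : 0 <= _ - _))// subr_ge0.
rewrite distrC; apply: key => //.
by rewrite -(ger0_norm (_ : 0 <= _ - _)) ?subr_ge0// distrC.
Qed.

Lemma le_duh h k (t x : R) : ccurve h -> ccurve k -> I x ->
  (forall s y, 0 <= s <= t -> I y -> h s y <= k s y) ->
  duh h t x <= duh k t x.
Proof.
move=> ch ck Ix hk; apply: le_Rintegral_itv.
- exact: (ccurve_continuous (ccurve_heat_shift t ch) Ix).
- exact: (ccurve_continuous (ccurve_heat_shift t ck) Ix).
- move=> r /andP[r0 rt]; apply: heat_le => //; try exact: ccurve_L2.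
  by move=> y Iy; apply: hk => //; rewrite subr_ge0 rt gerBl.
Qed.

Lemma duhB h k (t x : R) : ccurve h -> ccurve k -> I x ->
  duh (fun s y => h s y - k s y) t x = duh h t x - duh k t x.
Proof.
move=> ch ck Ix; rewrite /duh -RintegralB//; last 2 first.
- by apply: integrable_itv; exact: (ccurve_continuous (ccurve_heat_shift t ch) Ix).
- by apply: integrable_itv; exact: (ccurve_continuous (ccurve_heat_shift t ck) Ix).
by apply: eq_Rintegral => r _; rewrite -heatB//; exact: ccurve_L2.
Qed.

Lemma duh_norm_le h (psi : R -> R) (t x : R) : ccurve h -> continuous psi -> I x ->
  (forall s y, 0 <= s <= t -> I y -> `|h s y| <= psi s) ->
  `|duh h t x| <= \int[mu]_(s in `[0, t]) psi s.
Proof.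
move=> ch cp Ix hp; rewrite -Rintegral_itv_reflect//.
have c1 := ccurve_continuous (ccurve_heat_shift t ch) Ix.
have c2 : continuous (fun s => psi (t - s)).
  move=> s; apply: (@continuous_comp _ _ _ (fun s => t - s) psi); last exact: cp.
  by apply: cvgB; [exact: cvg_cst|exact: cvg_id].
have [t0|t0] := ltP t 0; first by rewrite (duh_le0 _ _ (ltW t0)) normr0 Rintegral_itv_empty.
rewrite (le_trans (le_normr_Rintegral _ (integrable_itv 0 t c1)))//.
apply: le_Rintegral_itv => //.
  by move=> s; apply: cvg_norm; exact: c1.
move=> r /andP[r0 rt]; apply: heat_bound => //; first exact: ccurve_L2.
by move=> y Iy; apply: hp => //; rewrite subr_ge0 rt gerBl.
Qed.

(** Connects the pointwise Duhamel integral with the weak one in [is_L2_integral], undoing the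
    substitution r = t - s. *)
Lemma dot_duh h (t : R) phi : ccurve h -> L2 phi ->
  dotL2 (duh h t) phi = \int[mu]_(s in `[0, t]) dotL2 (heat (t - s) (h s)) phi.
Proof.
move=> ch lp; rewrite (ccurve_fubini 0 t (ccurve_heat_shift t ch) lp).
have cd := ccurve_dot (ccurve_heat_shift' t ch) lp.
rewrite -(Rintegral_itv_reflect t cd).
by apply: eq_Rintegral => r _; rewrite subKr.
Qed.

(** Variation of constants for the scalar equation y' = - lam y + h_n with y(0) = 0 and lam =
    [eigen n]. *)
Lemma coef_duh h (t : R) n : ccurve h ->
  coef (duh h t) n =
  expR (- (eigen n * t)) * \int[mu]_(s in `[0, t]) (expR (eigen n * s) * coef (h s) n).
Proof.
move=> ch; rewrite /coef (dot_duh t ch (L2_basis n)).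
rewrite -RintegralZl//; last first.
  apply: (integrable_itv (f := fun s => expR (eigen n * s) * coef (h s) n)) => s.
  apply: cvgM; last exact: (ccurve_dot ch (L2_basis n)).
  apply: (@continuous_comp _ _ _ (fun s => eigen n * s) expR); last exact: continuous_expR.
  by apply: cvgM; [exact: cvg_cst|exact: cvg_id].
apply: eq_Rintegral => s; rewrite inE/= in_itv/= => /andP[s0 st].
rewrite -/(coef _ _) coef_heat ?subr_ge0//; last exact: ccurve_L2.
by rewrite -/(coef _ _) mulrA -expRD; congr (expR _ * _); ring.
Qed.

Lemma duh_ge0 h (t x : R) : ccurve h -> I x ->
  (forall s y, 0 <= s <= t -> I y -> 0 <= h s y) -> 0 <= duh h t x.
Proof.
move=> ch Ix h0; apply: Rintegral_ge0 => r; rewrite /= in_itv/= => /andP[r0 rt].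
apply: heat_ge0 => //; first exact: ccurve_L2.
by move=> y Iy; apply: h0 => //; rewrite subr_ge0 rt gerBl.
Qed.

End duhamel.

(** * The linear equation by Picard iteration *)

Section linear_problem.
Context {R : realType}.
Implicit Types (f g u phi : R -> R) (h k : R -> R -> R).

Local Notation mu := (@lebesgue_measure R).
Local Notation I := (`[0, 1]%classic : set R).
Local Notation e_ := (@neumann_basis R).
Local Notation heat := (@neumann_heat R).

Lemma continuous_expR_scale (c : R) : continuous (fun s => expR (c * s)).
Proof.
move=> s; apply: (@continuous_comp _ _ _ (fun s => c * s) expR); last exact: continuous_expR.
by apply: cvgM; [exact: cvg_cst|exact: cvg_id].
Qed.

Lemma integral_expR (c t : R) : 0 <= t ->
  \int[mu]_(s in `[0, t]) (c * expR (c * s)) = expR (c * t) - 1.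
Proof.
move=> t0; have cc : continuous (fun s => c * expR (c * s)).
  by move=> s; apply: cvgM; [exact: cvg_cst|exact: continuous_expR_scale].
by rewrite (FTC2_global t0 (is_derive_expR_scale c) cc) mulr0 expR0.
Qed.

Section picard.
Variables (K : R) (W v0 : R -> R).
Hypotheses (K0 : 0 <= K) (cW : {within I, continuous W})
  (W01 : forall x, I x -> 0 <= W x <= K)
  (cv : {within I, continuous v0}) (v00 : forall x, I x -> 0 <= v0 x).

Let pot h (s x : R) := W x * h s x.

Let pic h (t x : R) := heat t v0 x + duh (pot h) t x.

Fixpoint picard (n : nat) : R -> R -> R :=
  if n is n'.+1 then pic (picard n') else fun t => heat t v0.

Let ccpot h : ccurve h -> ccurve (pot h).
Proof. by move=> ch; exact: ccurveM_within. Qed.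

Lemma ccurve_picard n : ccurve (picard n).
Proof.
elim: n => [|n IH] /=; first exact: ccurve_heat.
by apply: ccurveD; [exact: ccurve_heat|exact/ccurve_duh/ccpot].
Qed.

Lemma picard_ge n t x : I x -> heat t v0 x <= picard n t x.
Proof.
elim: n t x => [|n IH] t x Ix //=; rewrite /pic lerDl.
apply: duh_ge0 => //; first exact/ccpot/ccurve_picard.
move=> s y /andP[s0 st] Iy; rewrite mulr_ge0//; first by have /andP[] := W01 Iy.
by rewrite (le_trans _ (IH s y Iy))// heat_ge0//; exact: L2_cont.
Qed.

(** The bound reproduces itself: by the semigroup law, the source K e^(K s) S(s) v0 has Duhamel
    integral exactly (e^(K t) - 1) S(t) v0. *)
Lemma picard_le n t x : 0 <= t -> I x -> picard n t x <= expR (K * t) * heat t v0 x.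
Proof.
move=> + Ix; elim: n t x Ix => [|n IH] t x Ix t0 /=.
  rewrite ler_peMl//; first by apply: heat_ge0 => //; exact: L2_cont.
  by rewrite -expR0 ler_expR mulr_ge0.
pose y0 s := fun x => (K * expR (K * s)) * heat s v0 x.
have cy : ccurve y0.
  apply: ccurveM_scalar; last exact: ccurve_heat.
  by move=> s; apply: cvgM; [exact: cvg_cst|exact: continuous_expR_scale].
rewrite /pic (@le_trans _ _ (heat t v0 x + duh y0 t x))//.
  rewrite lerD2l; apply: le_duh => //; first exact/ccpot/ccurve_picard.
  move=> s y /andP[s0 st] Iy; rewrite /pot /y0 -mulrA.
  have /andP[W0 WK] := W01 Iy.
  apply: ler_pM => //; last exact: IH.
  by rewrite (le_trans _ (picard_ge n s Iy))// heat_ge0//; exact: L2_cont.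
have lv : L2 v0 by exact: L2_cont.
suff -> : duh y0 t x = (expR (K * t) - 1) * heat t v0 x by rewrite le_eqVlt; apply/orP; left; apply/eqP; ring.
have cr : continuous (fun r => K * expR (K * (t - r))).
  move=> r; apply: cvgM; first exact: cvg_cst.
  apply: (@continuous_comp _ _ _ (fun r => t - r) (fun s => expR (K * s))).
    by apply: cvgB; [exact: cvg_cst|exact: cvg_id].
  exact: continuous_expR_scale.
have cK : continuous (fun s => K * expR (K * s)).
  by move=> s; apply: cvgM; [exact: cvg_cst|exact: continuous_expR_scale].
rewrite -integral_expR// -(Rintegral_itv_reflect t cK) -RintegralZr//; last first.
  exact: integrable_itv cr.
apply: eq_Rintegral => r; rewrite inE/= in_itv/= => /andP[r0 rt].
rewrite /y0 heatZ; last exact: L2_heat.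
by rewrite heat_semigroup ?subr_ge0//; have -> : r + (t - r) = t by ring.
Qed.

Lemma picard_npos n t x : t <= 0 -> picard n t x = v0 x.
Proof.
by move=> t0; case: n => [|n] /=; rewrite ?/pic heat_le0// duh_le0// addr0.
Qed.

(** Measured against the weight e^(2 K t), each Duhamel integration with a potential of size at most
    K gains a factor 1 / 2, so that the increments decay geometrically however large t is. *)
Lemma picard_step (M : R) n t x : 0 <= t -> I x -> (forall x, I x -> v0 x <= M) ->
  `|picard n.+1 t x - picard n t x| <= M * expR (2 * K * t) * (2^-1) ^+ n.
Proof.
move=> t0 + hM; have lv : L2 v0 by exact: L2_cont.
have M0 : 0 <= M.
  have I0 : I 0 by apply/I01E; rewrite lexx ler01.
  exact: le_trans (v00 I0) (hM _ I0).
elim: n t x t0 => [|n IH] t x t0 Ix.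
  rewrite expr0 mulr1 ger0_norm ?subr_ge0; last exact: picard_ge.
  have h1 := @picard_le 1 t x t0 Ix.
  have h2 : heat t v0 x <= M.
    rewrite -[leRHS](heat_cst t M x); apply: heat_le => //; exact: L2_cst.
  have h0 : 0 <= heat t v0 x by exact: heat_ge0.
  have E1 : expR (K * t) <= expR (2 * K * t).
    by rewrite ler_expR -mulrA mulr_natl mulr2n lerDl mulr_ge0.
  rewrite (@le_trans _ _ (picard 1 t x))// ?gerBl//.
  rewrite (le_trans h1)// mulrC; apply: ler_pM => //; exact: expR_ge0.
have -> : picard n.+2 t x - picard n.+1 t x =
    duh (fun s y => pot (picard n.+1) s y - pot (picard n) s y) t x.
  rewrite (duhB t (ccpot (ccurve_picard n.+1)) (ccpot (ccurve_picard n)) Ix) /= /pic.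
  by ring.
pose psi s := (M * 2^-1 ^+ n.+1) * (2 * K * expR (2 * K * s)).
have cp2 : continuous (fun s => 2 * K * expR (2 * K * s)).
  by move=> s; apply: cvgM; [exact: cvg_cst|exact: continuous_expR_scale].
have cp : continuous psi by move=> s; apply: cvgM; [exact: cvg_cst|exact: cp2].
rewrite (@le_trans _ _ (\int[mu]_(s in `[0, t]) psi s))//.
  apply: duh_norm_le => //.
    by apply: ccurveB; exact/ccpot/ccurve_picard.
  move=> s y /andP[s0 st] Iy; rewrite /pot -mulrBr normrM.
  have /andP[W0 WK] := W01 Iy; rewrite ger0_norm//.
  rewrite (le_trans (ler_pM _ _ WK (IH s y s0 Iy)))//.
  by rewrite /psi exprSr le_eqVlt; apply/orP; left; apply/eqP; field.
rewrite RintegralZl//; last exact: integrable_itv.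
rewrite integral_expR// [leRHS]mulrAC ler_wpM2l//; last by rewrite gerBl.
by rewrite mulr_ge0// exprn_ge0.
Qed.

Lemma linear_solution : exists z : R -> R -> R, [/\ ccurve z,
  forall t x, I x -> z t x = heat t v0 x + duh (fun s y => W y * z s y) t x,
  forall t x, I x -> heat t v0 x <= z t x &
  forall t x, 0 <= t -> I x -> z t x <= expR (K * t) * heat t v0 x].
Proof.
have [M [M0 hM]] := within_bounded cv.
have {}hM x : I x -> v0 x <= M.
  by move=> /I01E h; rewrite (le_trans (ler_norm _))// hM.
pose inc (t x : R) n := picard n.+1 t x - picard n t x.
pose z t x := heat t v0 x + limn (series (inc t x)).
(* For t <= 0 all iterates equal v0; freezing the majorant at its value at 0 keeps it nondecreasing
   in t. *)
pose B (t : R) n := M * expR (2 * K * Num.max 0 t) * (2^-1 : R) ^+ n.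
have half1 : 0 <= (2^-1 : R) < 1 by rewrite invr_ge0 ler0n invf_lt1 ?ltr1n.
have cB t : cvgn (series (B t)) by apply: summable_geo.
have incB t x n : I x -> `|inc t x n| <= B t n.
  move=> Ix; rewrite /inc /B; have [t0|t0] := leP t 0.
    rewrite !picard_npos// subrr normr0 !mulr_ge0 ?exprn_ge0// expR_ge0.
  by apply: picard_step => //; exact: ltW.
have sE t x N : series (inc t x) N = picard N t x - heat t v0 x.
  by rewrite /series/= telescope_sumr.
have zN t x N : I x -> `|z t x - picard N t x| <= limn (series (B t)) - series (B t) N.
  move=> Ix; have := series_tail N (fun n => incB t x n Ix) (cB t).
  by rewrite sE /z; congr (`|_| <= _); ring.
have zcvg t x : I x -> picard n t x @[n --> \oo] --> z t x.
  move=> Ix; have h := summable_norm (summable_le (fun n => incB t x n Ix) (cB t)).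
  have : (fun n => heat t v0 x + series (inc t x) n) @ \oo --> z t x.
    by apply: cvgD; [exact: cvg_cst|exact: h].
  by under eq_fun do rewrite sE addrC subrK.
(* The ratio q <= 1 of [B t] to [B T] is independent of n, so the remainders of the two series have
   the same ratio. *)
have Bmono (t T : R) N : t <= T ->
    limn (series (B t)) - series (B t) N <= limn (series (B T)) - series (B T) N.
  move=> tT.
  pose q := expR (2 * K * Num.max 0 t) / expR (2 * K * Num.max 0 T).
  have q1 : q <= 1.
    rewrite /q ler_pdivrMr ?expR_gt0// mul1r ler_expR ler_wpM2l ?mulr_ge0//.
    by rewrite ge_max le_max lexx/= le_max tT orbT.
  have q0 : 0 <= q by rewrite divr_ge0 ?expR_ge0.
  have BE n : B t n = q * B T n.
    by rewrite /B /q; field; rewrite gt_eqF// expR_gt0.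
  have -> : series (B t) = fun n => q * series (B T) n.
    by apply/funext => n; rewrite /series/= big_distrr; apply: eq_bigr => i _; rewrite BE.
  have -> : limn (fun n => q * series (B T) n) = q * limn (series (B T)).
    by apply/cvg_lim => //; apply: cvgM; [exact: cvg_cst|exact: cB].
  rewrite -mulrBr ler_piMl//.
  have := @series_tail _ (B T) (B T) N _ (cB T).
  have BT n : `|B T n| <= B T n.
    by rewrite ger0_norm// !mulr_ge0 ?exprn_ge0// expR_ge0.
  by move=> /(_ BT) /(le_trans (normr_ge0 _)).
have zunif (T e : R) : 0 < e -> exists n, forall t, t <= T -> forall x, I x ->
    `|z t x - picard n t x| <= e.
  move=> e0; have [N hN] := series_tail0 (cB T) e0.
  exists N => t tT x Ix; rewrite (le_trans (zN t x N Ix))// (le_trans (Bmono t T N tT))//.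
  by rewrite (le_trans (ler_norm _))// ltW.
have cz : ccurve z by apply: ccurve_lim zunif; exact: ccurve_picard.
exists z; split => //.
- move=> t x Ix.
  have h1 : picard n.+1 t x @[n --> \oo] --> z t x.
    by rewrite (cvg_shiftS (fun n => picard n t x)); exact: zcvg.
  suff h2 : picard n.+1 t x @[n --> \oo] --> heat t v0 x + duh (pot z) t x.
    by apply: (cvg_unique _ h1 h2).
  apply: cvgD; first exact: cvg_cst.
  apply/cvgrPdist_le => e e0.
  (* C dominates K t, so that K e / C integrated over [0, t] stays below e; the added ones keep C
     positive. *)
  pose C := (K + 1) * (`|t| + 1).
  have K1 : 0 < K + 1 by rewrite ltr_wpDl.
  have t1 : 0 < `|t| + 1 by rewrite ltr_wpDl.
  have C0 : 0 < C by rewrite mulr_gt0.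
  have eC : 0 < e / C by rewrite divr_gt0.
  have /cvgrPdist_lt /(_ _ eC) := cB t.
  apply: filterS => n /= hn.
  have cpn := ccurve_picard n.
  rewrite -duhB//; [|exact: ccpot..].
  rewrite (@le_trans _ _ (\int[mu]_(s in `[0, t]) (K * (e / C))))//.
    apply: (@duh_norm_le R _ (fun=> K * (e / C))) => //.
    + exact: (ccurveB (ccpot cz) (ccpot cpn)).
    + by move=> s; exact: cvg_cst.
    + move=> s y /andP[s0 st] Iy; rewrite /pot -mulrBr normrM.
      have /andP[W0 WK] := W01 Iy; rewrite ger0_norm//.
      apply: ler_pM => //; rewrite (le_trans (zN s y n Iy))//.
      rewrite (le_trans (Bmono s t n st))// (le_trans (ler_norm _))// ltW//.
  have [t0|t0] := ltP t 0; first by rewrite Rintegral_itv_empty// ltW.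
  rewrite Rintegral_itv_cst// subr0.
  have -> : K * (e / C) * t = e * (K * t / C) by ring.
  rewrite ler_piMr ?(ltW e0)// ler_pdivrMr// mul1r /C.
  by apply: ler_pM => //; [rewrite lerDl|rewrite (le_trans (ler_norm t))// lerDl].
- move=> t x Ix; apply: (cvgr_ge_near _ (zcvg t x Ix)); apply: nearW => n.
  exact: picard_ge.
- move=> t x t0 Ix; apply: (cvgr_le_near _ (zcvg t x Ix)); apply: nearW => n.
  exact: picard_le.
Qed.

End picard.

End linear_problem.

(** * Rescaling and regularity of mild solutions *)

Section rescaling.
Context {R : realType}.
Implicit Types (f g u phi psi : R -> R) (h k z : R -> R -> R).

Local Notation mu := (@lebesgue_measure R).
Local Notation I := (`[0, 1]%classic : set R).
Local Notation e_ := (@neumann_basis R).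
Local Notation heat := (@neumann_heat R).

(** Differentiability is asked only inside ]a, b[: coefficient curves can have a corner at 0, since
    the curves are extended to negative times by constants, and the cut amplitude used below can
    have one at the final time. *)
Lemma FTC2_open (F f : R -> R) (a b : R) : a <= b ->
  (forall x : R, a < x < b -> is_derive x (1 : R) F (f x)) ->
  {for a, continuous F} -> {for b, continuous F} -> continuous f ->
  \int[mu]_(x in `[a, b]) f x = F b - F a.
Proof.
rewrite le_eqVlt => /predU1P[<- _ _|ab dF ca cb cf].
  by rewrite set_itv1 Rintegral_set1 subrr.
rewrite /Rintegral (continuous_FTC2 (F := F) ab)//.
- exact: continuous_subspaceT.
- split.
  + by move=> x; rewrite in_itv/= => xab; case: (dF x xab).
  + by apply: cvg_at_right_filter.
  + by apply: cvg_at_left_filter.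
- move=> x; rewrite in_itv/= => xab; rewrite derive1E.
  by case: (dF x xab).
Qed.

Section mild_curve.
Variables (v0 : R -> R) (z h : R -> R -> R).
Hypotheses (cv : {within I, continuous v0}) (cz : ccurve z) (ch : ccurve h)
  (zE : forall t x, I x -> z t x = heat t v0 x + duh h t x).

Let hn n s := expR (eigen n * s) * coef (h s) n.

Lemma continuous_coef n : continuous (fun s => coef (h s) n).
Proof. exact: (ccurve_dot ch (L2_basis n)). Qed.

Lemma continuous_exp_coef n : continuous (fun s => expR (eigen n * s) * coef (h s) n).
Proof.
by move=> s; apply: cvgM; [exact: continuous_expR_scale|exact: continuous_coef].
Qed.

Lemma mild_coef (t : R) n : 0 <= t ->
  expR (eigen n * t) * coef (z t) n =
  coef v0 n + \int[mu]_(s in `[0, t]) (expR (eigen n * s) * coef (h s) n).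
Proof.
move=> t0.
have -> : coef (z t) n = coef (heat t v0 \+ duh h t) n.
  by apply: eq_coef => x /set_mem Ix; exact: zE.
rewrite fcoefD; [|exact/L2_heat/L2_cont|exact/ccurve_L2/ccurve_duh].
rewrite coef_heat//; last exact: L2_cont.
by rewrite coef_duh// -mulrDr mulrA -expRD subrr expR0 mul1r.
Qed.

(** By [coef_inj] the claim reduces to the product rule for phi E, where E(s) = e^(lam s) z_n(s) has
    derivative e^(lam s) h_n(s): the exponential removes the diffusion term. *)
Lemma mild_rescale phi psi (t x : R) : 0 <= t -> I x ->
  continuous phi -> continuous psi ->
  (forall s : R, 0 < s < t -> is_derive s (1 : R) phi (psi s)) ->
  phi t * z t x = heat t (fun y => phi 0 * v0 y) x +
    duh (fun s y => phi s * h s y + psi s * z s y) t x.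
Proof.
move=> t0 Ix cphi cpsi dphi.
have ck : ccurve (fun s y => phi s * h s y + psi s * z s y).
  by apply: ccurveD; exact: ccurveM_scalar.
have cpv : {within I, continuous (fun y => phi 0 * v0 y)}.
  by move=> y; apply: cvgM; [exact: cvg_cst|exact: cv].
have lv : L2 v0 by exact: L2_cont.
have lz s : L2 (z s) by exact: ccurve_L2.
have lh s : L2 (h s) by exact: ccurve_L2.
apply: (@coef_inj _ (fun x => phi t * z t x)
  (fun x => heat t (fun y => phi 0 * v0 y) x + duh (fun s y => phi s * h s y + psi s * z s y) t x)) => //.
- by move=> y; apply: cvgM; [exact: cvg_cst|exact: (cz.1 t)].
- by move=> y; apply: cvgD; [exact: heat_continuous|exact: (ccurve_duh ck).1].
move=> n; rewrite fcoefZ//.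
rewrite [RHS](@fcoefD _ (heat t (fun y => phi 0 * v0 y)) (duh (fun s y => phi s * h s y + psi s * z s y) t)); last 2 first.
- by apply: L2_heat; exact: L2_cont.
- exact/ccurve_L2/ccurve_duh.
rewrite coef_heat//; last exact: L2_cont.
rewrite coef_duh// fcoefZ//.
set lam := eigen n; pose E s := expR (lam * s) * coef (z s) n.
have cE : continuous E.
  move=> s; apply: cvgM; first exact: continuous_expR_scale.
  exact: (ccurve_dot cz (L2_basis n)).
have e1 : expR (- (lam * t)) * expR (lam * t) = 1.
  by rewrite -expRD addrC subrr expR0.
suff : phi t * E t - phi 0 * E 0 = \int[mu]_(s in `[0, t])
    (expR (lam * s) * coef (fun y => phi s * h s y + psi s * z s y) n).
  move=> H; rewrite -H.
  have E0 : E 0 = coef v0 n.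
    by rewrite /E (mild_coef n (lexx 0)) set_itv1 Rintegral_set1 addr0.
  rewrite E0 /E.
  transitivity (expR (- (lam * t)) * expR (lam * t) * (phi t * coef (z t) n)).
    by rewrite e1 mul1r.
  ring.
have dE (s : R) : 0 < s -> is_derive s (1 : R) E (hn n s).
  move=> s0; pose P y := \int[mu]_(r in `[-1, y]) hn n r.
  have dP : is_derive s (1 : R) P (hn n s).
    apply: is_derive_primitive; first exact: continuous_exp_coef.
    by rewrite (lt_trans _ s0)// ltrN10.
  apply: (@near_eq_is_derive _ _ _ (cst (coef v0 n - P 0) + P)).
    apply/nbhs_ballP; exists s => //= y; rewrite /ball/= => ys.
    have y0 : 0 <= y by move: ys; rewrite ltr_norml => /andP[_]; lra.
    rewrite /E (mild_coef n y0) /P/= fctE.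
    rewrite (@Rintegral_itv_cat _ (hn n) (-1) 0 y)//; last exact: continuous_exp_coef.
    by rewrite addrA subrK.
  by apply: is_derive_eq; rewrite add0r.
have dPE (s : R) : 0 < s < t -> is_derive s (1 : R) (phi * E)
    (expR (lam * s) * coef (fun y => phi s * h s y + psi s * z s y) n).
  move=> /andP[s0 st].
  have d1 := dE s s0; have d2 : is_derive s (1 : R) phi (psi s) by apply: dphi; rewrite s0.
  apply: is_derive_eq; rewrite (@fcoefD _ (fun y => phi s * h s y) (fun y => psi s * z s y)).
  - by rewrite !fcoefZ// /GRing.scale/= /E /hn; ring.
  - exact: L2Z.
  - exact: L2Z.
have ci : continuous (fun s => expR (lam * s) * coef (fun y => phi s * h s y + psi s * z s y) n).
  move=> s; apply: cvgM; first exact: continuous_expR_scale.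
  exact: (ccurve_dot ck (L2_basis n)).
have cPE (s : R) : {for s, continuous (phi * E)} by apply: cvgM; [exact: cphi|exact: cE].
by rewrite (FTC2_open t0 dPE (cPE 0) (cPE t) ci).
Qed.

(** The zeroth eigenvalue is 0: diffusion conserves mass, and only the source changes it. *)
Lemma mild_coef0_derive (s : R) : 0 < s ->
  is_derive s (1 : R) (fun s => coef (z s) 0) (coef (h s) 0).
Proof.
move=> s0; pose P y := \int[mu]_(r in `[-1, y]) coef (h r) 0.
have dP : is_derive s (1 : R) P (coef (h s) 0).
  apply: is_derive_primitive; first exact: continuous_coef.
  by rewrite (lt_trans _ s0)// ltrN10.
apply: (@near_eq_is_derive _ _ _ (cst (coef v0 0 - P 0) + P)).
  apply/nbhs_ballP; exists s => //= y; rewrite /ball/= => ys.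
  have y0 : 0 <= y by move: ys; rewrite ltr_norml => /andP[_]; lra.
  have := mild_coef 0 y0; have e0 : eigen 0 = 0 :> R by rewrite /eigen mul0r expr0n.
  rewrite e0 mul0r expR0 mul1r.
  under eq_Rintegral do rewrite mul0r expR0 mul1r.
  move=> ->; rewrite /P/= fctE.
  rewrite (@Rintegral_itv_cat _ (fun r => coef (h r) 0) (-1) 0 y)//; last exact: continuous_coef.
  by rewrite addrA subrK.
by apply: is_derive_eq; rewrite add0r.
Qed.

End mild_curve.
End rescaling.

(** * Summability of n |z_n(t)| at positive times *)

Section regularity.
Context {R : realType}.
Implicit Types (f g u phi psi : R -> R) (a : nat -> R) (h z : R -> R -> R).

Local Notation mu := (@lebesgue_measure R).
Local Notation I := (`[0, 1]%classic : set R).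
Local Notation e_ := (@neumann_basis R).
Local Notation heat := (@neumann_heat R).

Lemma sum_inv_sqr_le (n N : nat) : (0 < n)%N ->
  \sum_(n <= k < N) ((k.+1%:R ^+ 2)^-1 : R) <= n%:R^-1.
Proof.
move=> n0; have [nN|Nn] := leqP n N; last by rewrite big_geq ?invr_ge0 1?ltnW.
suff : \sum_(n <= k < N) ((k.+1%:R ^+ 2)^-1 : R) <= n%:R^-1 - N%:R^-1.
  by move=> h; rewrite (le_trans h)// gerBl invr_ge0.
rewrite -(subnKC nN); elim: (N - n)%N => [|m IH].
  by rewrite addn0 big_geq// subrr.
rewrite addnS big_nat_recr ?leq_addr//= (le_trans (lerD IH (lexx _)))//.
set x : R := (n + m)%:R; have x0 : 0 < x by rewrite ltr0n addn_gt0 n0.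
have -> : (n + m).+1%:R = x + 1 :> R by rewrite /x -natr1.
move: (n%:R^-1 : R) x x0 => q {}x x0; rewrite -subr_ge0.
have -> : q - (x + 1)^-1 - (q - x^-1 + ((x + 1) ^+ 2)^-1) = (x * (x + 1) ^+ 2)^-1.
  by field; rewrite !gt_eqF// addr_gt0.
by rewrite invr_ge0 mulr_ge0 ?sqr_ge0 ?ltW.
Qed.

Lemma eigen_ge (n : nat) : n%:R ^+ 2 <= eigen n :> R.
Proof. by rewrite /eigen exprMn ler_peMr ?sqr_ge0// pi_sqr_ge1. Qed.

Lemma expRN_le_inv (x : R) : 0 < x -> expR (- x) <= x^-1.
Proof.
move=> x0; rewrite expRN lef_pV2 ?posrE ?expR_gt0//.
by rewrite (le_trans _ (expR_ge1Dx x))// lerDr.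
Qed.

Lemma integral_expR_reflect (lam s t : R) : 0 < lam -> s <= t ->
  \int[mu]_(r in `[s, t]) expR (- (lam * (t - r))) <= lam^-1.
Proof.
move=> l0 st.
pose F r := lam^-1 * expR (- lam * t) * expR (lam * r).
have dF (x : R) : is_derive x (1 : R) F (expR (- (lam * (t - x)))).
  have d1 := is_derive_expR_scale lam x.
  have -> : F = (lam^-1 * expR (- lam * t)) \*: (fun r => expR (lam * r)) by [].
  apply: is_derive_eq; rewrite /GRing.scale/=.
  transitivity (lam^-1 * lam * (expR (- lam * t) * expR (lam * x))); first by ring.
  by rewrite mulVf ?gt_eqF// mul1r -expRD; congr expR; ring.
have ce : continuous (fun r => expR (- (lam * (t - r)))).
  move=> r; apply: (@continuous_comp _ _ _ (fun r => - (lam * (t - r))) expR); last exact: continuous_expR.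
  apply: cvgN; apply: cvgM; first exact: cvg_cst.
  by apply: cvgB; [exact: cvg_cst|exact: cvg_id].
rewrite (FTC2_global st dF ce) /F -mulrBr -mulrA ler_piMr ?invr_ge0 ?(ltW l0)//.
by rewrite mulrBr mulNr expRN mulVf ?gt_eqF ?expR_gt0// lerBlDr lerDl mulr_ge0 ?invr_ge0 ?expR_ge0.
Qed.

Lemma continuous_expR_reflect (lam t : R) : continuous (fun r => expR (- (lam * (t - r)))).
Proof.
move=> r; apply: (@continuous_comp _ _ _ (fun r => - (lam * (t - r))) expR); last exact: continuous_expR.
apply: cvgN; apply: cvgM; first exact: cvg_cst.
by apply: cvgB; [exact: cvg_cst|exact: cvg_id].
Qed.

Lemma expR_convolution_le (lam s t G : R) g : 0 < lam -> s <= t -> continuous g ->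
  0 <= G -> (forall r, s <= r <= t -> `|g r| <= G) ->
  `|\int[mu]_(r in `[s, t]) (expR (- (lam * (t - r))) * g r)| <= G / lam.
Proof.
move=> l0 st cg G0 gG.
have ce := @continuous_expR_reflect lam t.
have c1 : continuous (fun r => expR (- (lam * (t - r))) * g r).
  by move=> r; apply: cvgM; [exact: ce|exact: cg].
rewrite (le_trans (le_normr_Rintegral _ (integrable_itv s t c1)))//.
rewrite (@le_trans _ _ (\int[mu]_(r in `[s, t]) (G * expR (- (lam * (t - r))))))//.
  apply: le_Rintegral_itv.
  - by move=> r; apply: cvg_norm; exact: c1.
  - by move=> r; apply: cvgM; [exact: cvg_cst|exact: ce].
  - move=> r rst; rewrite normrM ger0_norm ?expR_ge0// mulrC.
    by rewrite ler_wpM2r ?expR_ge0// gG.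
rewrite RintegralZl//; last exact: integrable_itv.
by rewrite ler_wpM2l// integral_expR_reflect.
Qed.

Lemma coef_sup f (M : R) n : L2 f -> 0 <= M -> (forall x, I x -> `|f x| <= M) ->
  `|coef f n| <= M * 2.
Proof.
move=> lf M0 fM; rewrite (le_trans (dot_sup lf (L2_basis n) fM))// ler_wpM2l//.
rewrite -[leRHS]Rintegral_cst01; apply: le_Rintegral => //.
- by have := integrable_norm (L2_integrable (L2_basis n)).
- exact: L2_integrable (L2_cst 2).
- by move=> x _; exact: basis_le2.
Qed.

(** The factor 4 comes from (n + 1)^2 <= 4 n^2, the price of the shift that matches
    [summable_inv_sqr]. *)
Lemma inv_eigen_le (n : nat) : (0 < n)%N -> (eigen n)^-1 <= 4 / n.+1%:R ^+ 2 :> R.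
Proof.
move=> n0; have x0 : (0 : R) < n%:R by rewrite ltr0n.
have x1 : (1 : R) <= n%:R by rewrite ler1n.
have h := eigen_ge n; have e0 : 0 < eigen n :> R by rewrite (lt_le_trans _ h)// exprn_gt0.
have y0 : (0 : R) < n.+1%:R by rewrite ltr0n.
rewrite ler_pdivlMr ?exprn_gt0// mulrC ler_pdivrMr// (le_trans _ (ler_wpM2l _ h))//.
by rewrite -natr1; nra.
Qed.

Section mild_regularity.
Variables (v0 W : R -> R) (z : R -> R -> R).
Hypotheses (cv : {within I, continuous v0}) (cW : {within I, continuous W})
  (cz : ccurve z)
  (zE : forall t x, I x -> z t x = heat t v0 x + duh (fun s y => W y * z s y) t x).

Let h s y := W y * z s y.
Let ch : ccurve h. Proof. exact: ccurveM_within. Qed.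
Let hn n s := coef (h s) n.
Let chn n : continuous (hn n). Proof. exact: (ccurve_dot ch (L2_basis n)). Qed.

Lemma mild_coef_restart (s t : R) n : 0 <= s -> s <= t ->
  coef (z t) n = expR (- (eigen n * (t - s))) * coef (z s) n +
    \int[mu]_(r in `[s, t]) (expR (- (eigen n * (t - r))) * coef (h r) n).
Proof.
move=> s0 st; have t0 := le_trans s0 st.
have H1 := mild_coef cv ch zE n t0; have H2 := mild_coef cv ch zE n s0.
set lam := eigen n in H1 H2 *.
have ce : continuous (fun r => expR (lam * r) * coef (h r) n).
  exact: continuous_exp_coef.
rewrite (Rintegral_itv_cat ce s0 st) addrA -H2 in H1.
have -> : coef (z t) n = expR (- (lam * t)) * (expR (lam * t) * coef (z t) n).
  by rewrite mulrA -expRD addrC subrr expR0 mul1r.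
rewrite H1 mulrDr; congr (_ + _).
  by rewrite mulrA -expRD; congr (expR _ * _); ring.
rewrite -RintegralZl//; last exact: integrable_itv.
apply: eq_Rintegral => r _; rewrite mulrA -expRD; congr (expR _ * _); ring.
Qed.

(** The equation is restarted at a = t / 2 and the source coefficient h_n(r) is written as h_n(t)
    plus an increment. The part h_n(t) is square summable in n by Bessel's inequality and comes with
    a factor n / lam <= 1 / n; the increment is controlled by a modulus of continuity in time that
    gains another factor 1 / n. *)
Lemma mild_coef_summable (t : R) : 0 < t ->
  abs_summable (fun n => n%:R * coef (z t) n).
Proof.
move=> t0; pose a := t / 2.
have a0 : 0 < a by rewrite divr_gt0.
have at_ : a <= t by rewrite ler_pdivrMr// ler_peMr ?ler1n// ltW.
have [M2 [M20 hM2]] := ccurve_bounded 0 t ch.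
have [B0 [B00 hB0]] := coef_bounded (ccurve_L2 0 cz).
have [Kw [Kw0 hKw]] := within_bounded cW.
pose B := M2 * 2; have B_ge0 : 0 <= B by rewrite mulr_ge0.
have hB s n : 0 <= s <= t -> `|hn n s| <= B.
  by move=> s0t; apply: coef_sup => //; [exact: ccurve_L2|exact: hM2].
have lam0 n : (0 < n)%N -> 0 < eigen n :> R.
  by move=> n0; rewrite (lt_le_trans _ (eigen_ge n))// exprn_gt0// ltr0n.
pose C1 := B0 / a + B; have C10 : 0 <= C1 by rewrite addr_ge0// divr_ge0// ltW.
(* After time a the initial coefficient is damped by e^(- lam s) <= 1 / (lam a), and the bounded
   source contributes at most B / lam. *)
have zb s (k : nat) : a <= s <= t -> (0 < k)%N -> `|coef (z s) k| <= C1 / eigen k.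
  move=> /andP[as_ st] k0; have s0 := lt_le_trans a0 as_; have l0 := lam0 k k0.
  rewrite (mild_coef_restart k (lexx 0) (ltW s0)) subr0 (le_trans (ler_normD _ _))//.
  rewrite /C1 (mulrDl (B0 / a)) lerD//.
    rewrite normrM ger0_norm ?expR_ge0// mulrC -mulrA ler_pM ?hB0 ?expR_ge0//.
    have E1 : expR (- (eigen k * s)) <= (eigen k * s)^-1.
      by apply: expRN_le_inv; rewrite mulr_gt0.
    by rewrite (le_trans E1)// invfM mulrC ler_pM2r ?invr_gt0// lef_pV2 ?posrE.
  apply: expR_convolution_le => //; [exact: ltW|exact: chn|].
  by move=> r /andP[r0 rs]; apply: hB; rewrite r0 (le_trans rs).
pose C2 := C1 + B; have C20 : 0 <= C2 by rewrite addr_ge0.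
(* A Lipschitz constant independent of k: the factor lam lost in 1 - q <= lam (t - s) is recovered
   from the decay C1 / lam of the coefficient. *)
have zd s (k : nat) : a <= s <= t -> `|coef (z s) k - coef (z t) k| <= C2 * (t - s).
  move=> /andP[as_ st]; have s0 := lt_le_trans a0 as_.
  rewrite distrC (mild_coef_restart k (ltW s0) st).
  set J := \int[mu]_(r in _) _; set q := expR _.
  have -> : q * coef (z s) k + J - coef (z s) k = - ((1 - q) * coef (z s) k) + J by ring.
  rewrite (le_trans (ler_normD _ _))// /C2 (mulrDl C1) lerD//.
    rewrite normrN normrM; have ts : 0 <= t - s by rewrite subr_ge0.
    case: k @J @q => [|k] J q.
      by rewrite /q /eigen mul0r expr0n mul0r oppr0 expR0 subrr normr0 mul0r mulr_ge0.
    have l0 := lam0 k.+1 isT.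
    have q1 : `|1 - q| <= eigen k.+1 * (t - s).
      rewrite ger0_norm.
        by have := expR_ge1Dx (- (eigen k.+1 * (t - s))); rewrite -/q; lra.
      by rewrite subr_ge0 /q expR_le1 oppr_le0 mulr_ge0// ltW.
    have zk : `|coef (z s) k.+1| <= C1 / eigen k.+1 by apply: zb; rewrite ?as_.
    rewrite (le_trans (ler_pM _ _ q1 zk))// le_eqVlt; apply/orP; left; apply/eqP.
    by field; rewrite gt_eqF.
  apply: Rintegral_itv_norm_le => //.
    by move=> r; apply: cvgM; [exact: continuous_expR_reflect|exact: chn].
  move=> r /andP[sr rt]; rewrite normrM -[leRHS]mul1r ler_pM//.
    by rewrite ger0_norm ?expR_ge0// expR_le1 oppr_le0 mulr_ge0 ?eigen_ge0// subr_ge0.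
  by apply: hB; rewrite rt (le_trans _ sr)// ltW.
have zsum s : a <= s <= t -> abs_summable (coef (z s)).
  move=> ast; pose D := `|coef (z s) 0| + C1 * 4.
  have D0 : 0 <= D by rewrite addr_ge0// mulr_ge0.
  have hD k : `|coef (z s) k| <= D / k.+1%:R ^+ 2.
    case: k => [|k]; first by rewrite expr1n divr1 /D lerDl mulr_ge0.
    rewrite (le_trans (zb s k.+1 ast isT))// (le_trans (ler_wpM2l C10 (inv_eigen_le _)))//.
    by rewrite mulrA ler_wpM2r ?invr_ge0 ?sqr_ge0// /D lerDr.
  exact: (le_summable hD (summable_inv_sqr D0)).
pose C3 := 2 * C2 + 16 * C1; have C30 : 0 <= C3 by rewrite addr_ge0// mulr_ge0.
(* The cosine series is split at n: the Lipschitz bound serves for k < n, the decay 1 / k^2 beyond.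
   The cut n stays free and will be the index of the coefficient under estimate. In C3, 2 bounds
   |e_k|, and 16 is 2 for |e_k|, 2 for the two times, 4 from [inv_eigen_le]. *)
have zs s (n : nat) x : a <= s <= t -> (0 < n)%N -> I x ->
    `|z s x - z t x| <= C3 * (n%:R * (t - s) + n%:R^-1).
  move=> ast n0 Ix; have tt : a <= t <= t by rewrite at_ lexx.
  have ts : 0 <= t - s by rewrite subr_ge0; case/andP: ast.
  rewrite (cosine_inversion (cz.1 s) (zsum s ast) Ix).
  rewrite (cosine_inversion (cz.1 t) (zsum t tt) Ix).
  have hlim : series (fun k => coef (z s) k * e_ k x) N - series (fun k => coef (z t) k * e_ k x) N
      @[N --> \oo] --> cosser (coef (z s)) x - cosser (coef (z t)) x.
    by apply: cvgB; apply: cosser_cvg; exact: zsum.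
  apply: (cvgr_le_near _ (cvg_norm hlim)).
  exists n => // N /= nN; rewrite /series/= -sumrB.
  rewrite (le_trans (ler_norm_sum _ _ _))//.
  rewrite (@le_trans _ _ (\sum_(0 <= k < N) 2 * `|coef (z s) k - coef (z t) k|))//.
    by apply: ler_sum => k _; rewrite -mulrBl mulrC normrM ler_wpM2r// basis_le2.
  rewrite -big_distrr/= (@big_cat_nat _ _ _ n)//= (mulrDr 2) (mulrDr C3) lerD//.
    rewrite (@le_trans _ _ (2 * (\sum_(0 <= k < n) C2 * (t - s))))//.
      by rewrite ler_wpM2l// ler_sum// => k _; exact: zd.
    rewrite sumr_const_nat subn0 -[C2 * (t - s) *+ n]mulr_natl /C3 (mulrDl (2 * C2)).
    rewrite (_ : 2 * (n%:R * (C2 * (t - s))) = 2 * C2 * (n%:R * (t - s))); last by ring.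
    by rewrite lerDl !mulr_ge0.
  rewrite (@le_trans _ _ (2 * (\sum_(n <= k < N) (8 * C1) * (k.+1%:R ^+ 2)^-1)))//.
    rewrite ler_wpM2l//; apply: ler_sum_nat => k /andP[nk _].
    have k0 : (0 < k)%N := leq_trans n0 nk.
    rewrite (le_trans (ler_normB _ _))// (_ : 8 * C1 * _ = C1 * (4 / k.+1%:R ^+ 2) + C1 * (4 / k.+1%:R ^+ 2)).
      by rewrite lerD// (le_trans (zb _ k _ k0))// ler_wpM2l ?inv_eigen_le.
    by ring.
  rewrite -big_distrr/= (le_trans (ler_wpM2l _ (ler_wpM2l _ (sum_inv_sqr_le N n0))))//.
    by rewrite mulr_ge0.
  rewrite (_ : 2 * (8 * C1 * n%:R^-1) = 16 * C1 / n%:R); last by ring.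
  by rewrite /C3 (mulrDl (2 * C2)) lerDr !mulr_ge0// invr_ge0.
pose C4 := Kw * C3 * 2; have C40 : 0 <= C4 by rewrite !mulr_ge0.
(* The product W z mixes all coefficients of z, which is why its increment is bounded through the
   sup norm, where W enters by its bound Kw. *)
have hs s (n : nat) : a <= s <= t -> (0 < n)%N ->
    `|hn n s - hn n t| <= C4 * (n%:R * (t - s) + n%:R^-1).
  move=> ast n0; have ts : 0 <= t - s by rewrite subr_ge0; case/andP: ast.
  have lh r : L2 (h r) by exact: ccurve_L2.
  rewrite /hn -fcoefB//.
  have -> : C4 * (n%:R * (t - s) + n%:R^-1) = (Kw * (C3 * (n%:R * (t - s) + n%:R^-1))) * 2.
    by rewrite /C4; ring.
  apply: coef_sup; first exact: L2B.
    by rewrite !mulr_ge0// addr_ge0 ?invr_ge0// mulr_ge0.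
  move=> x Ix /=; rewrite /h -mulrBr normrM ler_pM//; last exact: zs.
  exact: hKw.
pose M n := `|n%:R * damp a (coef (z a)) n| + (2^-1 * hn n t ^+ 2 +
   (2 + 24 * C4) / n.+1%:R ^+ 2).
have tt : 0 <= t <= t by rewrite (ltW t0) lexx.
apply: (@le_summable R (fun n => n%:R * coef (z t) n) M); last first.
  have c1 : cvgn (series (fun n => `|n%:R * damp a (coef (z a)) n|)).
    have [Ba [_ hBa]] := coef_bounded (ccurve_L2 a cz).
    exact: (damp_n_summable a0 hBa).
  have c2 : cvgn (series (fun n => 2^-1 * hn n t ^+ 2)).
    apply: (@summable_bounded _ _ (2^-1 * dotL2 (h t) (h t))).
      by move=> n; rewrite mulr_ge0// ?sqr_ge0// invr_ge0.
    move=> N; rewrite /series/= -big_distrr/= ler_wpM2l ?invr_ge0//.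
    exact: (bessel N (ccurve_L2 t ch)).
  have c3 : cvgn (series (fun n => (2 + 24 * C4) / n.+1%:R ^+ 2)).
    by apply: summable_inv_sqr; rewrite addr_ge0// mulr_ge0.
  have -> : series M = fun N => series (fun n => `|n%:R * damp a (coef (z a)) n|) N +
     (series (fun n => 2^-1 * hn n t ^+ 2) N +
     series (fun n => (2 + 24 * C4) / n.+1%:R ^+ 2) N).
    by apply/funext => N; rewrite /series/= -!big_split.
  by apply: is_cvgD => //; exact: is_cvgD.
case=> [|m].
  rewrite mul0r normr0 addr_ge0// addr_ge0//.
    by rewrite mulr_ge0 ?sqr_ge0// invr_ge0.
  by rewrite divr_ge0 ?sqr_ge0// addr_ge0// mulr_ge0.
set n := m.+1; have n0 : (0 < n)%N by [].
have x0 : (0 : R) < n%:R by rewrite ltr0n.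
have l0 := lam0 n n0; set lam := eigen n in l0 *.
have nl : n%:R / lam <= n%:R^-1.
  rewrite ler_pdivrMr// -ler_pdivrMl ?invr_gt0// invrK -expr2; exact: eigen_ge.
have nn : (n%:R ^+ 2)^-1 <= 4 / n.+1%:R ^+ 2 :> R.
  have y0 : (0 : R) < n.+1%:R by rewrite ltr0n.
  rewrite ler_pdivlMr ?exprn_gt0// mulrC ler_pdivrMr ?exprn_gt0//.
  have x1 : (1 : R) <= n%:R by rewrite ler1n.
  by rewrite -natr1; nra.
have ce := @continuous_expR_reflect lam t.
(* The modulus is used with its free parameter equal to n. With tau = t - r, half of the exponential
   absorbs tau, by e^(- lam tau / 2) tau <= 2 / lam and n / lam <= 1 / n, leaving 3 C4 / n; the
   other half integrates to at most 2 / lam. *)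
have J1 : `|\int[mu]_(r in `[a, t]) (expR (- (lam * (t - r))) * (hn n r - hn n t))|
    <= 6 * C4 / (n%:R * lam).
  have cg : continuous (fun r => expR (- (lam * (t - r))) * (hn n r - hn n t)).
    by move=> r; apply: cvgM; [exact: ce|apply: cvgB; [exact: chn|exact: cvg_cst]].
  rewrite (le_trans (le_normr_Rintegral _ (integrable_itv a t cg)))//.
  have ce2 := @continuous_expR_reflect (lam / 2) t.
  rewrite (@le_trans _ _ (\int[mu]_(r in `[a, t]) (3 * C4 / n%:R * expR (- (lam / 2 * (t - r))))))//.
    apply: le_Rintegral_itv.
    - by move=> r; apply: cvg_norm; exact: cg.
    - by move=> r; apply: cvgM; [exact: cvg_cst|exact: ce2].
    - move=> r ar; have tr : 0 <= t - r by rewrite subr_ge0; case/andP: ar.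
      rewrite normrM ger0_norm ?expR_ge0//.
      rewrite (le_trans (ler_wpM2l (expR_ge0 _) (hs r n ar n0)))//.
      move: (t - r) tr => tau tau0.
      have -> : expR (- (lam * tau)) = expR (- (lam / 2 * tau)) * expR (- (lam / 2 * tau)).
        by rewrite -expRD; congr expR; field.
      have q0 := expR_ge0 (- (lam / 2 * tau)).
      have q1 : expR (- (lam / 2 * tau)) <= 1.
        by rewrite expR_le1 oppr_le0 mulr_ge0// divr_ge0// ltW.
      have q2 : expR (- (lam / 2 * tau)) * tau <= 2 / lam.
        move: tau0; rewrite le_eqVlt => /predU1P[<-|tau0].
          by rewrite mulr0 divr_ge0// ltW.
        have lt0 : 0 < lam / 2 * tau by rewrite mulr_gt0// divr_gt0.
        rewrite -ler_pdivlMr// (le_trans (expRN_le_inv lt0))//.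
        by rewrite !invfM invrK le_eqVlt; apply/orP; left; apply/eqP; ring.
      move: (expR _) q0 q1 q2 => q q0 q1 q2.
      have -> : q * q * (C4 * (n%:R * tau + n%:R^-1)) =
         C4 * (n%:R * (q * tau) + q * n%:R^-1) * q by ring.
      rewrite ler_wpM2r// (_ : 3 * C4 / n%:R = C4 * (3 / n%:R)); last by ring.
      rewrite ler_wpM2l//.
      have h1 : n%:R * (q * tau) <= 2 / n%:R.
        by rewrite (le_trans (ler_wpM2l _ q2)) ?(ltW x0)// mulrCA ler_wpM2l.
      have h2 : q * n%:R^-1 <= n%:R^-1 by rewrite ler_piMl// invr_ge0 ltW.
      have e3 : 3 / n%:R = 2 / n%:R + n%:R^-1 :> R by ring.
      by rewrite e3 lerD.
  rewrite RintegralZl//; last exact: integrable_itv.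
  have l20 : 0 < lam / 2 by rewrite divr_gt0.
  rewrite (le_trans (ler_wpM2l _ (integral_expR_reflect l20 at_)))//.
    by rewrite !mulr_ge0// invr_ge0 ltW.
  by rewrite le_eqVlt; apply/orP; left; apply/eqP; field; rewrite !gt_eqF.
have J2 : `|\int[mu]_(r in `[a, t]) (expR (- (lam * (t - r))) * hn n t)| <= `|hn n t| / lam.
  apply: expR_convolution_le => //.
  by move=> r; exact: cvg_cst.
have cnh : continuous (fun r => expR (- (lam * (t - r))) * (hn n r - hn n t)).
  by move=> r; apply: cvgM; [exact: ce|apply: cvgB; [exact: chn|exact: cvg_cst]].
have cnt : continuous (fun r => expR (- (lam * (t - r))) * hn n t).
  by move=> r; apply: cvgM; [exact: ce|exact: cvg_cst].
rewrite (mild_coef_restart n (ltW a0) at_) -/lam.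
have -> : \int[mu]_(r in `[a, t]) (expR (- (lam * (t - r))) * coef (h r) n) =
  \int[mu]_(r in `[a, t]) (expR (- (lam * (t - r))) * (hn n r - hn n t)) +
  \int[mu]_(r in `[a, t]) (expR (- (lam * (t - r))) * hn n t).
  rewrite -RintegralD//; [|exact: integrable_itv..].
  by apply: eq_Rintegral => r _; rewrite /hn; ring.
have ta : t - a = a by rewrite /a; field.
rewrite ta mulrDr (le_trans (ler_normD _ _))// /M lerD//.
rewrite mulrDr (le_trans (ler_normD _ _))// !normrM (ger0_norm (ltW x0)).
have k1 := ler_wpM2l (ltW x0) J1.
have k2 := ler_wpM2l (ltW x0) J2.
have k3 : n%:R * (6 * C4 / (n%:R * lam)) <= 24 * C4 / n.+1%:R ^+ 2.
  have -> : n%:R * (6 * C4 / (n%:R * lam)) = 6 * C4 * lam^-1 by field; rewrite !gt_eqF.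
  have -> : 24 * C4 / n.+1%:R ^+ 2 = 6 * C4 * (4 / n.+1%:R ^+ 2) by ring.
  by rewrite ler_wpM2l ?mulr_ge0// inv_eigen_le.
have k4 : n%:R * (`|hn n t| / lam) <= 2^-1 * hn n t ^+ 2 + 2 / n.+1%:R ^+ 2.
  have -> : n%:R * (`|hn n t| / lam) = `|hn n t| * (n%:R / lam) by ring.
  rewrite (le_trans (ler_wpM2l _ nl))//.
  rewrite -(real_normK (num_real (hn n t))); move: `|hn n t| => p.
  have -> : 2 / n.+1%:R ^+ 2 = 2^-1 * (4 / n.+1%:R ^+ 2) :> R.
    by move: ((n.+1%:R ^+ 2)^-1 : R) => Y; field.
  have := ler_wpM2l (_ : 0 <= 2^-1) nn; rewrite invr_ge0 => /(_ (ler0n _ _)).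
  rewrite -exprVn; move: (n%:R^-1 : R) (4 / n.+1%:R ^+ 2 : R) => y A hyA.
  have E : (p - y) ^+ 2 = p ^+ 2 - 2 * (p * y) + y ^+ 2 by ring.
  by have := sqr_ge0 (p - y); rewrite E; lra.
rewrite (le_trans (lerD (le_trans k1 k3) (le_trans k2 k4)))//.
by rewrite le_eqVlt; apply/orP; left; apply/eqP; ring.
Qed.

End mild_regularity.

End regularity.

(** * Termwise differentiation of cosine series *)

Section cosine_derivative.
Context {R : realType}.
Implicit Types (f g u phi psi : R -> R) (a : nat -> R).

Local Notation mu := (@lebesgue_measure R).
Local Notation I := (`[0, 1]%classic : set R).
Local Notation e_ := (@neumann_basis R).

Lemma sin_abs_le (x : R) : `|sin x| <= `|x|.
Proof.
wlog x0 : x / 0 <= x => [H|].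
  have [/H//|/ltW x0] := leP 0 x.
  by rewrite -normrN -[X in _ <= X]normrN -sinN H// oppr_ge0.
rewrite (ger0_norm x0) ler_norml sin_le_id// andbT -subr_ge0 opprK.
apply: (@ge0_of_derive _ (sin + id) (fun x => cos x + 1) _ _ _ x x0).
- by move=> y _; have := cos_geN1 y; lra.
- by rewrite !fctE/= sin0 addr0.
Qed.

Lemma cos_lipschitz (x y : R) : `|cos x - cos y| <= `|x - y|.
Proof.
rewrite cosB_prod normrN !normrM (ger0_norm (ler0n _ 2)).
have h1 := sin_max ((x + y) / 2); have h2 := sin_abs_le ((x - y) / 2).
rewrite (le_trans (ler_wpM2l _ (ler_pM _ _ h1 h2)))// mul1r normrM.
by rewrite (@ger0_norm _ 2^-1) ?invr_ge0// mulrC divfK ?pnatr_eq0.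
Qed.

Lemma basis_lipschitz n (x y : R) : `|e_ n x - e_ n y| <= n%:R * (2 * pi) * `|x - y|.
Proof.
rewrite !basisE -mulrBr normrM (ger0_norm (basis_scale_ge0 n)).
rewrite (le_trans (ler_pM _ _ (basis_scale_le2 n) (cos_lipschitz _ _)))//; first exact: basis_scale_ge0.
rewrite -mulrBr normrM (@ger0_norm _ (n%:R * pi)) ?mulr_ge0 ?pi_ge0//.
by rewrite le_eqVlt; apply/orP; left; apply/eqP; ring.
Qed.

Definition dbasis (n : nat) (x : R) : R :=
  basis_scale n * - (n%:R * pi * sin (n%:R * pi * x)).

Lemma basis_is_derive n (x : R) : is_derive x (1 : R) (e_ n) (dbasis n x).
Proof.
have h := is_derive_cos_scale (n%:R * pi) x.
have -> : e_ n = basis_scale n \*: (fun x => cos (n%:R * pi * x)).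
  by apply/funext => y; rewrite basisE.
exact: is_derive_eq.
Qed.

Lemma dbasis_le n (x : R) : `|dbasis n x| <= n%:R * (2 * pi).
Proof.
rewrite /dbasis normrM normrN (ger0_norm (basis_scale_ge0 n)) !normrM (ger0_norm (pi_ge0 R)).
rewrite (ger0_norm (ler0n _ n)).
have h : n%:R * pi * `|sin (n%:R * pi * x)| <= n%:R * pi.
  by rewrite ler_piMr ?sin_max// mulr_ge0// pi_ge0.
rewrite (le_trans (ler_pM _ _ (basis_scale_le2 n) h))//; first exact: basis_scale_ge0.
  by rewrite !mulr_ge0// pi_ge0.
by rewrite le_eqVlt; apply/orP; left; apply/eqP; ring.
Qed.

Lemma dbasis_continuous n : continuous (@dbasis n).
Proof.
move=> x; apply: cvgM; first exact: cvg_cst.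
apply: cvgN; apply: cvgM; first exact: cvg_cst.
apply: (@continuous_comp _ _ _ (fun x => n%:R * pi * x) sin).
  by apply: cvgM; [exact: cvg_cst|exact: cvg_id].
exact: continuous_sin.
Qed.

Section derivative.
Variable a : nat -> R.
Hypothesis sa : abs_summable (fun n => n%:R * a n).

Lemma abs_summable_of_n : abs_summable a.
Proof.
(* The weight n says nothing about a_0, so a geometric sequence starting at |a_0| is added to the
   majorant. *)
apply: (@le_summable R a (fun n => `|n%:R * a n| + `|a 0| * (2^-1) ^+ n)).
  case=> [|n]; first by rewrite mul0r normr0 add0r expr0 mulr1.
  have h1 : `|a n.+1| <= `|n.+1%:R * a n.+1|.
    by rewrite normrM ger0_norm// ler_peMl// ler1n.
  have h2 : 0 <= `|a 0| * 2^-1 ^+ n.+1.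
    by rewrite mulr_ge0// exprn_ge0// invr_ge0 ler0n.
  by rewrite (le_trans h1)// lerDl.
rewrite (_ : series _ = fun N => series (fun n => `|n%:R * a n|) N +
    series (fun n => `|a 0| * 2^-1 ^+ n) N).
  apply: is_cvgD => //; apply: summable_geo.
  by rewrite invr_ge0 ler0n invf_lt1 ?ltr1n.
by apply/funext => N; rewrite /series/= big_split.
Qed.

Definition dcosser (x : R) : R := limn (series (fun n => a n * dbasis n x)).

Let majorant : cvgn (series (fun n => `|n%:R * a n| * (2 * pi))).
Proof.
rewrite (_ : series _ = fun N => series (fun n => `|n%:R * a n|) N * (2 * pi)).
  by apply: is_cvgM => //; exact: is_cvg_cst.
by apply/funext => N; rewrite /series/= big_distrl.
Qed.

Lemma dcosser_continuous : continuous dcosser.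
Proof.
move=> x; apply: (@tannery R R (nbhs x) _ _ _ _ majorant).
- apply: nearW => y n; rewrite normrM (normrM n%:R) (ger0_norm (ler0n _ n)).
  by rewrite (mulrC n%:R) -mulrA ler_wpM2l// dbasis_le.
- by move=> n; apply: cvgM; [exact: cvg_cst|exact: dbasis_continuous].
Qed.

(** The difference quotients of e_n are bounded by 2 pi n, so Tannery's theorem at the punctured
    point 0 differentiates term by term. *)
Lemma cosser_is_derive (x : R) : is_derive x (1 : R) (cosser a) (dcosser x).
Proof.
have sa1 := abs_summable_of_n.
have H : limn (series (fun n => a n * (h^-1 * (e_ n (h + x) - e_ n x))))
    @[h --> 0^'] --> dcosser x.
  apply: (@tannery R R (0^') _ _ _ _ majorant).
    near=> h => n; have h0 : h != 0 by near: h; exact: nbhs_dnbhs_neq.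
    rewrite !normrM (ger0_norm (ler0n _ n)) (mulrC n%:R) -mulrA ler_wpM2l//.
    rewrite normfV ler_pdivrMl ?normr_gt0// mulrC.
    by rewrite (le_trans (basis_lipschitz _ _ _))// addrK.
  move=> n; apply: cvgM; first exact: cvg_cst.
  case: (basis_is_derive n x) => d1 d2.
  have := d1; rewrite /derivable => /cvg_ex[l hl].
  have hl2 : l = dbasis n x by rewrite -d2; apply/esym; exact: (cvg_lim _ hl).
  rewrite -hl2; move: hl; under eq_fun do rewrite [_ *: 1]mulr1.
  by [].
have E (h : R) : limn (series (fun n => a n * (h^-1 * (e_ n (h + x) - e_ n x)))) =
    h^-1 *: (cosser a (h + x) - cosser a x).
  apply/cvg_lim => //.
  rewrite (_ : series _ = fun N => h^-1 * (series (fun n => a n * e_ n (h + x)) N -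
     series (fun n => a n * e_ n x) N)).
    by apply: cvgM; [exact: cvg_cst|apply: cvgB; exact: cosser_cvg].
  apply/funext => N; rewrite /series/= -sumrB big_distrr/=.
  by apply: eq_bigr => n _; ring.
have {}H : h^-1 *: (cosser a (h + x) - cosser a x) @[h --> 0^'] --> dcosser x.
  by under eq_fun do rewrite -E.
apply: DeriveDef.
  rewrite /derivable; apply/cvg_ex; exists (dcosser x).
  by under eq_fun do rewrite [_ *: 1]mulr1; exact: H.
rewrite /derive; apply/cvg_lim => //.
by under eq_fun do rewrite [_ *: 1]mulr1; exact: H.
Unshelve. all: by end_near. Qed.

Lemma weak_derivative_cosser f : {in I, f =1 cosser a} -> weak_derivative f dcosser.
Proof.
move=> fa phi [sphi cphi].
(* The support of phi lies in the open interval, so both boundary terms of the integration by parts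
   vanish. *)
have z0 : phi 0 = 0.
  apply/eqP/negP => /negP h; have : `]0, 1[%classic (0 : R).
    by apply: cphi; apply: subset_closure.
  by rewrite /= in_itv/= ltxx.
have z1 : phi 1 = 0.
  apply/eqP/negP => /negP h; have : `]0, 1[%classic (1 : R).
    by apply: cphi; apply: subset_closure.
  by rewrite /= in_itv/= ltxx andbF.
have dphi (x : R) : is_derive x (1 : R) phi (phi^`()%classic x).
  have h : derivable phi x 1 := sphi 0%N x.
  by apply: (DeriveDef h); rewrite derive1E.
have cdphi : continuous (phi^`()%classic).
  move=> x; apply/differentiable_continuous/derivable1_diffP.
  by have := sphi 1%N x; rewrite derive1n1.
have cphi0 : continuous phi.
  by move=> x; apply/differentiable_continuous/derivable1_diffP; case: (dphi x).
have sa1 := abs_summable_of_n.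
have cc := cosser_continuous sa1.
have cd := dcosser_continuous.
have dF (x : R) : is_derive x (1 : R) (cosser a * phi)
    (cosser a x * phi^`()%classic x + dcosser x * phi x).
  have h1 := cosser_is_derive x; have h2 := dphi x.
  by apply: is_derive_eq; rewrite /GRing.scale/= [phi x * _]mulrC.
have c1 : continuous (fun x => cosser a x * phi^`()%classic x).
  by move=> x; apply: cvgM; [exact: cc|exact: cdphi].
have c2 : continuous (fun x => dcosser x * phi x).
  by move=> x; apply: cvgM; [exact: cd|exact: cphi0].
have c3 : continuous (fun x => cosser a x * phi^`()%classic x + dcosser x * phi x).
  by move=> x; apply: cvgD; [exact: c1|exact: c2].
have := FTC2_global ler01 dF c3.
rewrite !fctE/= z0 z1 !mulr0 subrr RintegralD//; try exact: integrable_itv.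
move=> /eqP; rewrite addr_eq0 => /eqP; rewrite -/(dotL2 dcosser phi) => <-.
by apply: eq_dot.
Qed.

Lemma Pplus_cosser f : {within I, continuous f} -> (forall x, x \in I -> 0 < f x) ->
  {in I, f =1 cosser a} -> Pplus f.
Proof.
move=> cf f0 fa; split => //; first exact: L2_cont.
exists dcosser; split; last exact: weak_derivative_cosser.
by apply/L2_cont/continuous_subspaceT; exact: dcosser_continuous.
Qed.

End derivative.
End cosine_derivative.

(** * Uniqueness in L^2 *)

Section uniqueness.
Context {R : realType}.
Implicit Types (f g w : R -> R).

Local Notation mu := (@lebesgue_measure R).
Local Notation I := (`[0, 1]%classic : set R).
Local Notation heat := neumann_heat.

(** Young's inequality optimized over its weight: with x = |<f, g>| and A = |f|^2, the choice x / A
    gives x^2 <= A B. *)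
Lemma dot_cauchy f g : L2 f -> L2 g ->
  dotL2 f g ^+ 2 <= dotL2 f f * dotL2 g g.
Proof.
move=> lf lg; set c := dotL2 f g.
have [->|c0] := eqVneq c 0; first by rewrite expr0n/= mulr_ge0// dot_ge0.
have {}c0 : 0 < `|c| by rewrite normr_gt0.
have young (a : R) : 0 < a -> `|c| <= (a * dotL2 f f + a^-1 * dotL2 g g) / 2.
  by move=> a0; exact: dot_young.
move: (dot_ge0 f) (dot_ge0 g) young; move: (dotL2 f f) (dotL2 g g) => A B A0 B0 young.
rewrite -real_normK ?num_real//; move: `|c| c0 young => x x0 young.
have [AE|An] := eqVneq A 0.
  (* If A = 0, this large weight brings the right-hand side below x, a contradiction. *)
  have := young ((B + 1) / x); rewrite divr_gt0// ?ltr_wpDl// => /(_ isT).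
  rewrite AE mulr0 add0r invf_div -ler_pdivrMr ?invr_gt0// invrK => h.
  have : B / (B + 1) < 1 by rewrite ltr_pdivrMr ?ltr_wpDl// mul1r ltrDl.
  move: h; rewrite mulrAC -mulrA => h h2.
  have : x * (B / (B + 1)) <= x * 1 by rewrite ler_pM2l// ltW.
  lra.
have {}An : 0 < A by rewrite lt_neqAle eq_sym An.
have := young (x / A); rewrite divr_gt0// => /(_ isT).
rewrite divfK ?gt_eqF// invf_div => h.
have {}h : x <= A / x * B by lra.
by rewrite expr2 -ler_pdivlMr// mulrAC.
Qed.

Lemma dotD_le f g : L2 f -> L2 g ->
  dotL2 (f \+ g) (f \+ g) <= 2 * dotL2 f f + 2 * dotL2 g g.
Proof.
move=> lf lg; have lfg := L2D lf lg.
rewrite dotDl// !dotDr// (dotC g f).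
have := dot_young ltr01 lf lg; rewrite invr1 !mul1r.
by have := ler_norm (dotL2 f g); lra.
Qed.

Lemma dotM_le f g (M : R) : measurable_fun I f ->
  (forall x, I x -> `|f x| <= M) -> L2 g ->
  dotL2 (f \* g) (f \* g) <= M ^+ 2 * dotL2 g g.
Proof.
move=> mf fM lg; have lfg := L2M_bounded mf fM lg.
have M0 : 0 <= M.
  by apply: le_trans (fM 0 _) => //; apply/I01E; rewrite lexx ler01.
rewrite -dotZl// /dotL2; apply: le_Rintegral => //.
- exact: L2_mul.
- exact: (L2_mul (L2Z _ lg) lg).
move=> x Ix /=; rewrite -!expr2 exprMn -mulrA -expr2 ler_wpM2r ?sqr_ge0//.
by rewrite -(real_normK (num_real (f x))) lerXn2r ?nnegrE ?normr_ge0// fM.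
Qed.

Section solutions.
Variables (V v0 : R -> R).
Hypotheses (cV : {within I, continuous V}) (l0 : L2 v0).

Lemma L2_reaction f : L2 f -> L2 (reaction V f).
Proof.
move=> lf; have [M [_ hM]] := within_bounded cV.
have mV : measurable_fun I V by exact: L2_measurable (L2_cont cV).
have lVf : L2 (V \* f).
  by apply: (L2M_bounded (M := M) mV) => // x Ix; apply: hM; apply/I01E.
by apply: (@L2_ext _ ((\- (V \* f)) \+ (fun x => dotL2 V f * f x))) => //;
  apply: L2D; [exact: L2N|exact: L2Z].
Qed.

Lemma timespan_le (T : \bar R) (s t : R) : 0 <= s <= t -> timespan T t -> timespan T s.
Proof.
move=> /andP[s0 st] [t0 tT]; split => //.
by apply: le_lt_trans tT; rewrite lee_fin.
Qed.

Lemma mild_bounded (T : \bar R) (v : R -> R -> R) (t : R) :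
  mild_solution V v0 T v -> timespan T t ->
  exists B, 0 <= B /\ forall s, 0 <= s <= t -> dotL2 (v s) (v s) <= B.
Proof.
move=> [lv cv _ _] Tt.
have [d d0 hd] : exists2 d : R, 0 < d & forall s : R, 0 <= s <= t -> 0 <= s <= t ->
    dotL2 (v s) (v s) <= d^-1.
  apply: (@itv_near_covering _ 0 t (fun (d : R) s => 0 <= s <= t ->
    dotL2 (v s) (v s) <= d^-1)).
  move=> s0 s0t; have Ts0 := timespan_le s0t Tt.
  have /(_ [set y | (y < 1%:E)%E]) := cv s0 Ts0.
  case.
    by apply: open_nbhs_nbhs; split => /=; [exact: open_ereal_lt_ereal|rewrite lte_fin].
  move=> d /= d0 hd.
  pose M := 2 + 2 * dotL2 (v s0) (v s0).
  have M0 : 0 < M by rewrite ltr_wpDr// mulr_ge0// dot_ge0.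
  (* M bounds |v s|^2 as soon as v s is within distance 1 of v s0, by |f + g|^2 <= 2 |f|^2 + 2
     |g|^2. *)
  exists (Num.min d M^-1); first by rewrite lt_min d0 invr_gt0.
  move=> s r; rewrite !lt_min => /andP[sd _] /andP[r0 /andP[_ rM]] st.
  have Ts := timespan_le st Tt; have ls := lv _ Ts; have ls0 := lv _ Ts0.
  have := hd s _ Ts; rewrite /ball/= distrC => /(_ sd).
  rewrite (L2norm_sqrt (L2B ls ls0)) lte_fin -[ltRHS]sqrtr1 ltr_sqrt// => h.
  have := dotD_le (L2B ls ls0) ls0.
  rewrite (_ : (v s \- v s0) \+ v s0 = v s); last first.
    by apply/funext => x /=; rewrite subrK.
  have : M <= r^-1 by rewrite -[M]invrK lef_pV2 ?posrE ?invr_gt0// ltW.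
  by rewrite /M; lra.
exists d^-1; split; first by rewrite invr_ge0 ltW.
by move=> s st; apply: hd.
Qed.

Lemma reactionB f g : L2 f -> L2 g -> reaction V f \- reaction V g =
  (\- (V \* (f \- g))) \+ ((fun x => dotL2 V f * (f \- g) x) \+
    (fun x => dotL2 V (f \- g) * g x)).
Proof.
move=> lf lg; have lV := L2_cont cV; rewrite dotBr//.
by apply/funext => x; rewrite /reaction/=; ring.
Qed.

(** The nonlinearity is quadratic, so its Lipschitz constant depends on bounds for both arguments;
    [mild_bounded] supplies them along solutions. The three terms of [reactionB] are estimated with
    M = sup |V| and the Cauchy-Schwarz inequality. *)
Lemma reaction_lipschitz (Bf Bg : R) : exists L, 0 <= L /\ forall f g,
  L2 f -> L2 g -> dotL2 f f <= Bf -> dotL2 g g <= Bg ->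
  dotL2 (reaction V f \- reaction V g) (reaction V f \- reaction V g) <=
    L * dotL2 (f \- g) (f \- g).
Proof.
have lV := L2_cont cV; have mV := L2_measurable lV.
have [M [M0 hM]] := within_bounded cV; pose A := dotL2 V V.
have A0 : 0 <= A := dot_ge0 V.
have {}hM x : I x -> `|V x| <= M by move=> Ix; apply: hM; apply/I01E.
exists (2 * M ^+ 2 + 4 * (A * `|Bf|) + 4 * (A * `|Bg|)); split.
  by rewrite !addr_ge0// ?mulr_ge0 ?sqr_ge0.
move=> f g lf lg /le_trans/(_ (ler_norm _)) hf /le_trans/(_ (ler_norm _)) hg.
have ld := L2B lf lg; have lVd := L2M_bounded mV hM ld.
rewrite reactionB//; set D := dotL2 (f \- g) (f \- g).
have D0 : 0 <= D := dot_ge0 _.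
apply: le_trans (dotD_le (L2N lVd) (L2D (L2Z _ ld) (L2Z _ lg))) _.
have h1 : dotL2 (\- (V \* (f \- g))) (\- (V \* (f \- g))) <= M ^+ 2 * D.
  rewrite (_ : dotL2 _ _ = dotL2 (V \* (f \- g)) (V \* (f \- g))).
    exact: dotM_le.
  by apply: eq_Rintegral => x _ /=; rewrite mulrNN.
have h2 := dotD_le (L2Z (dotL2 V f) ld) (L2Z (dotL2 V (f \- g)) lg).
have sq (c : R) w : L2 w ->
    dotL2 (fun x => c * w x) (fun x => c * w x) = c ^+ 2 * dotL2 w w.
  by move=> lw; rewrite dotZl ?dotZr ?mulrA ?expr2//; exact: L2Z.
rewrite (sq _ _ ld) (sq _ _ lg) -/D in h2.
have h3 : dotL2 V f ^+ 2 * D <= A * `|Bf| * D.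
  by rewrite ler_wpM2r// (le_trans (dot_cauchy lV lf))// ler_wpM2l.
have h4 : dotL2 V (f \- g) ^+ 2 * dotL2 g g <= A * `|Bg| * D.
  rewrite -mulrA (mulrC `|Bg|) mulrA ler_pM// ?sqr_ge0 ?dot_ge0//.
  exact: dot_cauchy.
move: h1 h2 h3 h4; rewrite -!mulrA; lra.
Qed.

(* One step of a Gronwall argument in which the constant, rather than the
   function, is iterated *)
Lemma mild_difference_step (T1 T2 : \bar R) (v u : R -> R -> R) (t0 : R) :
  mild_solution V v0 T1 v -> mild_solution V v0 T2 u ->
  timespan T1 t0 -> timespan T2 t0 -> exists k, 0 <= k /\ forall M : R,
  (forall s, 0 <= s <= t0 ->
    dotL2 (v s \- u s) (v s \- u s) <= M * expR (k * s)) ->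
  forall s, 0 <= s <= t0 ->
    dotL2 (v s \- u s) (v s \- u s) <= M / 2 * expR (k * s).
Proof.
move=> sv su T1t T2t.
have [Bv [Bv0 hBv]] := mild_bounded sv T1t.
have [Bu [Bu0 hBu]] := mild_bounded su T2t.
have [L [L0 hL]] := reaction_lipschitz Bv Bu.
have t00 : 0 <= t0 by case: T1t.
(* The Young weight exceeds the length of the time interval, so the term in D integrates to at most
   D / 2 and is absorbed on the left; k is then chosen so that al L / k <= 1 / 2. *)
pose al := t0 + 1; have al0 : 0 < al by rewrite ltr_wpDl.
have aL0 : 0 <= al * L by rewrite mulr_ge0// ltW.
pose k := 2 * (al * L) + 1; have k0 : 0 < k by rewrite ltr_wpDl// mulr_ge0.
exists k; split; first exact: ltW.
move=> M hM t tt0; have /andP[t_ge0 tle] := tt0.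
have M0 : 0 <= M.
  have := hM 0; rewrite lexx t00 mulr0 expR0 mulr1 => /(_ isT).
  exact: le_trans (dot_ge0 _).
have [lv _ _ iv] := sv; have [lu _ _ iu] := su.
have Tv s : 0 <= s <= t0 -> timespan T1 s by move=> h; exact: timespan_le T1t.
have Tu s : 0 <= s <= t0 -> timespan T2 s by move=> h; exact: timespan_le T2t.
have [lvt hv] := iv _ (Tv _ tt0); have [lut hu] := iu _ (Tu _ tt0).
set D := dotL2 _ _; set d := v t \- u t in D *.
have ld : L2 d := L2B (lv _ (Tv _ tt0)) (lu _ (Tu _ tt0)).
(* The weak Duhamel formula is tested with the difference d itself, which makes D reappear under the
   integral. *)
have [iv1 iv2] := hv _ ld; have [iu1 iu2] := hu _ ld.
have dE : d = (v t \- heat t v0) \- (u t \- heat t v0).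
  by apply/funext => x; rewrite /d/=; ring.
have : D <= \int[mu]_(s in `[0, t])
    (al * L * M / 2 * expR (k * s) + al^-1 * D / 2).
  rewrite {1}/D {1}dE dotBl// iv2 iu2 -RintegralB//.
  apply: le_Rintegral => //.
  - exact: (integrableB _ iv1 iu1).
  - apply: integrable_itv => s; apply: cvgD; last exact: cvg_cst.
    by apply: cvgM; [exact: cvg_cst|exact: continuous_expR_scale].
  move=> s; rewrite /= in_itv/= => /andP[s0 st].
  have ss0 : 0 <= s <= t0 by rewrite s0 (le_trans st).
  have lvs := lv _ (Tv _ ss0); have lus := lu _ (Tu _ ss0).
  have lrv := L2_reaction lvs; have lru := L2_reaction lus.
  rewrite -dotBl//; try exact: L2_heat.
  rewrite (_ : _ \- _ = heat (t - s) (reaction V (v s) \- reaction V (u s))); last first.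
    by apply/funext => x; rewrite heatB.
  apply: le_trans (ler_norm _) _.
  apply: le_trans (heat_dot_young _ al0 (L2B lrv lru) ld) _.
  rewrite [leRHS](_ : _ = (al * (L * (M * expR (k * s))) + al^-1 * D) / 2); last by ring.
  rewrite ler_pM2r ?invr_gt0// lerD2r ler_pM2l//.
  apply: le_trans (hL _ _ lvs lus (hBv _ ss0) (hBu _ ss0)) _.
  by rewrite ler_wpM2l// hM.
have cE : continuous (fun s : R => k * expR (k * s)).
  by move=> s; apply: cvgM; [exact: cvg_cst|exact: continuous_expR_scale].
have -> : \int[mu]_(s in `[0, t]) (al * L * M / 2 * expR (k * s) + al^-1 * D / 2) =
    al * L * M / 2 / k * (expR (k * t) - 1) + al^-1 * D / 2 * t.
  rewrite RintegralD//.
  - rewrite Rintegral_itv_cst// subr0; congr (_ + _).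
    rewrite -integral_expR// -RintegralZl//; last exact: integrable_itv.
    by apply: eq_Rintegral => s _; rewrite mulrA divfK ?gt_eqF.
  - apply: integrable_itv => s.
    by apply: cvgM; [exact: cvg_cst|exact: continuous_expR_scale].
  - by apply: integrable_itv => s; exact: cvg_cst.
have D0 : 0 <= D := dot_ge0 d.
have h1 : al^-1 * D / 2 * t <= D / 2.
  rewrite mulrAC ler_pM2r ?invr_gt0// mulrAC ler_piMl//.
  by rewrite ler_pdivrMl// mulr1 /al ler_wpDr.
have h2 : al * L / k <= 1 / 2.
  by rewrite ler_pdivrMr// /k div1r mulrDr mulKf ?pnatr_eq0// lerDl mulr1 invr_ge0.
have E1 : 0 < expR (k * t) by exact: expR_gt0.
have h3 : al * L * M / 2 / k * (expR (k * t) - 1) <= M / 4 * expR (k * t).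
  have -> : al * L * M / 2 / k = al * L / k * (M / 2) by ring.
  apply: (@le_trans _ _ (al * L / k * (M / 2) * expR (k * t))).
    by rewrite ler_wpM2l ?lerBlDr ?lerDl// mulr_ge0 ?divr_ge0 ?(ltW k0).
  rewrite ler_pM2r// (_ : M / 4 = 1 / 2 * (M / 2)); last by field.
  by rewrite ler_wpM2r ?divr_ge0.
move=> h4; have h5 := le_trans h4 (lerD h3 h1).
rewrite [D in D <= _ + _]splitr lerD2r in h5; rewrite [D]splitr (le_trans (lerD h5 h5))// -mulrDl.
by rewrite (_ : M / 4 + M / 4 = M / 2)//; field.
Qed.

(** Iterating the halving step n times from the bound 2 Bv + 2 Bu forces the squared distance to
    0. *)
Lemma mild_unique (T1 T2 : \bar R) (v u : R -> R -> R) (t : R) :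
  mild_solution V v0 T1 v -> mild_solution V v0 T2 u ->
  timespan T1 t -> timespan T2 t -> ae_eq01 (v t) (u t).
Proof.
move=> sv su T1t T2t; have t0 : 0 <= t by case: T1t.
have [lv _ _ _] := sv; have [lu _ _ _] := su.
have [Bv [Bv0 hBv]] := mild_bounded sv T1t.
have [Bu [Bu0 hBu]] := mild_bounded su T2t.
have [k [k0 hk]] := mild_difference_step sv su T1t T2t.
have hn n s : 0 <= s <= t -> dotL2 (v s \- u s) (v s \- u s) <=
    (2 * Bv + 2 * Bu) / 2 ^+ n * expR (k * s).
  elim: n s => [|n IH] s st.
    have lvs := lv _ (timespan_le st T1t); have lus := lu _ (timespan_le st T2t).
    rewrite expr0 divr1; apply: (@le_trans _ _ (2 * Bv + 2 * Bu)).
      apply: le_trans (dotD_le lvs (L2N lus)) _.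
      rewrite lerD// ler_pM2l//; first exact: hBv.
      rewrite (_ : dotL2 _ _ = dotL2 (u s) (u s)); first exact: hBu.
      by apply: eq_Rintegral => x _ /=; rewrite mulrNN.
    rewrite ler_peMr ?addr_ge0 ?mulr_ge0// -expR0 ler_expR mulr_ge0//.
    by case/andP: st.
  by rewrite exprSr invfM mulrA; exact: hk.
have ld : L2 (v t \- u t) by exact: L2B (lv _ T1t) (lu _ T2t).
have d0 : dotL2 (v t \- u t) (v t \- u t) = 0.
  apply/eqP; rewrite eq_le dot_ge0 andbT.
  have -> : 0 = (2 * Bv + 2 * Bu) * 0 * expR (k * t) :> R by rewrite mulr0 mul0r.
  apply: (@cvgr_ge_near _ _ \oo _ (fun n => (2 * Bv + 2 * Bu) / 2 ^+ n * expR (k * t))).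
    apply: cvgM; last exact: cvg_cst.
    apply: cvgM; first exact: cvg_cst.
    under eq_fun do rewrite -exprVn.
    by apply: cvg_expr; rewrite ger0_norm ?invf_lt1 ?invr_ge0 ?ltr1n.
  by apply: nearW => n; apply: hn; rewrite t0 lexx.
apply: filterS (dot0_ae ld d0); first exact: (ae_filter_ringOfSetsType mu).
move=> x /= H /H /eqP; by rewrite subr_eq0 => /eqP.
Qed.

End solutions.
End uniqueness.

(** * Mass, comparison in L^2 and blow-up of quotients *)

Section mass.
Context {R : realType}.
Implicit Types (f g w : R -> R).

Local Notation mu := (@lebesgue_measure R).
Local Notation I := (`[0, 1]%classic : set R).
Local Notation heat := neumann_heat.

Lemma mass_coef f : mass f = coef f 0.
Proof. by apply: eq_Rintegral => x _; rewrite basis0 mulr1. Qed.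

Lemma eq_mass f g : {in I, f =1 g} -> mass f = mass g.
Proof. by move=> fg; apply: eq_Rintegral => x xI; exact: fg. Qed.

Lemma massZ (c : R) f : L2 f -> mass (fun x => c * f x) = c * mass f.
Proof. by move=> lf; rewrite !mass_coef [LHS]dotZl//; exact: L2_basis. Qed.

Lemma mass_ae f g : L2 f -> L2 g -> ae_eq01 f g -> mass f = mass g.
Proof.
by move=> lf lg fg; rewrite !mass_coef; apply: dot_ae => //; exact: L2_basis.
Qed.

Lemma mass_heat (t : R) f : 0 <= t -> L2 f -> mass (heat t f) = mass f.
Proof.
move=> t0 lf; rewrite !mass_coef coef_heat//.
by rewrite /eigen mul0r expr0n/= mul0r oppr0 expR0 mul1r.
Qed.

Lemma le_dot01 w f g : L2 w -> L2 f -> L2 g -> (forall x, I x -> 0 <= w x) ->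
  (forall x, I x -> f x <= g x) -> dotL2 w f <= dotL2 w g.
Proof.
move=> lw lf lg w0 fg; apply: le_Rintegral => //; try exact: L2_mul.
by move=> x Ix; rewrite ler_wpM2l ?w0 ?fg.
Qed.

Lemma dot1 f : dotL2 (fun=> 1) f = mass f.
Proof. by apply: eq_Rintegral => x _; rewrite mul1r. Qed.

Lemma le_mass f g : L2 f -> L2 g -> (forall x, I x -> f x <= g x) -> mass f <= mass g.
Proof.
by move=> lf lg fg; rewrite -!dot1 le_dot01//; exact: L2_cst.
Qed.

Lemma le_dot_sqr f g : L2 f -> L2 g -> (forall x, I x -> `|f x| <= g x) ->
  dotL2 f f <= dotL2 g g.
Proof.
move=> lf lg fg; apply: le_Rintegral => //; try exact: L2_mul.
move=> x Ix; rewrite -!expr2 -(real_normK (num_real (f x))).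
have g0 : 0 <= g x by exact: le_trans (fg _ Ix).
by rewrite lerXn2r ?nnegrE// fg.
Qed.

Lemma dot_sqr_le f (M : R) : L2 f -> (forall x, I x -> `|f x| <= M) ->
  dotL2 f f <= M ^+ 2.
Proof.
move=> lf fM; have -> : M ^+ 2 = dotL2 (fun=> M) (fun=> M).
  by rewrite /dotL2 Rintegral_cst01.
by apply: le_dot_sqr => //; exact: L2_cst.
Qed.

(** Almost everywhere equal functions have the same cosine coefficients, and these separate
    continuous functions, endpoints included. *)
Lemma within_eq_ae f g : {within I, continuous f} -> {within I, continuous g} ->
  ae_eq01 f g -> {in I, f =1 g}.
Proof.
move=> cf cg fg x; rewrite inE => Ix; apply: coef_inj => // n.
by apply: dot_ae => //; [exact: L2_cont|exact: L2_cont|exact: L2_basis].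
Qed.

Lemma L2norm_ae f g : L2 f -> L2 g -> ae_eq01 f g -> L2norm f = L2norm g.
Proof.
move=> lf lg fg; rewrite !L2norm_sqrt// (dot_ae lf lg lf fg) dotC.
by rewrite (dot_ae lf lg lg fg).
Qed.

Lemma ccurve_L2norm_cvg (h : R -> R -> R) (s : R) : ccurve h ->
  L2norm (h t \- h s) @[t --> s] --> 0%E.
Proof.
move=> ch; have lh t := @ccurve_L2 R h t ch.
rewrite (_ : (fun t => _) =
    EFin \o (fun t => Num.sqrt (dotL2 (h t \- h s) (h t \- h s)))); last first.
  by apply/funext => t; rewrite L2norm_sqrt//; exact: L2B.
apply: cvg_EFin; first exact: nearW.
apply/cvgrPdist_le => e e0.
have [d d0 hd] := ch.2 s e e0.
apply/nbhs_ballP; exists d => //= t; rewrite /ball/= distrC => td.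
rewrite sub0r normrN ger0_norm ?sqrtr_ge0//.
rewrite -[leRHS](ger0_norm (ltW e0)) -sqrtr_sqr ler_sqrt ?sqr_ge0//.
apply: dot_sqr_le; first exact: L2B.
by move=> x Ix; exact: hd.
Qed.

Lemma cvg_quotient_pinfty (T c : R) (a q : R -> R) : 0 < c ->
  (forall t, t < T -> 0 < q t) -> {for T, continuous q} -> q T = 0 ->
  (\forall t \near T^'-, c <= a t) -> a t / q t @[t --> T^'-] --> +oo.
Proof.
move=> c0 q0 cq qT ca; apply/cvgryPge => A.
have A1 : 0 < `|A| + 1 by rewrite ltr_wpDl.
have h : \forall t \near T^'-, q t < c / (`|A| + 1).
  apply: (cvgr_lt (q T)); first exact: cvg_at_left_filter.
  by rewrite qT divr_gt0.
near=> t.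
have qt : 0 < q t by apply: q0; near: t; exact: nbhs_left_lt.
have h1 : q t < c / (`|A| + 1) by near: t.
have h2 : c <= a t by near: t.
rewrite ler_pdivlMr//; apply: le_trans h2.
rewrite ltr_pdivlMr// in h1; apply: le_trans (ltW h1).
rewrite mulrC ler_pM2l// (le_trans (ler_norm _))// lerDl//.
Unshelve. all: by end_near.
Qed.

End mass.

(** * The explicit solution *)

Section explicit_solution.
Context {R : realType}.

Local Notation mu := (@lebesgue_measure R).
Local Notation I := (`[0, 1]%classic : set R).
Local Notation heat := neumann_heat.

Variables (V v0 : R -> R) (K nu c : R) (z : R -> R -> R).
Hypotheses (cV : {within I, continuous V}) (nu0 : 0 < nu)
  (VK : forall x, I x -> nu <= V x <= K)
  (cv : {within I, continuous v0}) (c0 : 0 < c)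
  (vc : forall x, I x -> c <= v0 x)
  (cz : ccurve z)
  (zE : forall t x, I x ->
    z t x = heat t v0 x + duh (fun s y => (K - V y) * z s y) t x)
  (z_ge : forall t x, I x -> heat t v0 x <= z t x)
  (z_le : forall t x, 0 <= t -> I x -> z t x <= expR (K * t) * heat t v0 x).

Let I0 : I 0. Proof. by apply/I01E; rewrite lexx ler01. Qed.

Let lv : L2 v0 := L2_cont cv.
Let lV : L2 V := L2_cont cV.
Let lz t : L2 (z t) := ccurve_L2 t cz.

Let cW : {within I, continuous (fun x => K - V x)}.
Proof. by move=> x; apply: cvgB; [exact: cvg_cst|exact: cV]. Qed.

Let ch : ccurve (fun s y => (K - V y) * z s y).
Proof. exact: ccurveM_within. Qed.

Let K0 : 0 < K.
Proof. by have /andP[h1 h2] := VK I0; exact: lt_le_trans (le_trans h1 h2). Qed.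

Definition damped_mass (t : R) : R := expR (- K * t) * mass (z t).

Definition denominator (t : R) : R := 1 - mass v0 + damped_mass t.

Definition amplitude (t : R) : R := expR (- K * t) / denominator t.

Definition blowup_solution (t x : R) : R := amplitude t * z t x.

Local Notation g0 := (mass v0).
Local Notation m := damped_mass.
Local Notation q := denominator.
Local Notation phi := amplitude.

Lemma z_gec (t x : R) : I x -> c <= z t x.
Proof.
move=> Ix; apply: le_trans (z_ge t Ix).
by rewrite -(heat_cst t c x); apply: heat_le => //; exact: L2_cst.
Qed.

Lemma z0E (t x : R) : t <= 0 -> I x -> z t x = v0 x.
Proof. by move=> t0 Ix; rewrite zE// heat_le0// duh_le0// addr0. Qed.

Lemma initial_mass_gt0 : 0 < g0.
Proof.
apply: lt_le_trans c0 _; rewrite -[leLHS](@Rintegral_cst01 R).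
by apply: le_mass => //; exact: L2_cst.
Qed.

Lemma mass_z_ge (t : R) : 0 <= t -> g0 <= mass (z t).
Proof.
by move=> t0; rewrite -(mass_heat t0 lv); apply: le_mass => //; [exact: L2_heat|exact: z_ge].
Qed.

Lemma damped_mass_ge (t : R) : 0 <= t -> g0 * expR (- K * t) <= m t.
Proof. by move=> t0; rewrite mulrC ler_wpM2l ?expR_ge0 ?mass_z_ge. Qed.

Lemma damped_mass_gt0 (t : R) : 0 <= t -> 0 < m t.
Proof.
move=> t0; apply: lt_le_trans (damped_mass_ge t0).
by rewrite mulr_gt0 ?expR_gt0 ?initial_mass_gt0.
Qed.

Lemma damped_mass_le0 (t : R) : t <= 0 -> m t = expR (- K * t) * g0.
Proof.
move=> t0; congr (_ * _); apply: eq_mass => x; rewrite inE => Ix.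
exact: z0E.
Qed.

Lemma damped_mass0 : m 0 = g0.
Proof. by rewrite damped_mass_le0// mulr0 expR0 mul1r. Qed.

Lemma continuous_damped_mass : continuous m.
Proof.
have cm : continuous (fun t => mass (z t)).
  rewrite (_ : (fun t => _) = fun t => dotL2 (z t) (neumann_basis 0)).
    exact: (ccurve_dot cz (L2_basis 0)).
  by apply/funext => s; rewrite mass_coef.
by move=> t; apply: cvgM; [exact: continuous_expR_scale|exact: cm].
Qed.

Lemma continuous_denominator : continuous q.
Proof. by move=> t; apply: cvgD; [exact: cvg_cst|exact: continuous_damped_mass]. Qed.

Lemma continuous_dotV : continuous (fun t => dotL2 V (z t)).
Proof.
rewrite (_ : (fun t => _) = fun t => dotL2 (z t) V); first exact: ccurve_dot.
by apply/funext => t; rewrite dotC.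
Qed.

(** The mass of z has derivative K times itself minus <V, z>; the factor e^(- K s) cancels the first
    term. *)
Lemma damped_mass_derive (s : R) : 0 < s ->
  is_derive s (1 : R) m (- (expR (- K * s) * dotL2 V (z s))).
Proof.
move=> s0; have d1 := mild_coef0_derive cv ch zE s0.
have d2 := is_derive_expR_scale (- K) s.
rewrite (_ : m = (fun s => expR (- K * s)) \* (fun s => coef (z s) 0)); last first.
  by apply/funext => t; rewrite /m mass_coef.
apply: is_derive_eq.
rewrite -(mass_coef (z s)) (_ : coef _ 0 = K * mass (z s) - dotL2 V (z s)).
  by rewrite /GRing.scale/=; ring.
rewrite -mass_coef (_ : mass _ = mass ((fun x => K * z s x) \- (V \* z s))); last first.
  by apply: eq_mass => x _ /=; ring.
have lVz : L2 (V \* z s).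
  have [M [_ hM]] := within_bounded cV.
  exact: (L2M_bounded (M := M) (L2_measurable lV)).
rewrite mass_coef [LHS]dotBl//; [|exact: L2Z|exact: L2_basis].
rewrite -!/(coef _ 0) -!mass_coef massZ//.
Qed.

Lemma dotV_ge (s : R) : nu * mass (z s) <= dotL2 V (z s).
Proof.
rewrite -massZ// /mass; apply: le_Rintegral => //.
- by apply: L2_integrable; exact: L2Z.
- exact: L2_mul.
move=> x Ix; have /andP[h _] := VK Ix.
by rewrite ler_wpM2r// (le_trans (ltW c0))// z_gec.
Qed.

(** Since V >= nu and z >= 0, the derivative of the damped mass is at most - nu m, hence at most -
    nu r. *)
Lemma damped_mass_decay (a b r : R) : 0 <= a -> a <= b ->
  (forall s, a <= s <= b -> r <= m s) -> m b <= m a - nu * r * (b - a).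
Proof.
move=> a0 ab hr.
have cd : continuous (fun s : R => - (expR (- K * s) * dotL2 V (z s))).
  move=> s; apply: cvgN.
  by apply: cvgM; [exact: continuous_expR_scale|exact: continuous_dotV].
have := @FTC2_open R m (fun s => - (expR (- K * s) * dotL2 V (z s))) a b ab.
move=> /(_ _ (@continuous_damped_mass a) (@continuous_damped_mass b) cd) h.
have dm (x : R) : a < x < b ->
    is_derive x (1 : R) m (- (expR (- K * x) * dotL2 V (z x))).
  by case/andP => ax _; apply: damped_mass_derive; exact: le_lt_trans ax.
rewrite -lerBlDl -(h dm).
rewrite -mulNr -Rintegral_itv_cst//; apply: le_Rintegral_itv => //.
  by move=> s; exact: cvg_cst.
move=> s sab; rewrite lerN2; apply: (@le_trans _ _ (nu * m s)).
  by rewrite ler_pM2l// hr.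
by rewrite /m mulrCA ler_wpM2l ?expR_ge0 ?dotV_ge.
Qed.

Lemma damped_mass_decreasing (a b : R) : 0 <= a -> a < b -> m b < m a.
Proof.
move=> a0 ab; have b0 := le_trans a0 (ltW ab).
have := @damped_mass_decay a b (g0 * expR (- K * b)) a0 (ltW ab).
have p0 : 0 < nu * (g0 * expR (- K * b)) * (b - a).
  by rewrite !mulr_gt0 ?expR_gt0 ?initial_mass_gt0 ?subr_gt0.
move=> h; apply: le_lt_trans (h _) _; last by rewrite ltrBlDr ltrDl.
move=> s /andP[sa sb]; apply: le_trans (damped_mass_ge (le_trans a0 sa)).
by rewrite ler_pM2l ?initial_mass_gt0// ler_expR !mulNr lerN2 ler_pM2l.
Qed.

Lemma damped_mass_le (t : R) : 0 <= t -> m t <= g0.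
Proof.
rewrite -damped_mass0 le_eqVlt => /predU1P[<-//|t0].
by apply: ltW; exact: damped_mass_decreasing.
Qed.

Lemma denominator0 : q 0 = 1.
Proof. by rewrite /q damped_mass0 subrK. Qed.

Lemma denominator_decreasing (a b : R) : 0 <= a -> a < b -> q b < q a.
Proof. by move=> a0 ab; rewrite ltrD2l damped_mass_decreasing. Qed.

(** For a < 0, z is frozen at v0 and the damped mass is e^(- K a) g0 >= g0, so monotonicity extends
    across 0. *)
Lemma denominator_nonincreasing (a b : R) : a <= b -> 0 <= b -> q b <= q a.
Proof.
move=> ab b0; rewrite lerD2l.
have [a0|a0] := leP 0 a.
  move: ab; rewrite le_eqVlt => /predU1P[->//|ab].
  by rewrite ltW// damped_mass_decreasing.
apply: le_trans (damped_mass_le b0) _.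
rewrite damped_mass_le0 ?(ltW a0)// ler_peMl ?(ltW initial_mass_gt0)//.
by rewrite -expR0 ler_expR mulNr -mulrN mulr_ge0 ?(ltW K0)// oppr_ge0 ltW.
Qed.

(* If the initial mass exceeds 1, the solution lives until the damped mass
   has decreased by 1. *)
Lemma blowup_time : exists T : \bar R, [/\ (0 < T)%E,
  forall t, timespan T t -> 0 < q t,
  g0 <= 1 -> T = +oo%E &
  1 < g0 -> exists2 t : R, T = t%:E & 0 < t /\ q t = 0].
Proof.
have [g1|g1] := leP g0 1.
  exists +oo%E; split => //.
  move=> t [t0 _]; rewrite ltr_wpDl ?subr_ge0//; exact: damped_mass_gt0.
pose d := g0 - 1; have d0 : 0 < d by rewrite subr_gt0.
(* If the damped mass stayed above d up to this time, decay at rate nu d would have exhausted its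
   initial value g0, contradicting its positivity. *)
pose b := g0 / (nu * d).
have b0 : 0 < b by rewrite divr_gt0 ?mulr_gt0 ?initial_mass_gt0.
have [s sb sd] : exists2 s, 0 <= s <= b & m s < d.
  apply: contrapT => /forall2NP h.
  have h2 s : 0 <= s <= b -> d <= m s.
    by move=> sb; have [//|/negP] := h s; rewrite -leNgt.
  have := damped_mass_decay (lexx 0) (ltW b0) h2.
  rewrite damped_mass0 subr0 /b (mulrC (nu * d)) divfK ?gt_eqF ?mulr_gt0// subrr.
  by rewrite leNgt damped_mass_gt0// ltW.
have /andP[s0 _] := sb.
have cq : {within `[0, s], continuous q}.
  by apply: continuous_subspaceT; exact: continuous_denominator.
have qs : q s < 0 by rewrite /q /d in sd *; lra.
have [] := IVT s0 cq (v := 0).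
  by rewrite denominator0 ge_min le_max ler01 (ltW qs) orbT.
move=> t; rewrite in_itv/= => /andP[t0 _] qt.
have {}t0 : 0 < t.
  rewrite lt_neqAle t0 andbT; apply/eqP => t0'.
  by move: qt; rewrite -t0' denominator0 => /eqP; rewrite oner_eq0.
exists t%:E; split => //.
- by move=> r [r0]; rewrite lte_fin -qt => rt; exact: denominator_decreasing.
- by exists t.
Qed.

(* Agrees with the amplitude up to the time at which the denominator reaches
   d, and is continuous on all of R *)
Definition amplitude_cut (d s : R) : R := expR (- K * s) / Num.max (q s) d.

Lemma continuous_amplitude_cut (d : R) : 0 < d -> continuous (amplitude_cut d).
Proof.
move=> d0 s; apply: cvgM; first exact: continuous_expR_scale.
apply: cvgV; first by rewrite gt_eqF// lt_max d0 orbT.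
apply: (@continuous_max _ _ _ (fun=> d)); first exact: continuous_denominator.
exact: cvg_cst.
Qed.

Lemma amplitude_cutE (d s : R) : d <= q s -> amplitude_cut d s = phi s.
Proof. by move=> dq; rewrite /amplitude_cut max_l. Qed.

(** Here phi^2 <V, z> is phi times <V, phi z>, the nonlocal factor of the nonlinear equation, and -
    K phi undoes the shift by K in the linear one. *)
Lemma amplitude_derive (s : R) : 0 < s -> 0 < q s ->
  is_derive s (1 : R) phi (- K * phi s + phi s ^+ 2 * dotL2 V (z s)).
Proof.
move=> s0 qs; have d1 := damped_mass_derive s0.
have d2 := is_derive_expR_scale (- K) s.
have d3 : is_derive s (1 : R) q (- (expR (- K * s) * dotL2 V (z s))).
  have -> : q = cst (1 - g0) + m by [].
  by apply: is_derive_eq; rewrite add0r.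
have qn : q s != 0 by rewrite gt_eqF.
have d4 := is_deriveV qn d3.
rewrite [X in is_derive _ _ X _](_ : _ =
  (fun s => expR (- K * s)) * (fun s => (q s)^-1))//.
apply: is_derive_eq.
rewrite /phi /GRing.scale/= expr_div_n.
by field.
Qed.

Lemma amplitude_gt0 (s : R) : 0 < q s -> 0 < phi s.
Proof. by move=> qs; rewrite divr_gt0// expR_gt0. Qed.

Lemma amplitude0 : phi 0 = 1.
Proof. by rewrite /phi denominator0 divr1 mulr0 expR0. Qed.

Lemma L2_blowup_solution (t : R) : L2 (blowup_solution t).
Proof. exact: L2Z. Qed.

Lemma blowup_solution_within (t : R) : {within I, continuous (blowup_solution t)}.
Proof. by move=> x; apply: cvgM; [exact: cvg_cst|exact: (cz.1 t)]. Qed.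

Lemma mass_blowup_solution (t : R) : mass (blowup_solution t) = m t / q t.
Proof. by rewrite massZ// /phi mulrAC. Qed.

Lemma reaction_blowup_solution (s x : R) :
  reaction V (blowup_solution s) x = phi s * ((K - V x) * z s x) +
    (- K * phi s + phi s ^+ 2 * dotL2 V (z s)) * z s x.
Proof.
by rewrite /reaction dotZr// /blowup_solution; ring.
Qed.

(** [mild_rescale] with the amplitude cut at level q t. As q does not increase towards t, the cut is
    invisible up to time t, and the rescaled source phi (K - V) z + phi' z is the reaction term. *)
Lemma blowup_solution_duhamel (t : R) : 0 <= t -> 0 < q t ->
  is_L2_integral (fun s => heat (t - s) (reaction V (blowup_solution s))) 0 t
    (blowup_solution t \- heat t v0).
Proof.
move=> t0 qt.
pose p := amplitude_cut (q t).
pose r (s : R) := - K * p s + p s ^+ 2 * dotL2 V (z s).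
pose k (s y : R) := p s * ((K - V y) * z s y) + r s * z s y.
have pE s : s <= t -> p s = phi s.
  by move=> st; apply: amplitude_cutE; exact: denominator_nonincreasing.
have cp : continuous p by exact: continuous_amplitude_cut.
have cr : continuous r.
  move=> s; apply: cvgD.
    by apply: cvgM; [exact: cvg_cst|exact: cp].
  apply: cvgM; last exact: continuous_dotV.
  by apply: cvgM; exact: cp.
have ck : ccurve k by apply: ccurveD; exact: ccurveM_scalar.
have kE s : s <= t -> k s = reaction V (blowup_solution s).
  move=> st; apply/funext => x.
  by rewrite reaction_blowup_solution /k /r pE.
have wE x : I x -> (blowup_solution t \- heat t v0) x = duh k t x.
  move=> Ix; have := mild_rescale cv cz ch zE t0 Ix cp cr.
  have dp (s : R) : 0 < s < t -> is_derive s (1 : R) p (r s).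
    case/andP=> s0 st; have qs := denominator_decreasing (ltW s0) st.
    rewrite /r pE ?(ltW st)//.
    apply: (near_eq_is_derive _ (amplitude_derive s0 (lt_trans qt qs))).
    near=> y; apply/esym/amplitude_cutE/ltW.
    near: y; apply: (cvgr_gt (q s)) => //; exact: continuous_denominator.
  move=> /(_ dp); rewrite !pE// amplitude0 /= /blowup_solution => ->.
  rewrite (_ : (fun y => 1 * v0 y) = v0); last by apply/funext => y; rewrite mul1r.
  by rewrite addrC addKr.
split; first by apply: L2B; [exact: L2_blowup_solution|exact: L2_heat].
move=> f lf.
have cd : continuous (fun s => dotL2 (heat (t - s) (k s)) f).
  by apply: ccurve_dot => //; exact: ccurve_heat_shift'.
split.
  apply: eq_integrable (integrable_itv 0 t cd) => //= s.
  by rewrite inE/= in_itv/= => /andP[_ st]; rewrite kE.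
rewrite (@eq_dot _ _ (duh k t) f f)//; last first.
  by move=> x; rewrite inE => Ix; exact: wE.
rewrite (dot_duh t ck lf); apply: eq_Rintegral => s.
by rewrite inE/= in_itv/= => /andP[_ st]; rewrite kE.
Unshelve. all: by end_near.
Qed.

Lemma blowup_solution_mild (T : \bar R) : (forall t, timespan T t -> 0 < q t) ->
  mild_solution V v0 T blowup_solution.
Proof.
move=> qT; split.
- by move=> t _; exact: L2_blowup_solution.
(* Cutting at half the value q s, rather than at q s, leaves agreement on a two-sided neighbourhood
   of s. *)
- move=> s Ts; have qs := qT s Ts; pose p := amplitude_cut (q s / 2).
  have p0 : 0 < q s / 2 by rewrite divr_gt0.
  have sE : p s = phi s by apply: amplitude_cutE; rewrite ler_pdivrMr// ler_peMr ?ler1n// ltW.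
  have cpz : ccurve (fun t x => p t * z t x).
    exact: ccurveM_scalar (continuous_amplitude_cut p0) cz.
  apply: cvg_within_filter.
  apply: cvg_trans (ccurve_L2norm_cvg s cpz); apply: near_eq_cvg.
  near=> t; rewrite /blowup_solution sE /p amplitude_cutE//.
  apply: ltW; near: t; apply: (cvgr_gt (q s)).
    exact: continuous_denominator.
  by rewrite ltr_pdivrMr// ltr_pMr// ltr1n.
- apply: nearW => x Ix; rewrite /blowup_solution amplitude0 mul1r.
  by rewrite z0E.
- by move=> t Tt; apply: blowup_solution_duhamel; [case: Tt|exact: qT].
Unshelve. all: by end_near.
Qed.

(* Beyond the zero of the denominator a solution would have bounded L^2 norm,
   whereas the mass of the explicit one is unbounded. *)
Lemma Tmax_eq (T : \bar R) : (0 < T)%E -> (forall t, timespan T t -> 0 < q t) ->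
  (forall t : R, T = t%:E -> q t = 0) -> Tmax V v0 = T.
Proof.
move=> T0 qT Tq; apply/eqP; rewrite eq_le; apply/andP; split; last first.
  by apply: ereal_sup_ubound; exists blowup_solution; exact: blowup_solution_mild.
apply: ge_ereal_sup => T' [u su]; rewrite leNgt; apply/negP => TT'.
case: T => [t| |] in T0 qT Tq TT' *; [|by rewrite ltNge leey in TT'|by []].
rewrite lte_fin in T0.
have sv := blowup_solution_mild qT.
have T't : timespan T' t by split => //; exact: ltW.
have [B [B0 hB]] := mild_bounded su T't.
have [lu _ _ _] := su.
(* Before t the longer solution coincides with the explicit one, so its mass M is m / q.
   Cauchy-Schwarz against 1 gives M^2 <= B, and 2 M <= M^2 + 1 then gives M <= B + 1. *)
have h s : 0 <= s -> s < t -> m s <= (B + 1) * q s.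
  move=> s0 st; have ss : timespan t%:E s by split => //; rewrite lte_fin.
  have T's : timespan T' s by apply: timespan_le T't; rewrite s0 ltW.
  have uv := mild_unique cV su sv T's ss.
  rewrite -ler_pdivrMr ?qT// -mass_blowup_solution.
  rewrite -(mass_ae (lu _ T's) (L2_blowup_solution s) uv) -dot1.
  have c1 := dot_cauchy (L2_cst 1) (lu _ T's).
  have : dotL2 (fun=> 1) (u s) ^+ 2 <= B.
    apply: le_trans c1 _; rewrite {1}/dotL2 mulr1 Rintegral_cst01 mul1r.
    by apply: hB; rewrite s0 ltW.
  move: (dotL2 _ _) => M; have := sqr_ge0 (M - 1).
  by rewrite sqrrB1 => h1 h2; nra.
(* Limit of the previous bound from the left; as q t = 0 it contradicts the positivity of the damped
   mass. *)
have : m t <= (B + 1) * q t.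
  rewrite -subr_ge0.
  apply: (@cvgr_ge_near _ _ (t^'-) _ (fun s => (B + 1) * q s - m s)).
    apply: cvgB.
      by apply: cvgM; [exact: cvg_cst|apply: cvg_at_left_filter; exact: continuous_denominator].
    by apply: cvg_at_left_filter; exact: continuous_damped_mass.
  near=> s; rewrite subr_ge0; apply: h.
    by apply: ltW; near: s; exact: nbhs_left_gt.
  by near: s; exact: nbhs_left_lt.
rewrite (Tq t erefl) mulr0 leNgt damped_mass_gt0//; exact: ltW.
Unshelve. all: by end_near.
Qed.

Lemma blowup_solution_Pplus (t : R) : 0 < t -> 0 < q t ->
  Pplus (blowup_solution t).
Proof.
move=> t0 qt; have p0 := amplitude_gt0 qt.
have s1 := mild_coef_summable cv cW cz zE t0.
have coefE n : coef (blowup_solution t) n = phi t * coef (z t) n.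
  by rewrite [LHS]dotZl//; exact: L2_basis.
have s2 : abs_summable (fun n => n%:R * coef (blowup_solution t) n).
  apply: (@le_summable R _ (fun n => phi t * `|n%:R * coef (z t) n|)).
    by move=> n; rewrite coefE mulrCA normrM gtr0_norm.
  rewrite (_ : series _ = fun N => phi t * series (fun n => `|n%:R * coef (z t) n|) N).
    by apply: is_cvgM => //; exact: is_cvg_cst.
  by apply/funext => N; rewrite /series/= big_distrr.
apply: (Pplus_cosser s2).
- exact: blowup_solution_within.
- by move=> x; rewrite inE => Ix; rewrite mulr_gt0// (lt_le_trans c0)// z_gec.
- move=> x; rewrite inE => Ix; apply: cosine_inversion => //.
    exact: blowup_solution_within.
  exact: abs_summable_of_n.
Qed.

(** With E = e^(- K t), the denominator is at least 1 - g0 + g0 E, which exceeds E by (1 - g0) (1 -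
    E) >= 0. *)
Lemma amplitude_le1 (t : R) : 0 <= t -> g0 <= 1 -> phi t <= 1.
Proof.
move=> t0 g1; rewrite ler_pdivrMr ?mul1r.
  apply: (@le_trans _ _ (1 - g0 + g0 * expR (- K * t))).
    have : expR (- K * t) <= 1.
      by rewrite -expR0 ler_expR mulNr oppr_le0 mulr_ge0// ltW.
    move: (expR _) g1; move: g0 => g E h1 h2.
    by rewrite -subr_ge0 (_ : _ - _ = (1 - g) * (1 - E)) ?mulr_ge0 ?subr_ge0//; ring.
  by rewrite lerD2l damped_mass_ge.
by rewrite ltr_wpDl ?subr_ge0// damped_mass_gt0.
Qed.

(** Pointwise, phi z <= z <= e^(K t) S(t) v0 with all terms nonnegative, and S(t) contracts the L^2
    norm. *)
Lemma blowup_solution_norm_le (t : R) : 0 <= t -> 0 < q t -> g0 <= 1 ->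
  dotL2 (blowup_solution t) (blowup_solution t) <=
    expR (K * t) ^+ 2 * dotL2 v0 v0.
Proof.
move=> t0 qt g1; have p0 := amplitude_gt0 qt.
have lh := L2_heat t lv.
apply: (@le_trans _ _ (dotL2 (fun x => expR (K * t) * heat t v0 x)
    (fun x => expR (K * t) * heat t v0 x))).
  apply: le_dot_sqr; [exact: L2_blowup_solution|exact: L2Z|].
  move=> x Ix; have z0 : 0 < z t x by rewrite (lt_le_trans c0)// z_gec.
  rewrite gtr0_norm; last exact: (mulr_gt0 p0 z0).
  apply: le_trans (z_le t0 Ix).
  by rewrite ler_piMl ?(ltW z0)// amplitude_le1.
rewrite dotZl//; last exact: L2Z.
rewrite dotZr// mulrA -expr2 ler_wpM2l ?sqr_ge0//; exact: heat_dot_le.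
Qed.

Section blowup.
Variable T : R.
Hypotheses (T0 : 0 < T) (qT : q T = 0).

Let q_gt0 (t : R) : t < T -> 0 < q t.
Proof.
move=> tT; rewrite -qT; have [t0|t0] := leP 0 t.
  exact: denominator_decreasing.
apply: lt_le_trans (denominator_nonincreasing (ltW t0) (lexx 0)).
by rewrite qT denominator0.
Qed.

Lemma mass_blowup : m t / q t @[t --> T^'-] --> +oo.
Proof.
have mT : 0 < m T / 2 by rewrite divr_gt0// damped_mass_gt0// ltW.
apply: (cvg_quotient_pinfty mT q_gt0) => //; first exact: continuous_denominator.
near=> t; apply: ltW; near: t; apply: (cvgr_gt (m T)).
  by apply: cvg_at_left_filter; exact: continuous_damped_mass.
by rewrite ltr_pdivrMr// ltr_pMr ?ltr1n// damped_mass_gt0// ltW.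
Unshelve. all: by end_near.
Qed.

Lemma amplitude_blowup (b : R) : 0 < b -> b * phi t @[t --> T^'-] --> +oo.
Proof.
move=> b0; under eq_fun do rewrite /amplitude mulrA.
apply: (@cvg_quotient_pinfty _ T (b * expR (- K * T)) _ q) => //.
- by rewrite mulr_gt0// expR_gt0.
- exact: continuous_denominator.
by near=> t; rewrite ler_pM2l// ler_expR !mulNr lerN2 ler_pM2l.
Unshelve. all: by end_near.
Qed.

End blowup.

Section conclusions.
Variables (T : \bar R) (v : R -> R -> R).
Hypotheses (v0P : Pplus v0) (sv : mild_solution V v0 T v)
  (T0 : (0 < T)%E) (qT : forall t, timespan T t -> 0 < q t).

Let lsol t : timespan T t -> L2 (v t).
Proof. by case: sv => + _ _ _; exact. Qed.

Lemma solution_ae (t : R) : timespan T t -> ae_eq01 (blowup_solution t) (v t).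
Proof.
by move=> Tt; exact: (mild_unique cV (blowup_solution_mild qT) sv).
Qed.

Lemma mass_solution (t : R) : timespan T t -> mass (v t) = m t / q t.
Proof.
move=> Tt; rewrite -mass_blowup_solution; apply/esym/mass_ae.
- exact: L2_blowup_solution.
- exact: lsol.
- exact: solution_ae.
Qed.

Lemma timespan0 : timespan T 0.
Proof. by split. Qed.

Lemma mass_solution0 : mass (v 0) = g0.
Proof.
by rewrite (mass_solution timespan0) denominator0 divr1 damped_mass0.
Qed.

Lemma solution_Pplus (t : R) : timespan T t -> class_in Pplus (v t).
Proof.
(* The smoothing estimate holds for t > 0 only; at t = 0 the representative is v0 itself. *)
move=> Tt; have [t0 _] := Tt; move: t0; rewrite le_eqVlt => /predU1P[t0|t0].
  exists v0; split => //; rewrite -t0; case: sv => _ _ h _.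
  apply: filterS h; first exact: (ae_filter_ringOfSetsType mu).
  by move=> x h Ix; rewrite h.
exists (blowup_solution t); split; last exact: solution_ae.
by apply: blowup_solution_Pplus => //; exact: qT.
Qed.

(** The mass is m / q with q = m + (1 - g0), so the sign of 1 - g0 decides its position relative to
    1. The lower bound combines m >= g0 e^(- K t) with q <= 1, which is m <= g0. *)
Lemma solution_mass_trichotomy (t : R) : timespan T t ->
  [/\ 1 < g0 -> 1 < mass (v t), g0 = 1 -> mass (v t) = 1 &
      g0 < 1 -> g0 * expR (- (t * K)) <= mass (v t) /\ mass (v t) < 1].
Proof.
move=> Tt; rewrite mass_solution//; have qt := qT Tt.
have [t0 _] := Tt; split.
- by move=> g1; rewrite ltr_pdivlMr// mul1r /q; lra.
- by move=> g1; rewrite /q g1 subrr add0r divff// gt_eqF// damped_mass_gt0.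
move=> g1; split; last by rewrite ltr_pdivrMr// mul1r /q; lra.
rewrite (mulrC t) -mulNr.
apply: (le_trans (damped_mass_ge t0)).
rewrite ler_pdivlMr// ler_piMr//; first exact/ltW/damped_mass_gt0.
by have := damped_mass_le t0; rewrite /q; lra.
Qed.

Lemma solution_Pone : Pone v0 -> forall t, timespan T t -> class_in Pone (v t).
Proof.
move=> [_ g1] t Tt; have [u [Pu uv]] := solution_Pplus Tt.
exists u; split => //; split => //.
have [_ h _] := solution_mass_trichotomy Tt; rewrite -(h g1).
by apply: mass_ae => //; [case: Pu|exact: lsol].
Qed.

Lemma solution_norm_le (t : R) : timespan T t -> g0 <= 1 ->
  (L2norm (v t) <= (expR (t * K))%:E * L2norm v0)%E.
Proof.
move=> Tt g1; have [t0 _] := Tt.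
rewrite -(L2norm_ae (L2_blowup_solution t) (lsol Tt) (solution_ae Tt)).
rewrite !L2norm_sqrt//; last exact: L2_blowup_solution.
rewrite -EFinM lee_fin mulrC -[expR _]gtr0_norm ?expR_gt0// -sqrtr_sqr mulrC.
rewrite -sqrtrM ?sqr_ge0// ler_sqrt ?mulr_ge0 ?sqr_ge0 ?dot_ge0// mulrC.
rewrite (mulrC t) mulrC; apply: blowup_solution_norm_le => //; exact: qT.
Qed.

Section finite_time.
Variable t : R.
Hypotheses (Tt : T = t%:E) (qt : q t = 0).

Let t0 : 0 < t. Proof. by rewrite -lte_fin -Tt. Qed.

Let near_timespan : \forall s \near t^'-, timespan T s.
Proof.
near=> s; split; first by apply: ltW; near: s; exact: nbhs_left_gt.
by rewrite Tt lte_fin.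
Unshelve. all: by end_near.
Qed.

Lemma solution_mass_blowup : mass (v s) @[s --> t^'-] --> +oo.
Proof.
apply: cvg_trans (mass_blowup t0 qt); apply: near_eq_cvg.
by apply: filterS near_timespan => s Ts; rewrite mass_solution.
Qed.

(** A continuous representative is determined at every point of [0, 1], so u s x = phi s z s x >= c
    phi s, a lower bound independent of x that blows up with the amplitude. *)
Lemma solution_pointwise_blowup (u : R -> R -> R) (x : R) :
  continuous_version T v u -> I x -> u s x @[s --> t^'-] --> +oo.
Proof.
move=> uv Ix; apply: (@ger_cvgy _ _ _ _ (fun s => c * phi s)).
  apply: filterS near_timespan => s Ts; have [cu uvs] := uv s Ts.
  have ae : ae_eq01 (u s) (blowup_solution s).
    have sv1 := solution_ae Ts.
    apply: filterS2 uvs sv1; first exact: (ae_filter_ringOfSetsType mu).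
    by move=> y h1 h2 Iy; rewrite h1// h2.
  rewrite (within_eq_ae cu (@blowup_solution_within s) ae) ?inE//.
  rewrite mulrC ler_pM2l ?z_gec//; exact/amplitude_gt0/qT.
exact: amplitude_blowup.
Qed.

End finite_time.

End conclusions.

End explicit_solution.

Theorem mainTheorem5 (R : realType) (V : R -> R)
    (V_smooth : smooth_on01 V)
    (V_pos : forall x, x \in `[0, 1] -> 0 < V x)
    (v0 : R -> R) (v0_Pplus : Pplus v0)
    (v : R -> R -> R) (v_sol : mild_solution V v0 (Tmax V v0) v) :
  let supV := sup [set V x | x in `[0, 1]] in
  let g := fun t : R => mass (v t) in
  [/\ (* (i) *)
      forall t, timespan (Tmax V v0) t -> class_in Pplus (v t),
      (* (ii) *)
      (forall t, timespan (Tmax V v0) t ->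
        [/\ 1 < g 0 -> 1 < g t,
            g 0 = 1 -> g t = 1 &
            g 0 < 1 -> g 0 * expR (- (t * supV)) <= g t /\ g t < 1]) /\
      (Pone v0 -> forall t, timespan (Tmax V v0) t -> class_in Pone (v t)),
      (* (iii) *)
      g 0 <= 1 ->
        Tmax V v0 = +oo%E /\
        (forall t, 0 <= t ->
          (L2norm (v t) <= (expR (t * supV))%:E * L2norm v0)%E) &
      (* (iv) *)
      1 < g 0 ->
        [/\ (Tmax V v0 < +oo)%E,
            g t @[t --> (fine (Tmax V v0))^'-] --> +oo &
            forall u : R -> R -> R, continuous_version (Tmax V v0) v u ->
            forall x, x \in `[0, 1] ->
              u t x @[t --> (fine (Tmax V v0))^'-] --> +oo]].
Proof.
move=> supV g.
have [F [sF VF]] := V_smooth.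
have cV : {within `[0, 1]%classic, continuous V}.
  have cF : {within `[0, 1]%classic, continuous F}.
    apply: continuous_subspaceT => x.
    by apply/differentiable_continuous/derivable1_diffP; exact: (sF 0%N x).
  apply: subspace_eq_continuous cF => x xI; apply/esym; exact: VF.
have [M [M0 hM]] := within_bounded cV.
have VsupV x : x \in `[0, 1] -> V x <= supV.
  move=> xI; apply: ub_le_sup; last by exists x.
  exists M => _ [y yI <-]; apply: le_trans (ler_norm _) _.
  by apply: hM; rewrite /= in_itv in yI.
(* Compactness turns the pointwise positivity of V and of v0 into the uniform lower bounds nu = V a
   and c = v0 b. *)
have [a aI Va] := EVT_min ler01 cV.
have [v0_pos cv _ _] := v0_Pplus.
have [b bI vb] := EVT_min ler01 cv.
have nu0 : 0 < V a by exact: V_pos.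
have c0 : 0 < v0 b by apply: v0_pos; rewrite inE.
have VK x : `[0, 1]%classic x -> V a <= V x <= supV.
  by move=> Ix; rewrite Va// VsupV.
have vc x : `[0, 1]%classic x -> v0 b <= v0 x by exact: vb.
have K0 : 0 <= supV by rewrite (le_trans (ltW nu0))// VsupV.
have cW : {within `[0, 1]%classic, continuous (fun x => supV - V x)}.
  by move=> x; apply: cvgB; [exact: cvg_cst|exact: cV].
have W01 x : `[0, 1]%classic x -> 0 <= supV - V x <= supV.
  by move=> Ix; rewrite subr_ge0 VsupV//= gerBl ltW// V_pos.
have v00 x : `[0, 1]%classic x -> 0 <= v0 x.
  by move=> Ix; rewrite (le_trans (ltW c0))// vc.
have [z [cz zE z_ge z_le]] := linear_solution K0 cW W01 cv v00.
have [T [T0 qT T1 T2]] := blowup_time cV nu0 VK cv c0 vc cz zE z_ge.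
have TE : Tmax V v0 = T.
  apply: (Tmax_eq cV nu0 VK cv c0 vc cz zE z_ge T0 qT) => t Tt.
  have [g1|g1] := leP (mass v0) 1; first by rewrite T1 in Tt.
  have [s Ts [_ qs]] := T2 g1.
  by move: Ts; rewrite Tt => -[->].
rewrite TE in v_sol *.
have g0E : g 0 = mass v0.
  exact: (mass_solution0 cV nu0 VK cv c0 vc cz zE z_ge v_sol T0 qT).
rewrite g0E; split.
- exact: (solution_Pplus cV nu0 VK cv c0 vc cz zE z_ge v0_Pplus v_sol qT).
- split.
    exact: (solution_mass_trichotomy cV nu0 VK cv c0 vc cz zE z_ge v_sol qT).
  exact: (solution_Pone cV nu0 VK cv c0 vc cz zE z_ge v0_Pplus v_sol qT).
- move=> g1; rewrite (T1 g1); split=> // t t0.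
  apply: (solution_norm_le cV nu0 VK cv c0 vc cz zE z_ge z_le v_sol qT) => //.
  by rewrite (T1 g1); split => //; rewrite ltry.
- move=> g1; have [t Tt [t0 qt]] := T2 g1.
  rewrite Tt /=; split; first by rewrite ltry.
    exact: (solution_mass_blowup cV nu0 VK cv c0 vc cz zE z_ge v_sol T0 qT Tt qt).
  move=> u; rewrite -Tt => uv x xI.
  exact: (solution_pointwise_blowup cV nu0 VK cv c0 vc cz zE z_ge v_sol T0 qT Tt qt uv).
Qed.
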